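(* Let $G$ be a totally disconnected locally compact group, let $\mathscr{H}\leq \mathrm{Aut}(G)$ be flat, and let $\Phi(\mathscr{H})$ be its set of roots. Then the map $R:\mathscr{H}\to\mathbb{Z}^{\Phi(\mathscr{H})}$ defined by $R(\alpha)=\{\rho(\alpha)\}_{\rho\in\Phi(\mathscr{H})}$ is a homomorphism with kernel equal to $\mathscr{H}_u$ and range contained in $\bigoplus_{\rho\in\Phi(\mathscr{H})}\mathbb{Z}$. In particular, 1. $\{\rho\in\Phi(\mathscr{H})\mid \rho(\alpha)\neq 0\}$ is finite for each $\alpha\in\mathscr{H}$; and 2. $\mathscr{H}/\mathscr{H}_u$ is a free abelian group. The set $\Phi(\mathscr{H})$ is empty if and only if $\mathscr{H}$ is uniscalar, that is, $\mathscr{H}=\mathscr{H}_u$.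
   Context: $G$ is a totally disconnected locally compact (Hausdorff) group and $\mathrm{Aut}(G)$ is its group of bicontinuous automorphisms. For $\alpha\in\mathrm{Aut}(G)$ the scale is $s(\alpha)=\min\{[\alpha(U):\alpha(U)\cap U] : U\leq G \text{ compact open subgroup}\}$. A compact open subgroup $U$ is tidy (equivalently, minimizing) for $\alpha$ if this minimum is attained at $U$; equivalently, with $U_{\alpha+}=\bigcap_{n\geq0}\alpha^n(U)$ and $U_{\alpha-}=\bigcap_{n\geq 0}\alpha^{-n}(U)$, one has $U=U_{\alpha+}U_{\alpha-}$ and $\bigcup_{n\geq0}\alpha^{-n}(U_{\alpha-})$ is closed. A subgroup $\mathscr{H}\leq\mathrm{Aut}(G)$ is flat if there is a compact open subgroup $U$ of $G$ that is tidy for every $\alpha\in\mathscr{H}$. The uniscalar subset is $\mathscr{H}_u=\{\alpha\in\mathscr{H}\mid s(\alpha)=1=s(\alpha^{-1})\}$ (a normal subgroup of $\mathscr{H}$). A subgroup $H\leq G$ is $\mathscr{H}$-stable if $\alpha(H)=H$ for all $\alpha\in\mathscr{H}$. A scaling subgroup for $\mathscr{H}$ is a closed, non-compact, $\mathscr{H}$-stable subgroup $H\leq G$ having a compact, relatively open subgroup $W\leq H$ such that for every $\alpha\in\mathscr{H}$ either $\alpha(W)\geq W$ or $\alpha(W)\leq W$, and $H=\bigcup\{\alpha(W)\mid\alpha\in\mathscr{H}\}$. A root of the flat group $\mathscr{H}$ is a surjective homomorphism $\rho:\mathscr{H}\to\mathbb{Z}$ for which there are a scaling subgroup $H$ for $\mathscr{H}$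 and an integer $s_\rho>1$ such that $\Delta_H(\alpha|_H)=s_\rho^{\rho(\alpha)}$ for every $\alpha\in\mathscr{H}$, where $\Delta_H(\alpha|_H)$ is the module of the automorphism $\alpha|_H$ of $H$ (the factor $m(\alpha(W))/m(W)$ by which it scales a left Haar measure $m$ of $H$). The set of roots is denoted $\Phi(\mathscr{H})$. *)

(* Defs.v *)
From HB Require Import structures.
From mathcomp Require Import all_boot all_order all_algebra.
From mathcomp Require Import finmap.
From mathcomp Require Import all_classical all_reals all_analysis.

Set Implicit Arguments.
Unset Strict Implicit.
Unset Printing Implicit Defensive.

Local Open Scope classical_set_scope.
Local Open Scope ring_scope.
Local Open Scope group_scope.

Record subgroup (G : groupType) := Subgroup {
  sg_set :> set G;
  sg1 : sg_set 1;
  sgM : forall x y, sg_set x -> sg_set y -> sg_set (x * y);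
  sgV : forall x, sg_set x -> sg_set x^-1 }.

Arguments sg1 {G} s.
Arguments sgM {G} s {x y}.
Arguments sgV {G} s {x}.

Definition sgType (G : groupType) (H : subgroup G) : Type :=
  {x : G | x \in (H : set G)}.

Section SubgroupType.
Context (G : groupType) (H : subgroup G).
Local Notation T := (sgType H).

HB.instance Definition _ := SubChoice.copy T {x : G | x \in (H : set G)}.

Lemma sg_valP (x : T) : sg_set H (val x).
Proof. exact: set_mem (valP x). Qed.

Definition sg_elt (x : G) (Hx : sg_set H x) : T := Sub x (mem_set Hx).

Definition sg_one : T := sg_elt (sg1 H).
Definition sg_mul (x y : T) : T := sg_elt (sgM H (sg_valP x) (sg_valP y)).
Definition sg_inv (x : T) : T := sg_elt (sgV H (sg_valP x)).

Fact sg_mulA : associative sg_mul.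
Proof. by move=> x y z; apply: val_inj; rewrite /= mulgA. Qed.
Fact sg_mul1 : left_id sg_one sg_mul.
Proof. by move=> x; apply: val_inj; rewrite /= mul1g. Qed.
Fact sg_1mul : right_id sg_one sg_mul.
Proof. by move=> x; apply: val_inj; rewrite /= mulg1. Qed.
Fact sg_mulVl : left_inverse sg_one sg_inv sg_mul.
Proof. by move=> x; apply: val_inj; rewrite /= mulVg. Qed.
Fact sg_mulVr : right_inverse sg_one sg_inv sg_mul.
Proof. by move=> x; apply: val_inj; rewrite /= mulgV. Qed.

HB.instance Definition _ :=
  isGroup.Build T sg_mulA sg_mul1 sg_1mul sg_mulVl sg_mulVr.

End SubgroupType.

Definition left_coset (G : groupType) (x : G) (A : set G) : set G :=
  [set x * a | a in A].

Definition left_cosets (G : groupType) (A B : set G) : set (set G) :=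
  [set left_coset x B | x in A].

(* [A : B]; infinite indices get the junk value 0, which never occurs for
   an open subgroup B of a compact group A. *)
Definition coset_index (G : groupType) (A B : set G) : nat :=
  #|` fset_set (left_cosets A B)|%fset.

Record normal_subgroup (G : groupType) := NormalSubgroup {
  ns_subgroup :> subgroup G;
  ns_conj : forall x y, sg_set ns_subgroup y ->
    sg_set ns_subgroup (x * y * x^-1) }.

Arguments ns_conj {G} n x {y}.

(* G / N, with cosets as elements and the setwise product. *)
Definition quotient_group (G : groupType) (N : normal_subgroup G) : Type :=
  {C : set G | C \in left_cosets [set: G] N}.

Section Quotient.
Context (G : groupType) (N : normal_subgroup G).
Local Notation Q := (quotient_group N).

HB.instance Definition _ :=
  SubChoice.copy Q {C : set G | C \in left_cosets [set: G] N}.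

Definition set_mulg (A B : set G) : set G := [set x * y | x in A & y in B].
Definition set_invg (A : set G) : set G := [set x^-1 | x in A].

Lemma set_mulg_lcoset x y :
  set_mulg (left_coset x N) (left_coset y N) = left_coset (x * y) N.
Proof.
apply/seteqP; split => z /=.
  move=> [_ [a Na <-]] [_ [b Nb <-]] <-.
  exists (y^-1 * a * y * b); last by rewrite !mulgA mulgK.
  by apply: sgM => //; rewrite -{2}[y]invgK; exact: ns_conj.
move=> [a Na <-]; exists x; first by exists 1; [exact: sg1|rewrite mulg1].
by exists (y * a); [exists a|rewrite mulgA].
Qed.

Lemma set_invg_lcoset x : set_invg (left_coset x N) = left_coset x^-1 N.
Proof.
apply/seteqP; split => z /=.
  move=> [_ [a Na <-]] <-; exists (x * a^-1 * x^-1).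
    by apply: ns_conj; exact: sgV.
  by rewrite !mulgA mulVg mul1g invgM.
move=> [a Na <-]; exists (a^-1 * x); last by rewrite invgM invgK.
exists (x^-1 * a^-1 * x); last by rewrite !mulgA mulgV mul1g.
by rewrite -{2}[x]invgK; apply: ns_conj; exact: sgV.
Qed.

Lemma quotientP (C : Q) : exists x, val C = left_coset x N.
Proof. by have /set_mem[x _ <-] := valP C; exists x. Qed.

Fact quotient_mul_subproof (C D : Q) :
  set_mulg (val C) (val D) \in left_cosets [set: G] N.
Proof.
have [[x ->] [y ->]] := (quotientP C, quotientP D).
by apply/mem_set; exists (x * y) => //; rewrite set_mulg_lcoset.
Qed.

Fact quotient_inv_subproof (C : Q) :
  set_invg (val C) \in left_cosets [set: G] N.
Proof.
have [x ->] := quotientP C.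
by apply/mem_set; exists x^-1; rewrite ?set_invg_lcoset.
Qed.

Definition to_quotient (x : G) : Q :=
  Sub (left_coset x N) (mem_set (imageT _ x)).

Definition quotient_one : Q := to_quotient 1.
Definition quotient_mul (C D : Q) : Q := 
  Sub (set_mulg (val C) (val D)) (quotient_mul_subproof C D).
Definition quotient_inv (C : Q) : Q := 
  Sub (set_invg (val C)) (quotient_inv_subproof C).

Fact quotient_mulA : associative quotient_mul.
Proof.
move=> C D E; apply: val_inj => /=.
have [[x ->] [y ->] [z ->]] := And3 (quotientP C) (quotientP D) (quotientP E).
by rewrite !set_mulg_lcoset mulgA.
Qed.
Fact quotient_mul1 : left_id quotient_one quotient_mul.
Proof.
move=> C; apply: val_inj => /=; have [x ->] := quotientP C.
by rewrite set_mulg_lcoset mul1g.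
Qed.
Fact quotient_1mul : right_id quotient_one quotient_mul.
Proof.
move=> C; apply: val_inj => /=; have [x ->] := quotientP C.
by rewrite set_mulg_lcoset mulg1.
Qed.
Fact quotient_mulVl : left_inverse quotient_one quotient_inv quotient_mul.
Proof.
move=> C; apply: val_inj => /=; have [x ->] := quotientP C.
by rewrite set_invg_lcoset set_mulg_lcoset mulVg.
Qed.
Fact quotient_mulVr : right_inverse quotient_one quotient_inv quotient_mul.
Proof.
move=> C; apply: val_inj => /=; have [x ->] := quotientP C.
by rewrite set_invg_lcoset set_mulg_lcoset mulgV.
Qed.

HB.instance Definition _ := isGroup.Build Q quotient_mulA quotient_mul1
  quotient_1mul quotient_mulVl quotient_mulVr.

End Quotient.

(* The direct sum of copies of Z indexed by I, as a subset of Z^I. *)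
Definition direct_sum (I : Type) : set (I -> int) :=
  [set f | finite_set [set i | f i <> 0%R]].

Arguments direct_sum I : clear implicits.

Definition hom_to_additive (G : groupType) (A : zmodType) (f : G -> A) : Prop :=
  forall x y, f (x * y) = (f x + f y)%R.

Definition free_abelian (G : groupType) : Prop :=
  exists (I : Type) (f : G -> (I -> int)),
    [/\ hom_to_additive f, injective f & range f = direct_sum I].

HB.mixin Record isTopologicalGroup G & Topological G & Group G := {
  mulg_continuous : continuous (fun xy : G * G => xy.1 * xy.2);
  invg_continuous : continuous (fun x : G => x^-1) }.

#[short(type="topGroupType")]
HB.structure Definition TopologicalGroup :=
  {G of Topological G & Group G & isTopologicalGroup G}.

Definition tdlc (G : topGroupType) : Prop :=
  [/\ hausdorff_space G, locally_compact [set: G] &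
      totally_disconnected [set: G]].

Definition compact_open_subgroup (G : topGroupType) (U : subgroup G) : Prop :=
  compact (U : set G) /\ open (U : set G).

Section SubgroupTopology.
Context (G : topGroupType) (H : subgroup G).
Local Notation T := (sgType H).

HB.instance Definition _ := Topological.copy T (set_type (H : set G)).

Lemma sg_val_continuous : continuous (val : T -> G).
Proof. exact: (@initial_continuous (set_type (H : set G)) G set_val). Qed.

Lemma continuous_to_sg (X : topologicalType) (f : X -> T) :
  continuous (val \o f : X -> G) -> continuous f.
Proof.
exact: (@continuous_comp_initial (set_type (H : set G)) X G set_val).
Qed.

Fact sg_mulg_continuous : continuous (fun xy : T * T => xy.1 * xy.2).
Proof.
apply: continuous_to_sg => -[x y] /=.
apply: (@cvg_comp _ _ _ (fun xy : T * T => (val xy.1, val xy.2))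
  (fun xy : G * G => xy.1 * xy.2) _ (nbhs (val x, val y))); last first.
  exact: (@mulg_continuous G (val x, val y)).
apply: cvg_pair.
  by apply: (@cvg_comp _ _ _ fst val _ (nbhs x));
    [exact: cvg_fst|exact: sg_val_continuous].
by apply: (@cvg_comp _ _ _ snd val _ (nbhs y));
    [exact: cvg_snd|exact: sg_val_continuous].
Qed.

Fact sg_invg_continuous : continuous (fun x : T => x^-1).
Proof.
apply: continuous_to_sg => x.
apply: (@cvg_comp _ _ _ val (fun x : G => x^-1) _ (nbhs (val x))).
  exact: sg_val_continuous.
exact: invg_continuous.
Qed.

HB.instance Definition _ :=
  isTopologicalGroup.Build T sg_mulg_continuous sg_invg_continuous.

End SubgroupTopology.

(* The inverse is stored as data; it is determined by the automorphism, so
   equality of automorphisms is pointwise equality. *)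
Record caut (G : topGroupType) := CAut {
  caut_fun :> G -> G;
  caut_inv : G -> G;
  cautK : cancel caut_fun caut_inv;
  cautVK : cancel caut_inv caut_fun;
  cautM : {morph caut_fun : x y / x * y};
  caut_continuous : continuous caut_fun;
  caut_inv_continuous : continuous caut_inv }.

Section AutGroup.
Context (G : topGroupType).
Implicit Types a b c : caut G.

Lemma caut_eq a b : caut_fun a =1 caut_fun b -> a = b.
Proof.
move=> /funext; case: a => f g fK gK fM fc gc.
case: b => f' g' fK' gK' fM' fc' gc' /= E.
have E' : g = g' by apply/funext => x; rewrite -{1}[x]gK' -E fK.
case: _ / E in fK' gK' fM' fc' *; case: _ / E' in fK' gK' gc' *.
by congr CAut; exact: Prop_irrelevance.
Qed.

HB.instance Definition _ := gen_eqMixin (caut G).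
HB.instance Definition _ := gen_choiceMixin (caut G).

Definition caut1 : caut G :=
  @CAut G id id (fun=> erefl) (fun=> erefl) (fun _ _ => erefl)
    (fun x => @cvg_id _ (nbhs x)) (fun x => @cvg_id _ (nbhs x)).

Fact caut_mulM a b : {morph (a \o b : G -> G) : x y / x * y}.
Proof. by move=> x y; rewrite /= !cautM. Qed.

Fact caut_comp_continuous (f g : G -> G) :
  continuous f -> continuous g -> continuous (f \o g).
Proof. by move=> cf cg x; apply: continuous_comp; [exact: cg|exact: cf]. Qed.

Definition caut_mul a b : caut G :=
  @CAut G (a \o b) (caut_inv b \o caut_inv a)
    (can_comp (@cautK G a) (@cautK G b)) (can_comp (@cautVK G b) (@cautVK G a))
    (@caut_mulM a b)
    (caut_comp_continuous (@caut_continuous G a) (@caut_continuous G b))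
    (caut_comp_continuous (@caut_inv_continuous G b)
      (@caut_inv_continuous G a)).

Fact caut_invM a : {morph caut_inv a : x y / x * y}.
Proof. by move=> x y; apply: (can_inj (@cautK G a)); rewrite cautM !cautVK. Qed.

Definition caut_V a : caut G :=
  @CAut G (caut_inv a) a (@cautVK G a) (@cautK G a) (@caut_invM a)
    (@caut_inv_continuous G a) (@caut_continuous G a).

Fact caut_mulA : associative caut_mul.
Proof. by move=> a b c; exact: caut_eq. Qed.
Fact caut_mul1 : left_id caut1 caut_mul.
Proof. by move=> a; exact: caut_eq. Qed.
Fact caut_1mul : right_id caut1 caut_mul.
Proof. by move=> a; exact: caut_eq. Qed.
Fact caut_mulVl : left_inverse caut1 caut_V caut_mul.
Proof. by move=> a; apply: caut_eq => x; exact: cautK. Qed.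
Fact caut_mulVr : right_inverse caut1 caut_V caut_mul.
Proof. by move=> a; apply: caut_eq => x; exact: cautVK. Qed.

HB.instance Definition _ := isGroup.Build (caut G) caut_mulA caut_mul1
  caut_1mul caut_mulVl caut_mulVr.

End AutGroup.

Section Restriction.
Context (G : topGroupType) (L : subgroup G) (a : caut G).
Hypothesis aL : a @` (L : set G) = L.

Fact caut_restrict_in (x : sgType L) : sg_set L (a (val x)).
Proof.
have : (a @` (L : set G)) (a (val x)) by exists (val x) => //; exact: sg_valP.
by rewrite aL.
Qed.

Fact caut_restrict_inv_in (x : sgType L) : sg_set L (caut_inv a (val x)).
Proof.
have : (L : set G) (val x) by exact: sg_valP.
by move: (val x) => y; rewrite -{1}aL => -[z Lz <-]; rewrite cautK.
Qed.

Let f (x : sgType L) : sgType L := sg_elt (caut_restrict_in x).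
Let g (x : sgType L) : sgType L := sg_elt (caut_restrict_inv_in x).

Fact caut_restrictK : cancel f g.
Proof. by move=> x; apply: val_inj; rewrite /= cautK. Qed.
Fact caut_restrictVK : cancel g f.
Proof. by move=> x; apply: val_inj; rewrite /= cautVK. Qed.
Fact caut_restrictM : {morph f : x y / x * y}.
Proof. by move=> x y; apply: val_inj; rewrite /= cautM. Qed.
Fact caut_restrict_continuous : continuous f.
Proof.
apply: continuous_to_sg => x.
by apply: (@cvg_comp _ _ _ val a _ (nbhs (val x)));
  [exact: sg_val_continuous|exact: caut_continuous].
Qed.
Fact caut_restrict_inv_continuous : continuous g.
Proof.
apply: continuous_to_sg => x.
by apply: (@cvg_comp _ _ _ val (caut_inv a) _ (nbhs (val x)));
  [exact: sg_val_continuous|exact: caut_inv_continuous].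
Qed.

Definition caut_restrict : caut (sgType L) :=
  CAut caut_restrictK caut_restrictVK caut_restrictM
    caut_restrict_continuous caut_restrict_inv_continuous.

End Restriction.

(* Measurable types must be pointed; the identity is the base point. *)
Definition pointed_group (T : topGroupType) : Type := T.
HB.instance Definition _ (T : topGroupType) :=
  Topological.copy (pointed_group T) T.
HB.instance Definition _ (T : topGroupType) :=
  isPointed.Build (pointed_group T) (1 : T).

Notation borel T := (g_sigma_algebraType (@open (pointed_group T))).

Section Haar.
Context (R : realType) (T : topGroupType).
Local Open Scope ereal_scope.

(* Nonzero left-invariant Radon measure on the Borel sets. *)
Definition left_haar (mu : {measure set (borel T) -> \bar R}) : Prop :=
  [/\ mu [set: T] != 0,
      forall (x : T) (A : set (borel T)), measurable A ->
        mu (left_coset x A) = mu A,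
      forall K : set T, compact K -> mu K < +oo,
      forall A : set (borel T), measurable A ->
        mu A =
          ereal_inf [set mu U | U in [set U : set T | open U /\ A `<=` U]] &
      forall U : set T, open U ->
        mu U =
          ereal_sup [set mu K | K in [set K : set T | compact K /\ K `<=` U]]].

(* A left Haar measure is scaled by a single positive factor, independent of
   its normalization; 0 is returned only when T has no left Haar measure. *)
Definition module (b : caut T) : R :=
  xget 0%R [set c : R | exists mu, left_haar mu /\
    forall A : set (borel T), measurable A -> mu (b @` A) = c%:E * mu A].

End Haar.

Section Scale.
Context (G : topGroupType).

Definition displacement_index (a : caut G) (U : subgroup G) : nat :=
  coset_index (a @` U) (a @` U `&` U).

(* In a tdlc group compact open subgroups exist, so the default is not used. *)
Definition scale (a : caut G) : nat :=
  xget 0 [set n : nat |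
    (exists2 U : subgroup G,
      compact_open_subgroup U & displacement_index a U = n) /\
    (forall U : subgroup G,
      compact_open_subgroup U -> (n <= displacement_index a U)%N)].

Definition tidy (a : caut G) (U : subgroup G) : Prop :=
  compact_open_subgroup U /\ displacement_index a U = scale a.

Definition flat (HH : subgroup (caut G)) : Prop :=
  exists U : subgroup G, forall a, sg_set HH a -> tidy a U.

Definition uniscalar_part (HH : subgroup (caut G)) : set (sgType HH) :=
  [set a | scale (val a) = 1%N /\ scale (val a)^-1 = 1%N].

Definition stable (HH : subgroup (caut G)) (L : subgroup G) : Prop :=
  forall a, sg_set HH a -> a @` (L : set G) = L.

Record scaling_subgroup (HH : subgroup (caut G)) (L : subgroup G) : Prop := {
  scaling_closed : closed (L : set G);
  scaling_noncompact : ~ compact (L : set G);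
  scaling_stable : stable HH L;
  scaling_base : exists W : subgroup G,
    [/\ W `<=` L,
        compact (W : set G),
        exists2 O : set G, open O & (W : set G) = O `&` L,
        forall a, sg_set HH a -> W `<=` a @` W \/ a @` W `<=` W &
        (L : set G) = \bigcup_(a in (HH : set (caut G))) a @` W] }.

Definition module_on (R : realType) (HH : subgroup (caut G)) (L : subgroup G)
    (sL : scaling_subgroup HH L) (a : sgType HH) : R :=
  module R (caut_restrict (scaling_stable sL (sg_valP a))).

Definition flat_root (R : realType) (HH : subgroup (caut G))
    (rho : sgType HH -> int) : Prop :=
  [/\ hom_to_additive rho,
      range rho = [set: int] &
      exists (L : subgroup G) (sL : scaling_subgroup HH L) (s : int),
        (1 < s)%R /\
        forall a : sgType HH, module_on R sL a = (s%:~R ^ rho a)%R].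

Definition flat_roots (R : realType) (HH : subgroup (caut G)) :
    set (sgType HH -> int) :=
  [set rho | flat_root R rho].

Definition root_map (R : realType) (HH : subgroup (caut G)) (a : sgType HH) :
    set_type (@flat_roots R HH) -> int :=
  fun rho => val rho a.

End Scale.

Arguments uniscalar_part {G} HH.
Arguments flat_roots {G} R HH.
Arguments root_map {G} R HH a.

(* Main.v *)
Require Import Defs.
From HB Require Import structures.
From mathcomp Require Import all_boot all_order all_algebra.
From mathcomp Require Import finmap wochoice.
From mathcomp Require Import zify ring lra.
From mathcomp Require Import all_classical all_reals all_analysis.

Set Implicit Arguments.
Unset Strict Implicit.
Unset Printing Implicit Defensive.

Import Order.TTheory GRing.Theory Num.Theory.

Local Open Scope classical_set_scope.
Local Open Scope group_scope.

(* Let [U] be tidy for every element of the flat group [HH].  The logarithm of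
   the index [s(a) s(a^-1)] is a homogeneous length function on [HH], and such
   a function vanishes on commutators; so commutators preserve [U].

   For a submonoid [M] of [HH] containing the stabilizer of [U], the compact
   group [U_M], the intersection of the [b(U)] for [b] in [M], still satisfies
   [U_M = U_M+ U_M-] for each [a] in [HH], and [c(U_M)] meets [U] inside [U_M].
   If [a(U)] is not contained in [U], choose [M] containing [a] maximal with
   [a(U_M)] not contained in [U]: then [M] and [M^-1] cover [HH], so the
   translates of [U_M] form a chain whose union [L] meets [U] in [U_M], and [L]
   is a scaling subgroup.  The module on [L] takes only values [n] and [1/n], so
   it is [s ^ rho] for a root [rho], and [rho a <> 0].

   Conversely a root [rho] vanishes on the stabilizer of [U], and if
   [0 < rho a] then [a(U_M)] is not contained in [U] for [M = {0 <= rho}], by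
   Haar measure.  Only finitely many [rho] have this property: two distinct ones
   are separated by some [b], and adjoining [b] or [b^-1] to a monoid [S]
   containing [a] lowers the number of cosets of [U] that meet [a(U_S)].
   Finally, subgroups of direct sums of copies of [Z] are free. *)

(** * Indices *)

(** Infinite intersections [U_M] are reached from finite ones by compactness ([compact_directed]),
    monoids are enlarged by Zorn's lemma, and finiteness comes from the number of cosets of [U] that
    meet the compact group [a(U)]. Tidiness enters through two properties that pass to intersections
    and translates: the factorization [A = A_+ A_-] and [traps]. The latter confines [c(U_M)]: for
    [b] in [M], the orbit under [b^-1] of a point of [c(U_M)] never leaves this compact group. Both
    are deduced from minimality of the index, by tidying and an asymptotic count over powers of [a];
    that count also shows that the index at [a^n] is the [n]-th power of the index at [a], which is
    the homogeneity of the length. Commutators must preserve [U] in order that a monoid containing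
    the stabilizer be normalized by [HH]. Adjoining [g] then only adds the products [g^n b], and the
    group of the larger monoid is the plus part of the old one for [g]. *)

Lemma card_le_surj (T U : choiceType) (A : set T) (B : set U) (f : T -> U) :
  finite_set A -> (forall y, B y -> exists2 x, A x & f x = y) ->
  finite_set B /\ (#|` fset_set B| <= #|` fset_set A|)%N.
Proof.
move=> fA AB; have sub : B `<=` f @` A by move=> y /AB[x Ax <-]; exists x.
have fB : finite_set B by apply: sub_finite_set sub _; exact: finite_image.
split=> //; apply: (@leq_trans #|` fset_set (f @` A)|).
  by apply: fsubset_leq_card; rewrite -fset_set_sub//; exact: finite_image.
by rewrite fset_set_image//; exact: leq_imfset_card.
Qed.

Lemma card_le_inj (T U : choiceType) (A : set T) (B : set U) (f : T -> U) :
  finite_set B -> (forall x, A x -> B (f x)) ->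
  (forall x y, A x -> A y -> f x = f y -> x = y) ->
  finite_set A /\ (#|` fset_set A| <= #|` fset_set B|)%N.
Proof.
move=> fB AB fI.
have sub : f @` A `<=` B by move=> _ [x Ax <-]; exact: AB.
have ffA : finite_set (f @` A) by exact: sub_finite_set sub _.
have inA : {in A &, injective f} by move=> x y /set_mem + /set_mem; exact: fI.
have fA : finite_set A.
  by rewrite -(eq_finite_set (inj_card_eq inA)).
split=> //; have /(fcard_eq ffA fA) <- := inj_card_eq inA.
by apply: fsubset_leq_card; rewrite -fset_set_sub.
Qed.

Lemma card_fset_setX (T U : choiceType) (A : set T) (B : set U) :
  finite_set A -> finite_set B ->
  #|` fset_set (A `*` B)| = (#|` fset_set A| * #|` fset_set B|)%N.
Proof.
move=> fA fB; rewrite fset_setX//.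
set S := fset_set A; set S' := fset_set B.
have -> : (S `*` S')%fset = seq_fset tt [seq (x, y) | x <- S, y <- S'].
  apply/fsetP => -[x y]; rewrite in_fsetM seq_fsetE; apply/idP/allpairsP => /=.
    by move=> /andP[xS yS]; exists (x, y).
  by move=> [[x' y'] /= [xS yS [-> ->]]]; rewrite xS yS.
rewrite size_seq_fset undup_id ?size_allpairs//.
by rewrite allpairs_uniq ?fset_uniq// => -[? ?] [? ?].
Qed.

Definition is_subgroup (G : groupType) (A : set G) : Prop :=
  [/\ A 1, forall x y, A x -> A y -> A (x * y) & forall x, A x -> A x^-1].

Section Cosets.
Context (G : groupType).
Implicit Types (A B C : set G) (x y : G).

Lemma subgroupP (H : subgroup G) : is_subgroup H.
Proof. by split; [exact: sg1 | exact: sgM | exact: sgV]. Qed.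

Definition to_subgroup A (hA : is_subgroup A) : subgroup G :=
  let: And3 h1 hM hV := hA in Subgroup h1 hM hV.

Lemma to_subgroupE A (hA : is_subgroup A) : (to_subgroup hA : set G) = A.
Proof. by case: hA. Qed.

Lemma sg_div A x y : is_subgroup A -> A x -> A y -> A (x^-1 * y).
Proof. by case=> _ hM hV hx hy; apply: hM => //; exact: hV. Qed.

Lemma sg_mulr A x y : is_subgroup A -> A y -> A (x * y) <-> A x.
Proof.
case=> _ hM hV hy; split=> [hxy|hx]; last exact: hM.
by rewrite -(mulgK y x); apply: hM => //; exact: hV.
Qed.

Lemma sg_mull A x y : is_subgroup A -> A x -> A (x * y) <-> A y.
Proof.
case=> _ hM hV hx; split=> [hxy|hy]; last exact: hM.
by rewrite -(mulKg x y); apply: hM => //; exact: hV.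
Qed.

Lemma sg_inv_iff A x : is_subgroup A -> A x^-1 <-> A x.
Proof. by case=> _ _ hV; split=> /hV; rewrite ?invgK. Qed.

Lemma is_subgroupI A B :
  is_subgroup A -> is_subgroup B -> is_subgroup (A `&` B).
Proof.
move=> [a1 aM aV] [b1 bM bV]; split=> //.
  by move=> x y [? ?] [? ?]; split; [exact: aM|exact: bM].
by move=> x [? ?]; split; [exact: aV|exact: bV].
Qed.

Lemma left_cosetE x A y : left_coset x A y <-> A (x^-1 * y).
Proof.
split=> [[a Aa <-]|h]; first by rewrite mulKg.
by exists (x^-1 * y) => //; rewrite mulVKg.
Qed.

Lemma left_coset_eqP B x y : is_subgroup B ->
  left_coset x B = left_coset y B <-> B (x^-1 * y).
Proof.
move=> hB; split=> [E|h].
  by apply/left_cosetE; rewrite E; apply/left_cosetE; rewrite mulVg; case: hB.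
apply/seteqP; split=> z /left_cosetE hz; apply/left_cosetE.
  have -> : y^-1 * z = (x^-1 * y)^-1 * (x^-1 * z).
    by rewrite invgM invgK -mulgA mulVKg.
  exact: sg_div.
have -> : x^-1 * z = (x^-1 * y) * (y^-1 * z) by rewrite -mulgA mulVKg.
by case: hB => _ + _; apply.
Qed.

Lemma left_cosetM x y B : [set x * z | z in left_coset y B] = left_coset (x * y) B.
Proof.
apply/seteqP; split=> z.
  by move=> [_ [b Bb <-] <-]; exists b => //; rewrite mulgA.
by move=> [b Bb <-]; exists (y * b); [exists b|rewrite mulgA].
Qed.

Lemma left_cosets_sub A A' B : is_subgroup B ->
  (forall x, A x -> exists2 y, A' y & B (y^-1 * x)) ->
  left_cosets A B `<=` left_cosets A' B.
Proof.
move=> hB h _ [x /h[y Ay hy] <-]; exists y => //.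
by apply/left_coset_eqP.
Qed.

Lemma coset_index_le A A' B : is_subgroup B ->
  finite_set (left_cosets A' B) ->
  (forall x, A x -> exists2 y, A' y & B (y^-1 * x)) ->
  finite_set (left_cosets A B) /\ (coset_index A B <= coset_index A' B)%N.
Proof.
move=> hB fA' h; have sub := left_cosets_sub hB h.
have fA : finite_set (left_cosets A B) by exact: sub_finite_set sub _.
by split=> //; apply: fsubset_leq_card; rewrite -fset_set_sub.
Qed.

Lemma coset_index_lt A A' B : is_subgroup B ->
  finite_set (left_cosets A' B) -> A `<=` A' ->
  (exists2 x, A' x & forall y, A y -> ~ B (y^-1 * x)) ->
  (coset_index A B < coset_index A' B)%N.
Proof.
move=> hB fA' sA [x A'x hx].
have sub : left_cosets A B `<=` left_cosets A' B.
  by apply: left_cosets_sub => // y Ay; exists y; [exact: sA|rewrite mulVg; case: hB].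
have fA : finite_set (left_cosets A B) by exact: sub_finite_set sub _.
apply: fproper_ltn_card; rewrite fproperEneq.
apply/andP; split; last by rewrite -fset_set_sub.
apply/eqP => /(fset_set_inj fA fA') E.
have : left_cosets A' B (left_coset x B) by exists x.
by rewrite -E => -[y Ay /(left_coset_eqP _ _ hB) h]; exact: hx h.
Qed.

Let rep A B (D : set G) : G := xget 1 [set x | A x /\ D = left_coset x B].

Let repP A B D : left_cosets A B D -> A (rep A B D) /\ D = left_coset (rep A B D) B.
Proof. by move=> [x Ax <-]; rewrite /rep; case: xgetP => [y -> //|/(_ x)[]]. Qed.

(** With [r] in [A] representing [x B], the coset [x C] is [r] times the coset of [r^-1 x], an
    element of [B]; so pairs of a coset of [B] and a coset of [C] reach every coset on the left. *)
Lemma coset_index_trans A B C : is_subgroup B -> is_subgroup C ->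
  finite_set (left_cosets A B) -> finite_set (left_cosets B C) ->
  finite_set (left_cosets A C) /\
  (coset_index A C <= coset_index A B * coset_index B C)%N.
Proof.
move=> hB hC fA fB.
have [|f c] := @card_le_surj _ _ (left_cosets A B `*` left_cosets B C)
  (left_cosets A C) (fun p => [set rep A B p.1 * z | z in p.2]) (finite_setX fA fB).
  move=> _ [x Ax <-]; have Dx : left_cosets A B (left_coset x B) by exists x.
  have [_ /esym/(left_coset_eqP _ _ hB) rB] := repP Dx.
  exists (left_coset x B, left_coset ((rep A B (left_coset x B))^-1 * x) C).
    by split=> //=; exists ((rep A B (left_coset x B))^-1 * x).
  by rewrite /= left_cosetM mulVKg.
by split=> //; rewrite -card_fset_setX.
Qed.

Lemma coset_index_mul A B C : is_subgroup B -> is_subgroup C -> C `<=` B ->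
  (forall x y, A x -> B y -> A (x * y)) -> finite_set (left_cosets A C) ->
  finite_set (left_cosets A B) -> finite_set (left_cosets B C) ->
  (coset_index A B * coset_index B C <= coset_index A C)%N.
Proof.
move=> hB hC CB AB fAC fA fB.
have [| |_ c] := @card_le_inj _ _ (left_cosets A B `*` left_cosets B C)
  (left_cosets A C) (fun p => [set rep A B p.1 * z | z in p.2]) fAC.
- move=> [D E] [/repP[AD _] [y By <-]] /=; exists (rep A B D * y); first exact: AB.
  by rewrite left_cosetM.
- move=> [D E] [D' E'] [/repP[AD hD] [y By hE]] [/repP[AD' hD'] [y' By' hE']] /=.
  rewrite /= in hE hE'; rewrite -hE -hE' !left_cosetM => /(left_coset_eqP _ _ hC) h.
  have E1 : D = D'.
    rewrite /= in hD hD'; rewrite hD hD'; apply/left_coset_eqP => //.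
    have By1 : B y^-1 by case: hB => _ _; apply.
    apply/(sg_mulr _ hB By')/(sg_mull _ hB By1).
    by rewrite !mulgA -invgM -mulgA; exact: CB.
  congr pair => //; apply/left_coset_eqP => //.
  by move: h; rewrite -E1 invgM -!mulgA mulKg.
by rewrite -card_fset_setX.
Qed.

Lemma coset_index_eq A B C : is_subgroup B -> is_subgroup C -> C `<=` B ->
  (forall x y, A x -> A y -> B (x^-1 * y) -> C (x^-1 * y)) ->
  finite_set (left_cosets A B) ->
  finite_set (left_cosets A C) /\ coset_index A C = coset_index A B.
Proof.
move=> hB hC CB h fB.
have toB x : left_coset (rep A C (left_coset x C)) B = left_coset x B \/ ~ A x.
  have [Ax|] := pselect (A x); last by right.
  left; have [_ /esym/(left_coset_eqP _ _ hC)] : A (rep A C (left_coset x C)) /\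
      left_coset x C = left_coset (rep A C (left_coset x C)) C.
    by apply: repP; exists x.
  by move=> /CB ?; apply/left_coset_eqP.
have [| |f c] := @card_le_inj _ _ (left_cosets A C) (left_cosets A B)
    (fun D => left_coset (rep A C D) B) fB.
- by move=> D /repP[AD _]; exists (rep A C D).
- move=> D D' /repP[AD hD] /repP[AD' hD'] /(left_coset_eqP _ _ hB) E.
  by rewrite hD hD'; apply/left_coset_eqP => //; exact: h.
split=> //; apply/eqP; rewrite eqn_leq c /=.
have [|_ //] := @card_le_surj _ _ (left_cosets A C) (left_cosets A B)
    (fun D => left_coset (rep A C D) B) f.
move=> _ [x Ax <-]; exists (left_coset x C); first by exists x.
by have [] := toB x.
Qed.

Lemma coset_index_gt0 A B x : finite_set (left_cosets A B) -> A x ->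
  (0 < coset_index A B)%N.
Proof.
move=> f Ax; rewrite cardfs_gt0; apply/fset0Pn; exists (left_coset x B).
by rewrite in_fset_set// inE; exists x.
Qed.

End Cosets.

(** * Topological groups and their automorphisms *)

(** The traces of the [F i] on [K] form a filter base, and a cluster point lies in every closed
    [F i]. Approximate solutions are turned into exact ones through this lemma. *)
Lemma compact_directed (T : topologicalType) (I : Type) (i0 : I) (K : set T)
    (F : I -> set T) :
  compact K -> (forall i, closed (F i)) ->
  (forall i j, exists k, F k `<=` F i `&` F j) ->
  (forall i, K `&` F i !=set0) -> exists x, K x /\ forall i, F i x.
Proof.
move=> cK cF dF neF.
pose B := filter_from [set: I] (fun i => K `&` F i).
have FB : Filter B.
  apply: filter_from_filter; first by exists i0.
  move=> i j _ _; have [k hk] := dF i j; exists k => //.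
  by move=> x [Kx /hk[? ?]].
have PB : ProperFilter B by apply: filter_from_proper => i _; exact: neF.
have BK : B K by exists i0 => // x [].
have [x [Kx clx]] := cK B PB BK.
exists x; split=> // i; apply: (cF i) => N Nx.
have Bi : B (F i) by exists i => // y [].
by have [y [? ?]] := clx _ _ Bi Nx; exists y.
Qed.

Section TopGroup.
Context (G : topGroupType).
Implicit Types (A B C K U : set G) (x y : G).

Lemma continuous_mulg (X : topologicalType) (f g : X -> G) :
  continuous f -> continuous g -> continuous (fun t => f t * g t).
Proof.
move=> cf cg t; apply: (@cvg_comp _ _ _ (fun t => (f t, g t))
  (fun xy : G * G => xy.1 * xy.2) _ (nbhs (f t, g t))).
  by apply: cvg_pair; [exact: cf|exact: cg].
exact: (@mulg_continuous G (f t, g t)).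
Qed.

Lemma continuous_invg (X : topologicalType) (f : X -> G) :
  continuous f -> continuous (fun t => (f t)^-1).
Proof.
by move=> cf t; apply: (@cvg_comp _ _ _ f (fun x : G => x^-1) _ (nbhs (f t)));
  [exact: cf|exact: invg_continuous].
Qed.

Lemma continuous_cstg (X : topologicalType) x : continuous (fun _ : X => x).
Proof. by move=> t; exact: cvg_cst. Qed.

Lemma continuous_idg : continuous (fun x : G => x).
Proof. by move=> t; exact: cvg_id. Qed.

Lemma open_pre (X Y : topologicalType) (f : X -> Y) (A : set Y) :
  continuous f -> open A -> open (f @^-1` A).
Proof. by move=> /continuousP; apply. Qed.

Lemma closed_pre (X Y : topologicalType) (f : X -> Y) (A : set Y) :
  continuous f -> closed A -> closed (f @^-1` A).
Proof. by move=> /continuous_closedP; apply. Qed.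

Lemma left_coset_preimage x A : left_coset x A = (fun y => x^-1 * y) @^-1` A.
Proof. by apply/seteqP; split=> y /left_cosetE. Qed.

Lemma continuous_mull x : continuous (fun y : G => x * y).
Proof. exact: continuous_mulg (@continuous_cstg _ x) continuous_idg. Qed.

Lemma open_left_coset x A : open A -> open (left_coset x A).
Proof. by rewrite left_coset_preimage; apply: open_pre; exact: continuous_mull. Qed.

Lemma compact_image (X Y : topologicalType) (f : X -> Y) (A : set X) :
  continuous f -> compact A -> compact (f @` A).
Proof.
by move=> cf cA; apply: continuous_compact => //; exact: continuous_subspaceT.
Qed.

Lemma compact_left_coset x A : compact A -> compact (left_coset x A).
Proof. by apply: compact_image; exact: continuous_mull. Qed.

Lemma compact_set_mulg A B : compact A -> compact B -> compact (set_mulg A B).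
Proof.
move=> cA cB.
have -> : set_mulg A B = (fun xy : G * G => xy.1 * xy.2) @` (A `*` B).
  apply/seteqP; split=> z; first by move=> [x Ax [y By <-]]; exists (x, y).
  by move=> [[x y] [/= Ax By] <-]; exists x => //; exists y.
by apply: compact_image; [exact: mulg_continuous|exact: compact_setX].
Qed.

Lemma open_union (I : Type) (D : set I) (F : I -> set G) :
  (forall i, D i -> open (F i)) -> open (\bigcup_(i in D) F i).
Proof. exact: bigcup_open. Qed.

Lemma open_set_mulg A B : open B -> open (set_mulg A B).
Proof.
move=> oB; have -> : set_mulg A B = \bigcup_(x in A) left_coset x B.
  apply/seteqP; split=> z; first by move=> [x Ax [y By <-]]; exists x => //; exists y.
  by move=> [x Ax [y By <-]]; exists x => //; exists y.
by apply: open_union => x _; exact: open_left_coset.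
Qed.

Lemma nbhs1_open A : is_subgroup A -> nbhs 1 A -> open A.
Proof.
move=> hA n1; rewrite openE => x Ax; rewrite /interior.
have : nbhs x ((fun y => x^-1 * y) @^-1` A).
  by apply: continuous_mull; rewrite mulVg.
apply: filterS => y; rewrite /preimage /=.
by move/(sg_mull y hA); apply; apply/sg_inv_iff.
Qed.

Lemma open_subgroup_closed A : is_subgroup A -> open A -> closed A.
Proof.
move=> hA oA; rewrite -[A]setCK; apply: open_closedC.
rewrite openE => x nAx; rewrite /interior.
suff : nbhs x (left_coset x A).
  apply: filterS => y /left_cosetE h Ay; apply: nAx.
  by move: h => /(sg_mulr _ hA Ay)/sg_inv_iff; apply.
apply: open_nbhs_nbhs; split; first exact: open_left_coset.
by apply/left_cosetE; rewrite mulVg; case: hA.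
Qed.

Lemma left_cosets_finite A B : compact A -> is_subgroup B -> open B ->
  finite_set (left_cosets A B).
Proof.
move=> cA hB oB; have {}cA : @cover_compact (pointed_group G) A.
  by rewrite -compact_cover.
have [|x Ax|D sD AD] := cA G A (fun x => left_coset x B).
- by move=> x _; exact: open_left_coset.
- by exists x => //; apply/left_cosetE; rewrite mulVg; case: hB.
apply: (@sub_finite_set _ _ ((fun x => left_coset x B) @` [set` D])).
  move=> _ [x Ax <-]; have [y Dy hy] := AD x Ax; exists y => //.
  by apply/left_coset_eqP => //; apply/left_cosetE.
exact/finite_image/finite_fset.
Qed.

Lemma closure_subgroup A : is_subgroup A -> is_subgroup (closure A).
Proof.
move=> [a1 aM aV]; split; first exact: subset_closure.
  move=> x y clx cly N /= Nxy.
  have [[P Q] /= [Px Qy] PQ] := @mulg_continuous G (x, y) N Nxy.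
  have [u [Au Pu]] := clx P Px; have [v [Av Qv]] := cly Q Qy.
  by exists (u * v); split; [exact: aM|exact: (PQ (u, v))].
move=> x clx N Nx; have [u [Au Nu]] := clx _ (@invg_continuous G x N Nx).
by exists u^-1; split; [exact: aV|].
Qed.

Lemma tube (f : G * G -> G) K U : continuous f -> compact K -> open U ->
  (forall k, K k -> U (f (k, 1))) -> nbhs 1 [set x | forall k, K k -> U (f (k, x))].
Proof.
move=> cf /compact_near_coveringP cK oU KU.
have := cK G (nbhs (1 : G)) (fun x k => U (f (k, x))) _.
apply=> k Kk.
have : nbhs ((k, 1) : G * G) (f @^-1` U).
  by apply: cf; apply: open_nbhs_nbhs; split=> //; exact: KU.
by apply: filterS => -[].
Qed.

(** This makes the core of [U] under conjugation by a compact group open. *)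
Lemma open_conj_core K U : compact K -> open U -> U 1 ->
  nbhs 1 [set x | forall k, K k -> U (k^-1 * x * k)].
Proof.
move=> cK oU U1; apply: (tube (f := fun p => p.1^-1 * p.2 * p.1)) => //.
  apply: continuous_mulg; last by move=> p; exact: cvg_fst.
  apply: continuous_mulg; last by move=> p; exact: cvg_snd.
  by apply: continuous_invg => p; exact: cvg_fst.
by move=> k _ /=; rewrite mulg1 mulVg.
Qed.

End TopGroup.

Section Act.
Context (G : topGroupType).
Implicit Types (A B : set G) (a b : caut G) (x : G).

Definition act a A : set G := [set x | A (a^-1 x)].

Lemma actE a A x : act a A x = A (a^-1 x). Proof. by []. Qed.

Lemma cautKV a x : a (a^-1 x) = x. Proof. exact: cautVK. Qed.
Lemma cautVKg a x : a^-1 (a x) = x. Proof. exact: cautK. Qed.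
Lemma cautMg a b x : (a * b) x = a (b x). Proof. by []. Qed.
Lemma image_act a A : a @` A = act a A.
Proof.
apply/seteqP; split=> x; first by move=> [y Ay <-]; rewrite actE cautVKg.
by move=> h; exists (a^-1 x); rewrite ?cautKV.
Qed.

Lemma actP a A x : act a A (a x) <-> A x.
Proof. by rewrite !actE cautVKg. Qed.

Lemma caut_1 a : a 1 = 1.
Proof. by apply: (mulgI (a 1)); rewrite -cautM !mulg1. Qed.

Lemma caut_Vg a x : a x^-1 = (a x)^-1.
Proof. by apply/esym/mulg1_eq; rewrite -cautM mulgV caut_1. Qed.

Lemma act_subgroup a A : is_subgroup A -> is_subgroup (act a A).
Proof.
move=> [a1 aM aV]; split; first by rewrite actE caut_1.
  by move=> x y; rewrite !actE cautM; exact: aM.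
by move=> x; rewrite !actE caut_Vg; exact: aV.
Qed.

Lemma act_open a A : open A -> open (act a A).
Proof. by apply: open_pre; exact: caut_continuous. Qed.

Lemma act_closed a A : closed A -> closed (act a A).
Proof. by apply: closed_pre; exact: caut_continuous. Qed.

Lemma act_compact a A : compact A -> compact (act a A).
Proof. by rewrite -image_act; apply: compact_image; exact: caut_continuous. Qed.

Lemma act_mul a b A : act (a * b) A = act a (act b A).
Proof. by apply/seteqP; split=> x; rewrite !actE invgM. Qed.

Lemma act1 A : act 1 A = A.
Proof. by apply/seteqP; split=> x; rewrite !actE invg1. Qed.

Lemma actV a A x : act a^-1 A x <-> A (a x).
Proof. by rewrite !actE invgK. Qed.

Lemma expgSg a n x : (a ^+ n.+1) x = a ((a ^+ n) x).
Proof. by rewrite expgS. Qed.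

Lemma expgSrg a n x : (a ^+ n.+1) x = (a ^+ n) (a x).
Proof. by rewrite expgSr. Qed.

Lemma expgVK a n x : (a ^+ n) ((a^-1 ^+ n) x) = x.
Proof. by rewrite expVgn cautKV. Qed.

Lemma expVgK a n x : (a^-1 ^+ n) ((a ^+ n) x) = x.
Proof. by rewrite expVgn cautVKg. Qed.

Lemma expg_subV a m n x : (m <= n)%N ->
  (a^-1 ^+ n) ((a ^+ m) x) = (a^-1 ^+ (n - m)) x.
Proof. by move=> mn; rewrite -{1}(subnK mn) expgnDr cautMg expVgK. Qed.

Lemma expg_addg a m n x : (a ^+ (m + n)) x = (a ^+ m) ((a ^+ n) x).
Proof. by rewrite expgnDr. Qed.

Lemma coset_index_act a A B : is_subgroup B ->
  finite_set (left_cosets A B) ->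
  finite_set (left_cosets (act a A) (act a B)) /\
  coset_index (act a A) (act a B) = coset_index A B.
Proof.
move=> hB f.
have le b C D : is_subgroup D -> finite_set (left_cosets C D) ->
    finite_set (left_cosets (act b C) (act b D)) /\
    (coset_index (act b C) (act b D) <= coset_index C D)%N.
  move=> hD fC; apply: (@card_le_surj _ _ _ _ (fun E : set G => b @` E)) => //.
  move=> _ [x Cx <-]; exists (left_coset (b^-1 x) D); first by exists (b^-1 x).
  rewrite image_act; apply/seteqP; split=> y.
    by move=> /left_cosetE h; apply/left_cosetE; rewrite !actE cautM caut_Vg.
  by move=> /left_cosetE; rewrite !actE cautM caut_Vg => h; apply/left_cosetE.
have [f1 c1] := le a _ _ hB f; split=> //; apply/eqP; rewrite eqn_leq c1 /=.
by have [_] := le a^-1 _ _ (act_subgroup a hB) f1; rewrite -!act_mul mulVg !act1.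
Qed.

End Act.

(** * Tidy subgroups of one automorphism *)

Lemma finite_uniform (T : Type) (S : set T) (P : T -> nat -> Prop) :
  finite_set S -> (forall t m n, (m <= n)%N -> P t m -> P t n) ->
  (forall t, S t -> exists n, P t n) -> exists N, forall t, S t -> P t N.
Proof.
move=> + mP; elim/Pchoice : T => T in S P mP *; move=> fS eP.
have /choice[f Pf] : forall t, exists n, S t -> P t n.
  move=> t; have [/eP[n]|nS] := pselect (S t); first by exists n.
  by exists 0%N.
exists (\max_(t <- fset_set S) f t)%N => t St.
by apply: mP (Pf t St); apply: leq_bigmax_seq => //; rewrite in_fset_set// inE.
Qed.

Lemma recurrent (T : Type) (S : set T) (f : nat -> T) : finite_set S ->
  (forall n, S (f n)) -> exists t, forall N, exists2 n, (N <= n)%N & f n = t.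
Proof.
move=> fS Sf; apply: contrapT => /forallNP h.
have [||N hN] := @finite_uniform _ S (fun t N => forall n, (N <= n)%N -> f n <> t) fS.
- by move=> t m n mn + k nk; apply; exact: leq_trans nk.
- move=> t _; have /existsNP[N hN] := h t; exists N => n Nn fn.
  by apply: hN; exists n.
exact: hN (Sf N) N (leqnn N) erefl.
Qed.

(** Bernoulli's inequality [1 + k / D <= (1 + 1 / D) ^ k] without denominators. *)
Lemma bernoulli D k : ((D + k) * D ^ k <= D * D.+1 ^ k)%N.
Proof.
elim: k => [|k IH]; first by rewrite addn0.
rewrite !expnS; move: (D ^ k)%N (D.+1 ^ k)%N IH => p q IH.
have : (D.+1 * ((D + k) * p) <= D.+1 * (D * q))%N by rewrite leq_mul2l IH orbT.
by nia.
Qed.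

(** If [D < S], then [bernoulli] gives [D + k <= D C] for every [k], which fails at [k = D C + 1].
    Rates of growth are compared in this way up to constants. *)
Lemma expn_growth S D C : (forall k, S ^ k <= C * D ^ k)%N -> (S <= D)%N.
Proof.
move=> h; rewrite leqNgt; apply/negP => DS.
have D0 : (0 < D)%N.
  by have := h 1%N; rewrite !expn1; case: D DS {h} => //; lia.
have e : (D.+1 ^ (D * C).+1 <= S ^ (D * C).+1)%N by rewrite leq_exp2r.
have := leq_trans (leq_mul (leqnn D) e) (leq_mul (leqnn D) (h (D * C).+1)).
move=> /(leq_trans (bernoulli _ _)); rewrite mulnA leq_mul2r expn_eq0.
by lia.
Qed.

(* The paper's [U_{a-}] is [fwd a U] and its [U_{a+}] is [fwd a^-1 U]. *)
Definition fwd (G : topGroupType) (a : caut G) (A : set G) : set G :=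
  [set x | forall n, A ((a ^+ n) x)].

Definition bdd (G : topGroupType) (a : caut G) (x : G) : Prop :=
  exists2 K : set G, compact K & forall n, K ((a ^+ n) x).

(** Tidiness above, [A = A_+ A_-], with the factor from [A_+] on the left. *)
Definition factors (G : topGroupType) (a : caut G) (A : set G) : Prop :=
  forall x, A x -> exists2 y, fwd a^-1 A y & fwd a A (y^-1 * x).

(* For [a] and [a^-1] together, this replaces the closedness of the union of
   the [a^-n(U_{a-})]. *)
Definition traps (G : topGroupType) (a : caut G) (A : set G) : Prop :=
  forall x, A x -> bdd a x -> fwd a A x.

Section Fwd.
Context (G : topGroupType).
Implicit Types (a b : caut G) (A B : set G) (x y : G).

Lemma fwd_sub a A : fwd a A `<=` A.
Proof. by move=> x /(_ 0%N). Qed.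

Lemma fwd_mono a A B : A `<=` B -> fwd a A `<=` fwd a B.
Proof. by move=> AB x h n; exact/AB/h. Qed.

Lemma fwd_iter a A x k : fwd a A x -> fwd a A ((a ^+ k) x).
Proof. by move=> h n; rewrite -expg_addg; exact: h. Qed.

Lemma fwd_step a A x : fwd a A x -> fwd a A (a x).
Proof. exact: (@fwd_iter a A x 1). Qed.

Lemma expV_subg a m n x : (m <= n)%N ->
  (a^-1 ^+ m) ((a ^+ n) x) = (a ^+ (n - m)) x.
Proof. by move=> mn; rewrite -{1}(subnKC mn) expg_addg expVgK. Qed.

Lemma exp_subVg a m n x : (m <= n)%N ->
  (a ^+ m) ((a^-1 ^+ n) x) = (a^-1 ^+ (n - m)) x.
Proof. by move=> mn; rewrite -{1}(subnKC mn) expg_addg expgVK. Qed.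

Lemma fwdS a A x : fwd a A x <-> A x /\ fwd a A (a x).
Proof.
split=> [h|[Ax h] [//|n]]; first by split; [exact: fwd_sub h|exact: fwd_step].
by rewrite expgSrg.
Qed.

Lemma fwd_subgroup a A : is_subgroup A -> is_subgroup (fwd a A).
Proof.
move=> [a1 aM aV]; split; first by move=> n; rewrite caut_1.
  by move=> x y hx hy n; rewrite cautM; exact: aM.
by move=> x hx n; rewrite caut_Vg; exact: aV.
Qed.

Lemma fwd_closed a A : closed A -> closed (fwd a A).
Proof.
move=> cA; have -> : fwd a A = \bigcap_(n in [set: nat]) ((a ^+ n) @^-1` A).
  by apply/seteqP; split=> x h n; [move=> _; exact: h|exact: (h n I)].
by apply: closed_bigI => n _; apply: closed_pre => //; exact: caut_continuous.
Qed.

Lemma fwdI a A B : fwd a (A `&` B) = fwd a A `&` fwd a B.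
Proof.
apply/seteqP; split=> x; first by move=> h; split=> n; case: (h n).
by move=> [h h'] n.
Qed.

Lemma bddM a x y : bdd a x -> bdd a y -> bdd a (x * y).
Proof.
move=> [K cK hK] [L cL hL]; exists (set_mulg K L); first exact: compact_set_mulg.
by move=> n; rewrite cautM; exists ((a ^+ n) x) => //; exists ((a ^+ n) y).
Qed.

Lemma bddV a x : bdd a x -> bdd a x^-1.
Proof.
move=> [K cK hK]; exists ((fun x => x^-1) @` K).
  by apply: compact_image => //; exact: invg_continuous.
by move=> n; exists ((a ^+ n) x); rewrite ?caut_Vg.
Qed.

Lemma fwd_bdd a A x : compact A -> fwd a A x -> bdd a x.
Proof. by move=> cA h; exists A. Qed.

Lemma factorsV a A : is_subgroup A -> factors a A -> factors a^-1 A.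
Proof.
move=> hA f x Ax; have [|y hy hz] := f x^-1; first by case: hA => _ _; apply.
exists (x * y); first by rewrite invgK -[x * y]invgK invgM; case: (fwd_subgroup a hA) => _ _; apply.
by rewrite invgM mulgVK; case: (fwd_subgroup a^-1 hA) => _ _; apply.
Qed.

End Fwd.

(** * Tidying above: the factorization from minimality *)

Section TidyAbove.
Context (G : topGroupType) (a : caut G) (U : set G).
Hypotheses (hU : is_subgroup U) (cU : compact U) (oU : open U).

(** The intersection of [U], [a(U)], ..., [a^n(U)]. *)
Definition meet_iter n : set G := [set x | forall k, (k <= n)%N -> U ((a^-1 ^+ k) x)].

Lemma meet_iterS n : meet_iter n.+1 = meet_iter n `&` ((a^-1 ^+ n.+1) @^-1` U).
Proof.
apply/seteqP; split=> x.
  by move=> h; split=> [k kn|]; apply: h => //; exact: leqW.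
by move=> [h h'] k; rewrite leq_eqVlt => /predU1P[->//|]; exact: h.
Qed.

Lemma meet_iter_sub n : meet_iter n `<=` U.
Proof. by move=> x /(_ 0%N); apply. Qed.

Lemma meet_iter_subgroup n : is_subgroup (meet_iter n).
Proof.
case: hU => u1 uM uV; split; first by move=> k _; rewrite caut_1.
  by move=> x y hx hy k kn; rewrite cautM; apply: uM; [exact: hx|exact: hy].
by move=> x hx k kn; rewrite caut_Vg; apply: uV; exact: hx.
Qed.

Lemma meet_iter_open n : open (meet_iter n).
Proof.
elim: n => [|n IH].
  suff -> : meet_iter 0 = U by [].
  apply/seteqP; split; first exact: meet_iter_sub.
  by move=> x Ux k; rewrite leqn0 => /eqP ->.
by rewrite meet_iterS; apply: openI => //; apply: open_pre => //; exact: caut_continuous.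
Qed.

Lemma meet_iter_compact n : compact (meet_iter n).
Proof.
apply: subclosed_compact cU (@meet_iter_sub n).
by apply: open_subgroup_closed; [exact: meet_iter_subgroup|exact: meet_iter_open].
Qed.

Hypothesis minU : forall n,
  (coset_index (act a U) U <= coset_index (act a (meet_iter n)) (meet_iter n))%N.

Let clU : closed U. Proof. exact: open_subgroup_closed. Qed.

(** Let [U_n] be [meet_iter n]. Since [a(U_n)] meets [U] inside [U_n], the displacement index of
    [U_n] counts the cosets of [U] that meet [a(U_n)]. Minimality forces these to be all cosets that
    meet [a(U)]; so [a x] lies in [a(U_n) U] for each [n], and compactness replaces [U_n] by the
    intersection. *)
Lemma factors_step x : U x ->
  exists2 y, fwd a^-1 U y & U (y^-1 * x) /\ U (a (y^-1 * x)).
Proof.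
move=> Ux.
have H n : exists2 y, act a (meet_iter n) y & U (y^-1 * a x).
  apply: contrapT => nex.
  have fin := left_cosets_finite (act_compact (a := a) (meet_iter_compact (n := n))) hU oU.
  have [|_ E] := coset_index_eq hU (meet_iter_subgroup n) (@meet_iter_sub n) _ fin.
    move=> u v Uu Uv Uuv [//|k] kn.
    by rewrite expgSrg; apply: (sg_div (act_subgroup a (meet_iter_subgroup n)) Uu Uv); exact: ltnW.
  suff : (coset_index (act a (meet_iter n)) U < coset_index (act a U) U)%N.
    by rewrite -E ltnNge minU.
  apply: coset_index_lt => //.
  - exact: left_cosets_finite (act_compact (a := a) cU) hU oU.
  - by move=> y; exact: meet_iter_sub.
  - exists (a x); first by apply/actP.
    by move=> y hy Uy; apply: nex; exists y.
have [||||y [_ hy]] := @compact_directed G nat 0%N (act a U)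
    (fun n => [set y | meet_iter n (a^-1 y) /\ U (y^-1 * a x)]).
- exact: act_compact.
- move=> n; apply: closedI.
    apply: (@closed_pre _ _ (caut_fun a^-1)); first exact: caut_continuous.
    by apply: open_subgroup_closed; [exact: meet_iter_subgroup|exact: meet_iter_open].
  apply: (@closed_pre _ _ (fun y => y^-1 * a x)) => //.
  by apply: continuous_mulg; [exact: invg_continuous|exact: continuous_cstg].
- move=> i j; exists (maxn i j) => y [h Uy]; split; split=> // k kn; apply: h.
    by rewrite leq_max kn.
  by rewrite leq_max kn orbT.
- by move=> n; have [y hy Uy] := H n; exists y; split=> //; exact: meet_iter_sub hy.
have fy : fwd a^-1 U (a^-1 y) by move=> n; have [+ _] := hy n; apply.
exists (a^-1 y) => //; split; first by apply: sg_div => //; exact: fwd_sub fy.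
by rewrite cautM caut_Vg cautKV; case: (hy 0%N).
Qed.

(** The plus factor is corrected at time [n]: [factors_step] applied to [a^n(y^-1 x)] gives [y'] in
    [U_+], and [y a^-n(y')] serves for one more step. A limit of these approximate factors serves
    for all times. *)
Lemma factors_of_minimal : factors a U.
Proof.
move=> x Ux.
have H n : exists2 y, fwd a^-1 U y &
    forall k, (k <= n)%N -> U ((a ^+ k) (y^-1 * x)).
  elim: n => [|n [y hy IH]].
    exists 1; first by case: (fwd_subgroup a^-1 hU).
    by move=> k; rewrite leqn0 => /eqP ->; rewrite invg1 mul1g.
  have [y' hy' [Uy' Uay']] := factors_step (IH n (leqnn n)).
  have hz : fwd a^-1 U ((a^-1 ^+ n) y') by exact: fwd_iter.
  exists (y * (a^-1 ^+ n) y').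
    by case: (fwd_subgroup a^-1 hU) => _ + _; apply.
  have E k : (a ^+ k) ((y * (a^-1 ^+ n) y')^-1 * x) =
     ((a ^+ k) ((a^-1 ^+ n) y'))^-1 * (a ^+ k) (y^-1 * x).
    by rewrite invgM -mulgA cautM caut_Vg.
  move=> k; rewrite leq_eqVlt => /predU1P[->|kn].
    rewrite expgSg E -[X in X^-1](_ : y' = _); last by rewrite expgVK.
    exact: Uay'.
  rewrite E; apply: sg_div => //; last by apply: IH.
  have -> : (a ^+ k) ((a^-1 ^+ n) y') = (a^-1 ^+ (n - k)) y'.
    by rewrite exp_subVg.
  exact: hy'.
have [|||y [_ hy]] := @compact_directed G nat 0%N U
    (fun n => [set y | fwd a^-1 U y /\ forall k, (k <= n)%N -> U ((a ^+ k) (y^-1 * x))]) cU.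
- move=> n; apply: closedI; first exact: fwd_closed.
  suff : closed (\bigcap_(k in [set k | (k <= n)%N])
      ((fun y => (a ^+ k) (y^-1 * x)) @^-1` U)) by [].
  apply: closed_bigI => k _; apply: closed_pre => //.
  apply: caut_comp_continuous; first exact: caut_continuous.
  by apply: continuous_mulg; [exact: invg_continuous|exact: continuous_cstg].
- move=> i j; exists (maxn i j) => y [h Uy]; split; split=> // k kn; apply: Uy.
    by rewrite leq_max kn.
  by rewrite leq_max kn orbT.
- by move=> n; have [y hy Uy] := H n; exists y; split=> //; exact: fwd_sub hy.
exists y; first by case: (hy 0%N).
by move=> n; have [_] := hy n; apply.
Qed.

End TidyAbove.

(** * Homoclinic elements and tidying below *)

Definition homoclinic (G : topGroupType) (a : caut G) (U : set G) : set G :=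
  [set x | exists N, forall n, (N <= n)%N -> U ((a ^+ n) x) /\ U ((a^-1 ^+ n) x)].

Lemma homoclinicV (G : topGroupType) (a : caut G) (U : set G) :
  homoclinic a^-1 U = homoclinic a U.
Proof.
by apply/seteqP; split=> x [N h]; exists N => n /h[? ?]; split=> //;
  rewrite ?invgK // -1?[a]invgK.
Qed.

Section Homoclinic.
Context (G : topGroupType) (a : caut G) (U : set G).
Hypotheses (hsG : hausdorff_space G) (hU : is_subgroup U) (cU : compact U).
Hypotheses (oU : open U) (fU : factors a U).

Let clU : closed U. Proof. exact: open_subgroup_closed. Qed.

Lemma homoclinic_subgroup : is_subgroup (homoclinic a U).
Proof.
case: hU => u1 uM uV; split; first by exists 0%N => n _; rewrite !caut_1.
  move=> x y [N hN] [M hM]; exists (maxn N M) => n; rewrite geq_max => /andP[Nn Mn].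
  have [? ?] := hN n Nn; have [? ?] := hM n Mn.
  by rewrite !cautM; split; exact: uM.
by move=> x [N hN]; exists N => n /hN[? ?]; rewrite !caut_Vg; split; exact: uV.
Qed.

Lemma homoclinic_step x : homoclinic a U x -> homoclinic a U (a x).
Proof.
move=> [N h]; exists N.+1 => n Nn; split; first by rewrite -expgSrg; apply h; exact: leqW (ltnW Nn).
case: n Nn => // n Nn; by rewrite expgSrg cautVKg; case: (h n Nn).
Qed.

Lemma homoclinicX n x : homoclinic a U x -> homoclinic a U ((a ^+ n) x).
Proof. by move=> h; elim: n => // n IH; rewrite expgSg; exact: homoclinic_step. Qed.

End Homoclinic.

Lemma homoclinicVX (G : topGroupType) (a : caut G) U n x :
  homoclinic a U x -> homoclinic a U ((a^-1 ^+ n) x).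
Proof. by rewrite -homoclinicV; exact: homoclinicX. Qed.

Lemma act_iterP (G : topGroupType) (a : caut G) (A : set G) n x :
  act (a ^+ n) A x <-> A ((a^-1 ^+ n) x).
Proof. by rewrite actE expVgn. Qed.

Section TidyBelow.
Context (G : topGroupType) (a : caut G) (U : set G).
Hypotheses (hsG : hausdorff_space G) (hU : is_subgroup U) (cU : compact U).
Hypotheses (oU : open U) (fU : factors a U).

Let clU : closed U. Proof. exact: open_subgroup_closed. Qed.
Let hH := homoclinic_subgroup a hU.

Let E : set G := homoclinic a U `&` fwd a^-1 U.

Let hE : is_subgroup E.
Proof. by apply: is_subgroupI => //; exact: fwd_subgroup. Qed.

(* Finitely many cosets represent [a E / E], and a common power of [a] moves
   all representatives into [U] for good. *)
Lemma homoclinic_bounded : exists2 K, compact K & homoclinic a U `<=` K.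
Proof.
have fin : finite_set (left_cosets (act a E) U).
  apply: (@sub_finite_set _ _ (left_cosets (act a U) U)); last first.
    exact: left_cosets_finite (act_compact (a := a) cU) hU oU.
  move=> _ [x [_ hx] <-]; exists x => //; exact: fwd_sub hx.
have [||N hN] := finite_uniform (P := fun D N => exists y, [/\ act a E y,
    D = left_coset y U & fwd a U ((a ^+ N) y)]) fin.
- move=> D m n mn [y [Ey hy fy]]; exists y; split=> //.
  by rewrite -(subnK mn) expg_addg; exact: fwd_iter.
- move=> _ [x Ex <-]; have [[M hM] _] := Ex.
  exists M.+1, x; split=> // k; rewrite -expg_addg -[x](cautKV a) -expgSrg.
  by have /hM[] : (M <= (k + M.+1).+1)%N by lia.
(* Write [a x = y e] with [y] one of the representatives and [e] in [E]: after [N] further steps [y]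
   is in [U_-] for good, and the induction continues with [e]. *)
have key m x : E x -> exists2 u, fwd a U u & act (a ^+ N) E (u^-1 * (a ^+ (N + m)) x).
  elim: m x => [|m IH] x Ex.
    exists 1; first by case: (fwd_subgroup a hU).
    by rewrite invg1 mul1g addn0; apply/actP.
  have aEx : act a E (a x) by apply/actP.
  have [|y [Ey /(left_coset_eqP _ _ hU) Uyx fy]] := hN (left_coset (a x) U); first by exists (a x).
  have Ue : U (y^-1 * a x) by rewrite -(sg_inv_iff _ hU) invgM invgK.
  have Ee : E (y^-1 * a x).
    split.
      apply: (sg_div hH); last by case: Ex => h _; exact: homoclinic_step.
      by rewrite -[y](cautKV a); apply: homoclinic_step; case: Ey.
    move=> [//|k]; rewrite expgSrg.
    have : E (a^-1 (y^-1 * a x)) by exact: sg_div (act_subgroup a hE) Ey aEx.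
    by case=> _; apply.
  have [u fu hu] := IH _ Ee.
  exists ((a ^+ (N + m)) y * u).
    case: (fwd_subgroup a hU) => _ + _; apply=> //.
    by rewrite addnC expg_addg; exact: fwd_iter.
  rewrite invgM -mulgA addnS expgSrg.
  by move: hu; rewrite cautM caut_Vg.
exists (set_mulg U (act (a ^+ N) U)).
  by apply: compact_set_mulg => //; exact: act_compact.
move=> x hx; have [M hM] := hx.
have Ex : E ((a^-1 ^+ (N + M)) x).
  split; first exact: homoclinicVX.
  by move=> n; rewrite -expg_addg; apply hM; rewrite addnA leq_addl.
have [u fu] := key M _ Ex; rewrite expgVK => hu.
exists u; first exact: fwd_sub fu.
exists (u^-1 * x); last by rewrite mulVKg.
by case: hu => _ /fwd_sub.
Qed.

(** A compact group stable under [a] and [a^-1]; joining it to a compact open subgroup, as in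
    [exists_tidy_subgroup], removes the failure of tidiness below. *)
Definition homoclinic_closure : set G := closure (homoclinic a U).
Local Notation L := homoclinic_closure.

Lemma homoclinic_closure_compact : compact L.
Proof.
have [K cK HK] := homoclinic_bounded.
apply: (subclosed_compact _ cK); first exact: closed_closure.
rewrite (iffLR (closure_id K)); last exact: compact_closed.
exact: closure_subset.
Qed.

Lemma homoclinic_closure_subgroup : is_subgroup L.
Proof. exact: closure_subgroup. Qed.

Lemma homoclinic_closureX n x : L x -> L ((a ^+ n) x) /\ L ((a^-1 ^+ n) x).
Proof.
move=> clx; split=> N Nx.
  have [y [hy Ny]] := clx _ (@caut_continuous _ (a ^+ n) x N Nx).
  by exists ((a ^+ n) y); split=> //; exact: homoclinicX.
have [y [hy Ny]] := clx _ (@caut_continuous _ (a^-1 ^+ n) x N Nx).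
by exists ((a^-1 ^+ n) y); split=> //; exact: homoclinicVX.
Qed.

(** Some coset of [U] contains [a^m u] and also [a^n u] for arbitrarily large [n]. In the
    factorization [w = y z] of the quotient, [z] is homoclinic, and dividing [u] by [l = a^-n(z)]
    leaves an element whose images under [a^k] lie in [U_+] up to [k = n - m]. In the limit, [l] is
    in [L] and [u l^-1] has its whole orbit in [U]. *)
Lemma bdd_fwdV_closure u : fwd a^-1 U u -> bdd a u -> L u.
Proof.
move=> fu [K cK hK].
have [|D hD] := @recurrent _ (left_cosets K U) (fun n => left_coset ((a ^+ n) u) U)
    (left_cosets_finite cK hU oU).
  by move=> n; exists ((a ^+ n) u).
have [m _ Dm] := hD 0%N.
have key k : exists2 l, homoclinic a U l & fwd a^-1 U ((a ^+ k) (u * l^-1)).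
  have [n nk Dn] := hD (m + k)%N.
  have mn : (m <= n)%N by exact: leq_trans (leq_addr _ _) nk.
  have kn : (k <= n)%N by exact: leq_trans (leq_addl _ _) nk.
  have mkn : (m <= n - k)%N by rewrite leq_subRL// addnC.
  pose w := ((a ^+ m) u)^-1 * (a ^+ n) u.
  have Uw : U w by apply/left_coset_eqP => //; rewrite Dm.
  have [y fy fz] := fU Uw; pose z := y^-1 * w.
  have hz : homoclinic a U z.
    exists n => j nj; split; first exact: fz.
    have mj := leq_trans mn nj.
    rewrite /z /w !cautM !caut_Vg !expg_subV//.
    apply: (sg_div hU); first exact: fy.
    by apply: (sg_div hU); exact: fu.
  exists ((a^-1 ^+ n) z); first exact: homoclinicVX.
  have -> : u * ((a^-1 ^+ n) z)^-1 = (a^-1 ^+ n) ((a ^+ m) u * y).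
    have {1}-> : u = (a^-1 ^+ n) ((a ^+ n) u) by rewrite expVgK.
    rewrite -caut_Vg -cautM; congr (_ _).
    by rewrite /z /w !invgM !invgK !mulgA mulgV mul1g.
  rewrite exp_subVg// cautM expg_subV//.
  by case: (fwd_subgroup a^-1 hU) => _ + _; apply; exact: fwd_iter.
have [||||l [Ll hl]] := @compact_directed G nat 0%N L
   (fun k => [set l | fwd a^-1 U ((a ^+ k) (u * l^-1))]).
- exact: homoclinic_closure_compact.
- move=> k; apply: (@closed_pre _ _ (fun l => (a ^+ k) (u * l^-1))); last exact: fwd_closed.
  apply: caut_comp_continuous; first exact: caut_continuous.
  by apply: continuous_mulg; [exact: continuous_cstg|exact: invg_continuous].
- move=> i j; exists (maxn i j) => l /= h; split.
    by rewrite -(subKn (leq_maxl i j)) -expV_subg ?leq_subr//; exact: fwd_iter.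
  by rewrite -(subKn (leq_maxr i j)) -expV_subg ?leq_subr//; exact: fwd_iter.
- move=> k; have [l hl fl] := key k; exists l; split=> //; exact: subset_closure.
have Lz : L (u * l^-1).
  apply: subset_closure; exists 0%N => n _; split; first exact: (hl n 0%N).
  exact: (hl 0%N).
by rewrite -(mulgVK l u); case: homoclinic_closure_subgroup => _ + _; apply.
Qed.

End TidyBelow.

Definition co_subgroup (G : topGroupType) (U : set G) : Prop :=
  [/\ is_subgroup U, compact U & open U].

Lemma homoclinic_closureV (G : topGroupType) (a : caut G) (U : set G) :
  homoclinic_closure a^-1 U = homoclinic_closure a U.
Proof. by rewrite /homoclinic_closure homoclinicV. Qed.

(** In [x = y z] with [y] in [U_+] and [z] in [U_-], boundedness in both directions passes from [x]
    to [y] and [z]; [bdd_fwdV_closure] then applies to [y] for [a] and to [z] for [a^-1]. *)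
Lemma bdd_closure (G : topGroupType) (a : caut G) (U : set G) x :
  hausdorff_space G -> co_subgroup U -> factors a U ->
  U x -> bdd a x -> bdd a^-1 x -> homoclinic_closure a U x.
Proof.
move=> hs [hU cU oU] fU Ux bx bVx; have [y fy fz] := fU x Ux.
have Ly : homoclinic_closure a U y.
  apply: bdd_fwdV_closure => //.
  rewrite (_ : y = x * (y^-1 * x)^-1); last by rewrite invgM invgK mulVKg.
  by apply: bddM => //; apply: bddV; exact: fwd_bdd cU fz.
rewrite -(mulVKg y x).
have [_ + _] := homoclinic_closure_subgroup a hU; apply=> //.
rewrite -homoclinic_closureV; apply: bdd_fwdV_closure => //.
- exact: factorsV.
- by rewrite invgK.
- by apply: bddM => //; apply: bddV; exact: fwd_bdd cU fy.
Qed.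

Lemma ex_min_nat (f : nat -> nat) : exists n, forall m, (f n <= f m)%N.
Proof.
have ex : exists k, `[< exists n, f n = k >] by exists (f 0%N); apply/asboolP; exists 0%N.
case: (ex_minnP ex) => k /asboolP[n <-] h.
by exists n => m; apply: h; apply/asboolP; exists m.
Qed.

Lemma meet_iterD (G : topGroupType) (a : caut G) (U : set G) m n :
  meet_iter a (meet_iter a U m) n = meet_iter a U (m + n).
Proof.
apply/seteqP; split=> x h k kl.
  have [km|km] := leqP k m; first by have := h 0%N isT k km.
  rewrite -(subnKC (ltnW km)) expg_addg.
  by apply: (h (k - m)%N _ m (leqnn m)); rewrite leq_subLR.
by move=> j jm; rewrite -expg_addg; apply: h; rewrite leq_add.
Qed.

(** [U0] is the part of [U] normalized by [L], so [U0 L] is a compact open group containing [L].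
    Passing to its [meet_iter] of least displacement index restores the factorization and keeps [L].
    The last property says that the union of the [a^n(V_+)] meets [V] in [V_+]: the minus factor of
    such an [x] is bounded in both directions, hence lies in [L], which is stable. *)
Lemma exists_tidy_subgroup (G : topGroupType) (a : caut G) (U : set G) :
  hausdorff_space G -> co_subgroup U -> factors a U ->
  exists V : set G, [/\ co_subgroup V, factors a V &
    forall n x, V x -> fwd a^-1 V ((a^-1 ^+ n) x) -> fwd a^-1 V x].
Proof.
move=> hs coU fU; have [hU cU oU] := coU.
pose L := homoclinic_closure a U.
have hL : is_subgroup L := homoclinic_closure_subgroup a hU.
have cL : compact L := homoclinic_closure_compact hs hU cU oU.
have LX n x : L x -> L ((a ^+ n) x) /\ L ((a^-1 ^+ n) x) := @homoclinic_closureX _ _ _ n x.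
pose U0 := [set x | forall k, L k -> U (k^-1 * x * k)].
have L1 : L 1 by case: hL.
have hU0 : is_subgroup U0.
  case: hU => u1 uM uV; split; first by move=> k _; rewrite mulg1 mulVg.
    move=> x y hx hy k Lk; rewrite (_ : _ * _ * k = (k^-1 * x * k) * (k^-1 * y * k)).
      by apply: uM; [exact: hx|exact: hy].
    by rewrite !mulgA mulgK.
  move=> x hx k Lk; rewrite (_ : _ * _ * k = (k^-1 * x * k)^-1); first exact/uV/hx.
  by rewrite !invgM invgK mulgA.
have U0U : U0 `<=` U by move=> x /(_ 1 L1); rewrite invg1 mul1g mulg1.
have nU0 l x : L l -> U0 x -> U0 (l * x * l^-1).
  move=> Ll h k Lk; rewrite (_ : _ * k = (l^-1 * k)^-1 * x * (l^-1 * k)).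
    exact: h _ (sg_div hL Ll Lk).
  by rewrite invgM invgK !mulgA.
pose V := set_mulg U0 L.
have hV : is_subgroup V.
  have [l1 lM lV] := hL; have [u1 uM uV] := hU0; split.
  - by exists 1 => //; exists 1 => //; rewrite mulg1.
  - move=> _ _ [u hu [l hl <-]] [u' hu' [l' hl' <-]].
    exists (u * (l * u' * l^-1)); first exact/uM/nU0.
    by exists (l * l'); [exact: lM|rewrite !mulgA mulgVK].
  - move=> _ [u hu [l hl <-]]; exists (l^-1 * u^-1 * l^-1^-1).
      by apply: nU0; [exact: lV|exact: uV].
    by exists l^-1; [exact: lV|rewrite invgM invgK mulgK].
have LV : L `<=` V by move=> l Ll; exists 1; [case: hU0|exists l => //; rewrite mul1g].
have oV : open V.
  apply: nbhs1_open => //; apply: filterS (open_conj_core cL oU _); last by case: hU.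
  by move=> x hx; exists x => //; exists 1 => //; rewrite mulg1.
have VUL : V `<=` set_mulg U L by move=> _ [u hu [l hl <-]]; exists u; [exact: U0U|exists l].
have cV : compact V.
  apply: subclosed_compact VUL; first exact: open_subgroup_closed.
  exact: compact_set_mulg.
have [N hN] := ex_min_nat (fun n => coset_index (act a (meet_iter a V n)) (meet_iter a V n)).
pose V' := meet_iter a V N.
have hV' : is_subgroup V' by exact: meet_iter_subgroup.
have cV' : compact V' by exact: meet_iter_compact.
have oV' : open V' by exact: meet_iter_open.
have fV' : factors a V'.
  by apply: factors_of_minimal => // n; rewrite meet_iterD; exact: hN.
have LV' : L `<=` V' by move=> l Ll k _; apply: LV; have [] := LX k l Ll.
have bL x : V' x -> bdd a x -> bdd a^-1 x -> L x.
  move=> V'x bx bVx; have [u U0u [l Ll ul]] := VUL x (meet_iter_sub V'x).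
  rewrite -ul; have [_ + _] := hL; apply=> //.
  have uE : u = x * l^-1 by rewrite -ul mulgK.
  have bl : bdd a l by exists L => // n; case: (LX n l Ll).
  have bVl : bdd a^-1 l by exists L => // n; case: (LX n l Ll).
  by apply: bdd_closure => //; rewrite uE; apply: bddM => //; exact: bddV.
exists V'; split=> // n x V'x hx.
have [y fy fz] := fV' x V'x.
rewrite -(mulVKg y x); have [_ + _] := fwd_subgroup a^-1 hV'; apply=> //.
suff Lz : L (y^-1 * x) by move=> k; apply: LV'; case: (LX k _ Lz).
apply: bL; [exact: (fz 0%N)|exact: fwd_bdd fz|].
apply: bddM; first by apply: bddV; exact: fwd_bdd fy.
exists (act (a ^+ n) V'); first exact: act_compact.
move=> k; apply/act_iterP; rewrite -expg_addg addnC expg_addg; exact: hx.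
Qed.

(** * Displacement indices of powers *)

Lemma coset_index_self (G : groupType) (P : set G) : is_subgroup P ->
  finite_set (left_cosets P P) /\ coset_index P P = 1%N.
Proof.
move=> hP.
have E : left_cosets P P = [set P].
  apply/seteqP; split=> C; last first.
    move=> ->; exists 1; first by case: hP.
    apply/seteqP; split=> x.
      by move/left_cosetE; rewrite invg1 mul1g.
    by move=> Px; apply/left_cosetE; rewrite invg1 mul1g.
  move=> [x Px <-]; apply/seteqP; split=> y.
    by move=> /left_cosetE /(sg_mull _ hP); apply; apply/sg_inv_iff.
  by move=> Py; apply/left_cosetE; exact: sg_div.
by rewrite /coset_index E fset_set1 cardfs1; split=> //; exact: finite_set1.
Qed.

(** If [x] and [y] share a coset of [B] but not of [C], the cosets of [C] other than [x C] still
    reach all cosets of [B], so the index over [C] is strictly larger. *)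
Lemma coset_index_eq_inv (G : groupType) (A B C : set G) :
  is_subgroup B -> is_subgroup C -> C `<=` B ->
  finite_set (left_cosets A C) -> (coset_index A C <= coset_index A B)%N ->
  forall x y, A x -> A y -> B (x^-1 * y) -> C (x^-1 * y).
Proof.
move=> hB hC CB fC le x y Ax Ay Bxy; apply: contrapT => nC.
have mulE z : set_mulg (left_coset z C) B = left_coset z B.
  apply/seteqP; split=> w.
    move=> [_ [c Cc <-] [b Bb <-]]; exists (c * b); last by rewrite mulgA.
    by have [_ + _] := hB; apply=> //; exact: CB.
  move=> [b Bb <-]; exists z; last by exists b.
  by exists 1; [case: hC|rewrite mulg1].
have [|_] := @card_le_surj _ _ (left_cosets A C `\ left_coset x C)
    (left_cosets A B) (fun D => set_mulg D B) (finite_setD _ fC).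
  move=> _ [z Az <-].
  have [E|nE] := pselect (left_coset z C = left_coset x C).
    exists (left_coset y C).
      by split; [exists y|move=> /esym/(left_coset_eqP _ _ hC)].
    by rewrite mulE -(mulE z) E mulE; apply/esym/left_coset_eqP.
  by exists (left_coset z C); [split=> //; exists z|rewrite mulE].
rewrite leqNgt => /negP; apply; apply: leq_trans le.
rewrite fset_setD1// /coset_index [X in (_ < X)%N](cardfsD1 (left_coset x C)).
by rewrite in_fset_set// mem_set//; exists x.
Qed.

(** Each inclusion in the chain [P <= a(P) <= ... <= a^n(P)] has index [[a(P) : P]]. *)
Lemma coset_index_iter (G : topGroupType) (a : caut G) (P : set G) n :
  is_subgroup P -> P `<=` act a P -> finite_set (left_cosets (act a P) P) ->
  finite_set (left_cosets (act (a ^+ n) P) P) /\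
  coset_index (act (a ^+ n) P) P = (coset_index (act a P) P ^ n)%N.
Proof.
move=> hP Pa fin; elim: n => [|n [IHf IHc]].
  have -> : act (a ^+ 0) P = P by rewrite expg0 act1.
  by have [? ->] := coset_index_self hP.
have PX m : P `<=` act (a ^+ m) P.
  elim: m => [|m IH]; first by rewrite expg0 act1.
  by rewrite expgSr act_mul => x Px; have := IH x Px; rewrite !actE; exact: Pa.
have [f1 c1] := coset_index_act (a ^+ n) hP fin.
rewrite -act_mul -expgSr in f1 c1.
have hPn : is_subgroup (act (a ^+ n) P) by exact: act_subgroup.
have [f2 c2] := coset_index_trans hPn hP f1 IHf.
split=> //; apply/eqP; rewrite eqn_leq; apply/andP; split.
  by rewrite (leq_trans c2)// c1 IHc expnS.
rewrite expnS -IHc -c1; apply: coset_index_mul => //.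
move=> x y hx hy; have [_ + _] := act_subgroup (a ^+ n.+1) hP; apply=> //.
by rewrite expgSr act_mul actE; apply: Pa.
Qed.

Lemma act_cosets_finite (G : topGroupType) (b : caut G) (A B : set G) :
  co_subgroup A -> co_subgroup B -> finite_set (left_cosets (act b A) B).
Proof.
move=> [hA cA oA] [hB cB oB].
exact: left_cosets_finite (act_compact (a := b) cA) hB oB.
Qed.

(** Count through [a(U)]: as many of its cosets meet [a(b(U))] as cosets of [U] meet [b(U)]. *)
Lemma coset_index_actM (G : topGroupType) (a b : caut G) (U : set G) : co_subgroup U ->
  (coset_index (act (a * b)%g U) U <= coset_index (act a U) U * coset_index (act b U) U)%N.
Proof.
move=> coU; have [hU cU oU] := coU; rewrite act_mul.
have [f c] := coset_index_act a hU (act_cosets_finite b coU coU).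
have [_] := coset_index_trans (act_subgroup a hU) hU f (act_cosets_finite a coU coU).
by move/leq_trans; apply; rewrite c mulnC.
Qed.

Lemma coset_index_pow (G : topGroupType) (a : caut G) n (U : set G) : co_subgroup U ->
  (coset_index (act (a ^+ n) U) U <= coset_index (act a U) U ^ n)%N.
Proof.
move=> coU; elim: n => [|n IH].
  by rewrite expn0 expg0 act1; have [hU _ _] := coU; have [_ ->] := coset_index_self hU.
rewrite expnS expgS; apply: leq_trans (coset_index_actM _ _ coU) _.
by rewrite leq_mul2l IH orbT.
Qed.

Section Minimizing.
Context (G : topGroupType) (a : caut G) (U : set G).
Hypotheses (hs : hausdorff_space G) (coU : co_subgroup U).
Hypothesis minU : forall V, co_subgroup V ->
  (coset_index (act a U) U <= coset_index (act a V) V)%N.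

Lemma minimal_factors : factors a U.
Proof.
have [hU cU oU] := coU; apply: factors_of_minimal => // n; apply: minU.
by split; [exact: meet_iter_subgroup|exact: meet_iter_compact|exact: meet_iter_open].
Qed.

Lemma fwdV_mono V : is_subgroup V -> fwd a^-1 V `<=` act a (fwd a^-1 V).
Proof. by move=> hV x /fwd_step. Qed.

Lemma act_fwdV_cap V : is_subgroup V ->
  forall x y, act a (fwd a^-1 V) x -> act a (fwd a^-1 V) y ->
  V (x^-1 * y) -> fwd a^-1 V (x^-1 * y).
Proof.
move=> hV x y hx hy Vxy; apply/fwdS; split=> //.
have hP : is_subgroup (fwd a^-1 V) by exact: fwd_subgroup.
by rewrite cautM caut_Vg; exact: (sg_div hP hx hy).
Qed.

(** Since [a^n(V) = a^n(V_+) a^n(V_-)] and [a^n(V_-)] stays in [V], only [V_+] contributes cosets of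
    [V]. *)
Lemma fwdV_index V : co_subgroup V -> factors a V ->
  [/\ finite_set (left_cosets (act a (fwd a^-1 V)) (fwd a^-1 V)),
   coset_index (act a (fwd a^-1 V)) (fwd a^-1 V) = coset_index (act a V) V &
   forall n, finite_set (left_cosets (act (a ^+ n) (fwd a^-1 V)) V) /\
    coset_index (act (a ^+ n) V) V = coset_index (act (a ^+ n) (fwd a^-1 V)) V].
Proof.
move=> [hV cV oV] fV; pose P := fwd a^-1 V.
have hP : is_subgroup P by exact: fwd_subgroup.
have PV : P `<=` V by exact: fwd_sub.
have X n : finite_set (left_cosets (act (a ^+ n) P) V) /\
    coset_index (act (a ^+ n) V) V = coset_index (act (a ^+ n) P) V.
  have fin : finite_set (left_cosets (act (a ^+ n) V) V).
    exact: left_cosets_finite (act_compact (a := a ^+ n) cV) hV oV.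
  have [|f c] := @coset_index_le _ (act (a ^+ n) P) (act (a ^+ n) V) _ hV fin.
    by move=> x Px; exists x; [exact: PV|rewrite mulVg; case: hV].
  split=> //; apply/eqP; rewrite eqn_leq c andbT.
  apply: (coset_index_le hV f _).2 => x hx.
  have [y fy fz] := fV _ hx; exists ((a ^+ n) y); first exact/actP.
  have := fz n; rewrite cautM caut_Vg.
  by rewrite -[_ ((a ^+ n)^-1 x)]/(((a ^+ n) * (a ^+ n)^-1) x) mulgV.
have [f c] := X 1%N; rewrite expg1 in f c.
have [|f' c'] := coset_index_eq hV hP PV _ f; first exact: act_fwdV_cap.
by split=> //; rewrite c' c.
Qed.

(** For the subgroup [V] of [exists_tidy_subgroup] the index at [a^m] is an exact power, at least
    the [m]-th power of the minimum, and it is at most a constant times the index of [U] at [a^m].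
    Taking [m = n k] and letting [k] grow removes the constant by [expn_growth]. *)
Lemma minimal_index_le n :
  (coset_index (act a U) U ^ n <= coset_index (act (a ^+ n) U) U)%N.
Proof.
have [hU cU oU] := coU.
have [V [coV fV tV]] := exists_tidy_subgroup hs coU minimal_factors.
have [hV cV oV] := coV.
have [f1 c1 X] := fwdV_index coV fV.
have hP := fwd_subgroup a^-1 hV.
have powV m : (coset_index (act a U) U ^ m <= coset_index (act (a ^+ m) V) V)%N.
  have [fm cm] := coset_index_iter m hP (fwdV_mono hV) f1.
  have [fX cX] := X m; rewrite cX.
  have [|_ <-] := coset_index_eq hV hP (@fwd_sub _ _ _) _ fX.
    move=> x y hx hy Vxy; apply: tV Vxy _ => //.
    by apply/act_iterP; apply: sg_div hx hy; exact: act_subgroup.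
  by rewrite cm c1; case: m {fm cm fX cX} => // m; rewrite leq_exp2r//; exact: minU.
have fin := @act_cosets_finite G.
have finUV := fin 1 _ _ coU coV; rewrite act1 in finUV.
have finVU := fin 1 _ _ coV coU; rewrite act1 in finVU.
apply: (@expn_growth _ _ (coset_index V U * coset_index U V)) => k.
rewrite -expnM; apply: leq_trans (powV _) _.
have pw := coset_index_pow (a ^+ n) k coU; rewrite -expgnA in pw.
have [fA cA] := coset_index_act (a ^+ (n * k)) hU finVU.
have [f2 c2] := coset_index_trans hU hV (fin (a ^+ (n * k)) _ _ coU coU) finUV.
have [_ c3] := coset_index_trans (act_subgroup (a ^+ (n * k)) hU) hV fA f2.
apply: leq_trans c3 _; rewrite cA -mulnA leq_mul2l; apply/orP; right.
by apply: leq_trans c2 _; rewrite mulnC leq_mul2l pw orbT.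
Qed.

(** The number of cosets of [U_+] in [a^n(U_+)] is [[a(U_+) : U_+] ^ n], by [minimal_index_le] at
    most the number of cosets of [U] that meet [a^n(U_+)]; so no two of them merge modulo [U]. The
    pair [1], [x] gives the claim. *)
Lemma minimal_fwdV_cap n x : U x -> fwd a^-1 U ((a^-1 ^+ n) x) -> fwd a^-1 U x.
Proof.
move=> Ux hx; have [hU cU oU] := coU; have hP := fwd_subgroup a^-1 hU.
have [f1 c1 X] := fwdV_index coU minimal_factors.
have [fX cX] := X n.
have [fm cm] := coset_index_iter n hP (fwdV_mono hU) f1.
rewrite -[x]mul1g -invg1.
apply: (coset_index_eq_inv hU hP (@fwd_sub _ _ _) fm (A := act (a ^+ n) (fwd a^-1 U))).
- by rewrite cm c1 -cX; exact: minimal_index_le.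
- by rewrite actE caut_1; case: hP.
- exact/act_iterP.
- by rewrite invg1 mul1g.
Qed.

(** It suffices to treat the factor [y] in [U_+]. Its orbit is in one coset of [U] at time [m] and
    at arbitrarily late times [n]; [minimal_fwdV_cap] puts [(a^m y)^-1 a^n y] in [U_+], whence
    [a^(n - m) y] is in [U_+] and all earlier images are in [U]. *)
Lemma minimal_traps : traps a U.
Proof.
move=> x Ux bx; have [hU cU oU] := coU.
have [y fy fz] := minimal_factors Ux.
have by_ : bdd a y.
  rewrite (_ : y = x * (y^-1 * x)^-1); last by rewrite invgM invgK mulVKg.
  by apply: bddM => //; apply: bddV; exact: fwd_bdd cU fz.
suff fay : fwd a U y.
  by rewrite -(mulVKg y x); have [_ + _] := fwd_subgroup a hU; apply.
have [K cK hK] := by_.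
have [|D hD] := @recurrent _ (left_cosets K U) (fun n => left_coset ((a ^+ n) y) U)
    (left_cosets_finite cK hU oU).
  by move=> n; exists ((a ^+ n) y).
have [m _ Dm] := hD 0%N.
move=> k; have [n nk Dn] := hD (m + k)%N.
have mn : (m <= n)%N by exact: leq_trans (leq_addr _ _) nk.
have Uw : U (((a ^+ m) y)^-1 * (a ^+ n) y) by apply/left_coset_eqP => //; rewrite Dm.
have hP := fwd_subgroup a^-1 hU.
have aPm i : fwd a^-1 U ((a^-1 ^+ i) ((a ^+ i) y)) by rewrite expVgK.
have Pw : fwd a^-1 U (((a ^+ m) y)^-1 * (a ^+ n) y).
  apply: (@minimal_fwdV_cap n) => //.
  rewrite cautM caut_Vg; apply: (sg_div hP) => //.
  by rewrite expg_subV//; exact: fwd_iter.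
have : fwd a^-1 U ((a^-1 ^+ m) ((a ^+ n) y)).
  rewrite -(mulVKg ((a ^+ m) y) ((a ^+ n) y)) cautM.
  by have [_ + _] := hP; apply => //; exact: fwd_iter.
rewrite expV_subg// => h.
have kn : (k <= n - m)%N by rewrite leq_subRL.
by rewrite -(subKn kn) -expV_subg ?leq_subr//; exact: h.
Qed.

End Minimizing.

(** * Intersections of tidy subgroups *)

Definition tidy_for (G : topGroupType) (a : caut G) (A : set G) : Prop :=
  [/\ co_subgroup A, factors a A, traps a A & traps a^-1 A].

Section TidyFor.
Context (G : topGroupType).
Implicit Types (a b : caut G) (A B : set G) (x y : G).

Lemma expg_conj a b n : (b * a * b^-1) ^+ n = b * a ^+ n * b^-1.
Proof.
elim: n => [|n IH]; first by rewrite !expg0 mulg1 mulgV.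
by rewrite !expgS IH !mulgA mulgVK.
Qed.

Lemma fwd_conj a b A : fwd (b * a * b^-1) (act b A) = act b (fwd a A).
Proof.
apply/seteqP; split=> x h n; have := h n; rewrite actE expg_conj 2!cautMg cautVKg //.
Qed.

Lemma bdd_conj a b x : bdd (b * a * b^-1) x -> bdd a (b^-1 x).
Proof.
move=> [K cK hK]; exists (act b^-1 K); first exact: act_compact.
by move=> n; apply/actV; have := hK n; rewrite expg_conj 2!cautMg.
Qed.

Lemma traps_conj a b A : traps a A -> traps (b * a * b^-1) (act b A).
Proof.
move=> tA x Ax /bdd_conj bx; rewrite fwd_conj; exact: tA.
Qed.

Lemma tidy_for_conj a b A : tidy_for a A -> tidy_for (b * a * b^-1) (act b A).
Proof.
move=> [[hA cA oA] fA tA tVA].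
have VE : (b * a * b^-1)^-1 = b * a^-1 * b^-1 by rewrite !invgM invgK mulgA.
split; [|move=> x Ax| |].
- by split; [exact: act_subgroup|exact: act_compact|exact: act_open].
- have [y fy fz] := fA _ Ax; exists (b y).
    by rewrite VE fwd_conj; apply/actP.
  by rewrite fwd_conj actE cautM caut_Vg cautVKg.
- exact: traps_conj.
- by rewrite VE; exact: traps_conj.
Qed.

Lemma co_subgroupI A B : co_subgroup A -> co_subgroup B -> co_subgroup (A `&` B).
Proof.
move=> [hA cA oA] [hB cB oB]; split; [exact: is_subgroupI| |exact: openI].
apply: (subclosed_compact _ cA); last by move=> x [].
by apply: closedI; exact: open_subgroup_closed.
Qed.

(* The elements of the decreasing sequence of compact groups [a^-n A_+] are
   eventually close to their intersection [A_0]. *)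
Lemma fwdV_near a A O : co_subgroup A -> is_subgroup O -> open O ->
  exists N, forall n y, (N <= n)%N -> fwd a^-1 A y ->
    exists2 c, fwd a A c /\ fwd a^-1 A c & O (c^-1 * (a^-1 ^+ n) y).
Proof.
move=> [hA cA oA] hO oO; apply: contrapT => /forallNP nex.
pose A0 := fwd a A `&` fwd a^-1 A.
have oAO : open (set_mulg A0 O) by exact: open_set_mulg.
have clA : closed A by exact: open_subgroup_closed.
have [||||z [_ hz]] := @compact_directed G nat 0%N A
  (fun n => [set z | fwd a^-1 A ((a ^+ n) z)] `&` ~` (set_mulg A0 O)).
- exact: cA.
- move=> n; apply: closedI; last exact: open_closedC.
  by apply: (@closed_pre _ _ (a ^+ n)); [exact: caut_continuous|exact: fwd_closed].
- move=> i j; exists (maxn i j) => z [/= h nz]; do 2!split => //=.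
    by rewrite -(subKn (leq_maxl i j)) -expV_subg ?leq_subr//; exact: fwd_iter.
  by rewrite -(subKn (leq_maxr i j)) -expV_subg ?leq_subr//; exact: fwd_iter.
- move=> N; have /existsNP[n /existsNP[u /not_implyP[Nn /not_implyP[fu nu]]]] := nex N.
  exists ((a^-1 ^+ n) u); split; first exact: fu.
  split=> /=.
    by rewrite exp_subVg//; exact: fwd_iter.
  move=> [c Ac [w Ow cw]]; apply: nu; exists c => //.
  by rewrite -cw mulKg.
have [_] := hz 0%N; apply; exists z; last by exists 1; [case: hO|rewrite mulg1].
split; last by case: (hz 0%N).
by move=> n; have [/= /fwd_sub] := hz n.
Qed.

(** Two factorizations [a1 a2 = b1 b2] of [x] differ by [z = a1^-1 b1 = a2 b2^-1], which is bounded
    in both directions. Far back on its orbit [z] is close to [A_0 B_0], and [traps] puts the error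
    itself in the invariant parts; so [z = c' e'^-1], and [a1 c' = b1 e'] is a common plus
    factor. *)
Lemma tidy_forI a A B : tidy_for a A -> tidy_for a B -> tidy_for a (A `&` B).
Proof.
move=> [coA fA tA tVA] [coB fB tB tVB].
have coAB := co_subgroupI coA coB.
have [hA cA oA] := coA; have [hB cB oB] := coB; have [hO cO oO] := coAB.
split=> //; first last.
- by move=> x [Ax Bx] bx; rewrite fwdI; split; [exact: tVA|exact: tVB].
- by move=> x [Ax Bx] bx; rewrite fwdI; split; [exact: tA|exact: tB].
move=> x [Ax Bx].
have [a1 fa1 fa2] := fA x Ax; have [b1 fb1 fb2] := fB x Bx.
set a2 := a1^-1 * x in fa2; set b2 := b1^-1 * x in fb2.
pose z := a1^-1 * b1.
have zE : z = a2 * b2^-1 by rewrite /z /a2 /b2 invgM invgK !mulgA mulgK.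
have hAp := fwd_subgroup a^-1 hA; have hAm := fwd_subgroup a hA.
have hBp := fwd_subgroup a^-1 hB; have hBm := fwd_subgroup a hB.
have fa1' : fwd a^-1 A a1^-1 by case: hAp => _ _; apply.
have fb1' : fwd a^-1 B b1^-1 by case: hBp => _ _; apply.
have [N1 hN1] := fwdV_near a coA hO oO.
have [N2 hN2] := fwdV_near a coB hO oO.
pose n := maxn N1 N2.
have [c [cm cp] Oc] := hN1 n _ (leq_maxl _ _) fa1'.
have [e [em ep] Oe] := hN2 n _ (leq_maxr _ _) fb1'.
pose o := c^-1 * (a^-1 ^+ n) z * e.
have Oo : (A `&` B) o.
  have -> : o = (c^-1 * (a^-1 ^+ n) a1^-1) * (e^-1 * (a^-1 ^+ n) b1^-1)^-1.
    rewrite /o /z invgM invgK cautM !caut_Vg invgK !mulgA.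
    by [].
  by case: hO => _ hM hV; apply: hM => //; exact: hV.
have bz : bdd a z.
  by rewrite zE; apply: bddM; [|apply: bddV]; [exact: fwd_bdd fa2|exact: fwd_bdd fb2].
have bVz : bdd a^-1 z.
  by apply: bddM; [apply: bddV|]; [exact: fwd_bdd fa1|exact: fwd_bdd fb1].
have bX b y k : bdd b y -> bdd b ((b^-1 ^+ k) y).
  move=> [K cK hK]; exists (act (b^-1 ^+ k) K); first exact: act_compact.
  move=> m; rewrite actE.
  have -> : ((b^-1 ^+ k)^-1) ((b ^+ m) ((b^-1 ^+ k) y)) = (b ^+ m) y.
    by rewrite -expVgn invgK -expg_addg addnC expg_addg expgVK.
  exact: hK.
have bY b y k : bdd b y -> bdd b ((b ^+ k) y).
  by move=> [K cK hK]; exists K => // m; rewrite -expg_addg.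
have bo : bdd a o.
  apply: bddM; last exact: fwd_bdd em.
  by apply: bddM; [apply: bddV; exact: fwd_bdd cm|exact: bX].
have bVo : bdd a^-1 o.
  apply: bddM; last exact: fwd_bdd ep.
  by apply: bddM; [apply: bddV; exact: fwd_bdd cp|exact: bY].
have [Ao Bo] := Oo.
have om : fwd a A o by exact: tA.
have op : fwd a^-1 A o by exact: tVA.
(* [a^-n z = (c o) e^-1] with [c o] in [A_0] and [e] in [B_0] *)
pose c' := (a ^+ n) (c * o); pose e' := (a ^+ n) e.
have zce : z = c' * e'^-1.
  rewrite /c' /e' -caut_Vg -cautM /o !mulgA mulgV mul1g mulgK.
  by rewrite expgVK.
have inv b D y : fwd b D y -> fwd b^-1 D y -> forall k, fwd b^-1 D ((b ^+ k) y).
  move=> h h' k j; have [kj|jk] := leqP k j.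
    by rewrite expg_subV//; exact: h'.
  by rewrite expV_subg ?(ltnW jk)//; exact: h.
have c'm : fwd a A c' by apply: fwd_iter; case: hAm => _ + _; apply.
have c'p : fwd a^-1 A c'.
  by apply: inv; [case: hAm|case: hAp] => _ + _; apply.
have e'm : fwd a B e' by exact: fwd_iter.
have e'p : fwd a^-1 B e' by exact: inv.
have yE : a1 * c' = b1 * e' by rewrite -[b1](mulVKg a1) -/z zce -!mulgA mulVg mulg1.
exists (a1 * c'); rewrite fwdI; split.
- by case: hAp => _ + _; apply.
- by rewrite yE; case: hBp => _ + _; apply.
- by rewrite invgM -mulgA; exact: (sg_div hAm c'm fa2).
- by rewrite yE invgM -mulgA; exact: (sg_div hBm e'm fb2).
Qed.

End TidyFor.

Definition meetU (G : topGroupType) (U : set G) (M : set (caut G)) : set G :=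
  [set x | forall b, M b -> U (b^-1 x)].

Definition gen_by (Gam : groupType) (M : set Gam) (g : Gam) : set Gam :=
  [set x | exists n b, M b /\ x = g ^+ n * b].

(** * Commutators of a flat group *)

Definition zexp (Gam : groupType) (x : Gam) (z : int) : Gam :=
  match z with Posz n => x ^+ n | Negz n => x ^- n.+1 end.

Lemma zexpSr (Gam : groupType) (x : Gam) (z : int) :
  zexp x (z + 1)%R = zexp x z * x.
Proof.
case: z => n; first by rewrite -[(Posz n + 1)%R]/(Posz (n + 1)) addn1 /zexp expgSr.
have -> : (Negz n + 1)%R = (- (n%:Z))%R by rewrite NegzE; lia.
by rewrite /= expgS invgM mulgVK; case: n => [|n]; rewrite ?oppr0 ?invg1// -NegzE.
Qed.

Lemma zexpSl (Gam : groupType) (x : Gam) (z : int) :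
  zexp x (z + 1)%R = x * zexp x z.
Proof.
rewrite zexpSr; case: z => n; first by rewrite /= -expgSr expgS.
by rewrite /zexp -!expVgn {1}expgSr mulgVK expgS mulVKg.
Qed.

Section HomogeneousLength.
Context (R : realType) (Gam : groupType) (l : Gam -> R).
Local Open Scope ring_scope.
Hypothesis l_ge0 : forall x, 0 <= l x.
Hypothesis lM : forall x y : Gam, l (x * y)%g <= l x + l y.
Hypothesis lV : forall x : Gam, l x^-1%g = l x.
Hypothesis lX : forall (x : Gam) n, l (x ^+ n)%g = n%:R * l x.

Lemma arch_le (A B C : R) : (forall n : nat, n%:R * A <= n%:R * B + C) -> A <= B.
Proof.
move=> h; rewrite leNgt; apply/negP => BA.
have BA0 : 0 < A - B by rewrite subr_gt0.
have := h (Num.bound (`|C| / (A - B))).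
have : `|C| / (A - B) < (Num.bound (`|C| / (A - B)))%:R.
  by apply: archi_boundP; rewrite divr_ge0// ltW.
rewrite ltr_pdivrMr// => h1 h2.
have := ler_norm C; move: h1 h2; set n := _%:R.
by move=> h1 h2 h3; move: h1; rewrite mulrBr; lra.
Qed.

(** The [n]-th power of a conjugate is a conjugate of the [n]-th power by the same element, so the
    error in its length is bounded independently of [n]; homogeneity removes it. *)
Lemma length_conj x y : l (x ^ y)%g = l x.
Proof.
have le u v : l (u ^ v)%g <= l u.
  apply: (@arch_le _ _ (l v + l v)) => n.
  rewrite -!lX -conjXg conjgE.
  have := lM v^-1%g (u ^+ n * v)%g; have := lM (u ^+ n)%g v; rewrite lV.
  lra.
by apply: le_anti; rewrite le /= -{1}(conjgK y x) le.
Qed.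

(** In [(w y)^n g (z w^-1)^n] the letters [w] and [w^-1] sit at the ends, so after conjugation each
    further pair of factors costs only [l y + l z]. For [g = s t^-1] this word is [x^n x^n] up to
    bounded factors. *)
Lemma length_half x w y z s t : x = ((w * y) ^ s)%g -> x = ((z * w^-1) ^ t)%g ->
  l x <= (l y + l z) / 2%:R.
Proof.
move=> xs xt.
have key n g : l ((w * y) ^+ n * g * (z * w^-1) ^+ n)%g <= n%:R * (l y + l z) + l g.
  elim: n => [|n IH]; first by rewrite !expg0 mul1g mulg1; lra.
  rewrite expgS expgSr.
  set X := ((w * y) ^+ n * g * (z * w^-1) ^+ n)%g in IH.
  have -> : (w * y * (w * y) ^+ n * g * ((z / w) ^+ n * (z / w)) = (y * X * z) ^ w^-1)%g.
    by rewrite conjgE invgK /X !mulgA.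
  rewrite length_conj.
  have := lM (y * X)%g z; have := lM y X; rewrite -natr1; lra.
suff : 2%:R * l x <= l y + l z by lra.
apply: (@arch_le _ _ (l s + l t + l (s * t^-1)%g)) => n.
have : n%:R * (2%:R * l x) = l (x ^+ n * x ^+ n)%g.
  by rewrite -expgnDr lX addnn -muln2 natrM mulrA.
move=> ->; rewrite {1}xs xt -!conjXg !conjgE.
have -> : (s^-1 * ((w * y) ^+ n * s) * (t^-1 * ((z / w) ^+ n * t)) =
   s^-1 * ((w * y) ^+ n * (s * t^-1) * (z / w) ^+ n * t))%g by rewrite !mulgA.
have := lM s^-1%g ((w * y) ^+ n * (s * t^-1) * (z / w) ^+ n * t)%g.
have := lM ((w * y) ^+ n * (s * t^-1) * (z / w) ^+ n)%g t.
have := key n (s * t^-1)%g; rewrite lV; lra.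
Qed.

Lemma length_zexp x (z : int) : l (zexp x z) = `|z|%:~R * l x.
Proof.
case: z => n; first by rewrite /= lX.
by rewrite /= lV lX NegzE normrN.
Qed.

(* Theorem of the D.H.J. PolyMath project (2018): the estimate [step] is
   the expectation of [f] after one step of a random walk on the pairs
   [(m, k)], which after [2n] steps from [(0, n)] has moved by [O(sqrt n)]. *)
Theorem homogeneous_length_comm x y : l (x * y * x^-1 * y^-1)%g = 0.
Proof.
set c := (x * y * x^-1 * y^-1)%g.
pose f (m k : int) := l (zexp x m * zexp c k)%g.
(* In [length_half] take [w = x]: [x^(m+1) c^(k+1)] is [x] times [x^m c^(k+1)], and by the form of
   [c] it is a conjugate of [z x^-1] for [z = y^-1 x^(m+1) c^k x y], itself conjugate to
   [x^(m+2) c^k]. *)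
have step m k : f (m + 1) (k + 1) <= (f m (k + 1) + f (m + 1 + 1) k) / 2%:R.
  rewrite /f; have -> : l (zexp x (m + 1 + 1) * zexp c k)%g =
     l (y^-1 * (zexp x (m + 1) * zexp c k) * x * y)%g.
    set B := (zexp x (m + 1) * zexp c k)%g.
    transitivity (l (B * x)%g); last first.
      by rewrite -(length_conj _ y) conjgE !mulgA.
    rewrite zexpSl -mulgA -/B -(length_conj (x * B)%g x).
    by rewrite conjgE !mulgA mulVg mul1g.
  apply: (@length_half _ x _ _ 1%g y^-1%g).
    by rewrite conjg1 mulgA -zexpSl.
  by rewrite conjgE invgK (zexpSr c) /c !mulgA mulgV mul1g.
pose D := l x + l c.
have D0 : 0 <= D by rewrite addr_ge0.
(* Both points reached from [(m, k)] have [2 k + m] smaller by one, and the mean of [(m - 1)^2] and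
   [(m + 1)^2] is [m^2 + 1], so the bound propagates. The parameter [s] enters through
   [|m| <= m^2 / s + s] at [t = 0]. *)
have key (s : R) : 0 < s -> forall (t : nat) (m k : int), 2 * k + m = t%:Z ->
    f m k <= D * ((m%:~R ^+ 2 + t%:R) / s + s).
  move=> s0; elim=> [|t IH] m k mk.
    have f1 : f m k <= D * `|m|%:~R.
      apply: le_trans (lM _ _) _; rewrite !length_zexp mulrDl mulrC lerD2l mulrC.
      by apply: ler_wpM2l => //; rewrite ler_int; lia.
    apply: le_trans f1 _; apply: ler_wpM2l => //; rewrite addr0.
    have -> : (m%:~R ^+ 2 : R) = `|m|%:~R ^+ 2 by rewrite intr_norm real_normK// num_real.
    set u : R := `|m|%:~R.
    rewrite -(ler_pM2r s0) mulrDl mulfVK ?gt_eqF//.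
    have : 0 <= (u - s) ^+ 2 by exact: sqr_ge0.
    have : 0 <= u by rewrite ler0z normr_ge0.
    by move: s0 => ? ? ?; nra.
  have := step (m - 1) (k - 1); rewrite !subrK.
  have h1 := IH (m - 1) k ltac:(lia).
  have h2 := IH (m + 1) (k - 1) ltac:(lia).
  move=> /le_trans; apply.
  apply: (le_trans (y := (D * (((m - 1)%:~R ^+ 2 + t%:R) / s + s) +
     D * (((m + 1)%:~R ^+ 2 + t%:R) / s + s)) / 2%:R)).
    by rewrite ler_pM2r ?lerD// invr_gt0 ltr0n.
  rewrite rmorphB rmorphD /= -natr1 le_eqVlt; apply/orP; left; apply/eqP.
  have s00 : s != 0 by rewrite gt_eqF.
  by field.
apply: le_anti; rewrite l_ge0 andbT.
apply: (@arch_le _ _ (3%:R * D)) => -[|N]; first by rewrite !mul0r add0r mulr_ge0.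
have N0 : 0 < N.+1%:R :> R by rewrite ltr0n.
(* At [m = 0], [k = n^2], [t = 2 n^2] the choice [s = n] balances the two terms and gives
   [n^2 l(c) <= 3 n D]. *)
have := key N.+1%:R N0 (2 * N.+1 ^ 2)%N 0 (N.+1 ^ 2)%N%:Z ltac:(lia).
rewrite /f /= mul1g lX natrM natrX expr2 /= expr0n /= add0r.
set n : R := N.+1%:R in N0 *.
have -> : 2%:R * n ^+ 2 / n + n = 3%:R * n by field; rewrite gt_eqF.
move=> h; rewrite mulr0 add0r -(ler_pM2l N0) mulrA; apply: le_trans h _.
by rewrite le_eqVlt; apply/orP; left; apply/eqP; ring.
Qed.

End HomogeneousLength.

Lemma sgType_valX (G : groupType) (H : subgroup G) (x : sgType H) n :
  val (x ^+ n) = val x ^+ n.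
Proof.
elim: n => [|n IH]; first by rewrite !expg0.
by rewrite !expgS -IH.
Qed.

Section FlatCommutators.
Context (G : topGroupType) (H : subgroup (caut G)) (U : set G).
Hypotheses (hs : hausdorff_space G) (coU : co_subgroup U).
Hypothesis minU : forall a, sg_set H a -> forall V, co_subgroup V ->
  (coset_index (act a U) U <= coset_index (act a V) V)%N.

Let d (a : caut G) := coset_index (act a U) U.

Let d_gt0 a : (0 < d a)%N.
Proof.
apply: (@coset_index_gt0 _ _ _ 1); first exact: act_cosets_finite.
by rewrite actE caut_1; case: coU => -[].
Qed.

Let dX a n : sg_set H a -> d (a ^+ n) = (d a ^ n)%N.
Proof.
move=> Ha; apply/eqP; rewrite eqn_leq coset_index_pow//=.
by apply: minimal_index_le => // V coV; exact: minU.
Qed.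

Lemma coset_index1_sub a : d a = 1%N -> act a U `<=` U.
Proof.
move=> d1 x ax; have [hU _ _] := coU.
have f := act_cosets_finite a coU coU.
apply: contrapT => nUx.
have U1 : [set (1 : G)] `<=` act a U.
  by move=> _ ->; rewrite actE caut_1; case: hU.
have := coset_index_lt hU f U1; rewrite -/(d a) d1 ltnS leqn0 => /(_ _)/eqP c0.
suff : (0 < coset_index [set 1%g : G] U)%N.
  by rewrite c0//; exists x => // _ ->; rewrite invg1 mul1g.
apply: (@coset_index_gt0 _ _ _ 1) => //.
exact/finite_image/finite_set1.
Qed.

(** Both summands of [l] are nonnegative, so [l = 0] forces [d = 1] at the commutator and at its
    inverse; each of these gives one inclusion. *)
Lemma flat_comm (R : realType) a b : sg_set H a -> sg_set H b ->
  act [~ a, b] U = U.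
Proof.
move=> Ha Hb.
pose l (x : sgType H) : R := (ln (d (val x))%:R + ln (d (val x^-1%g))%:R)%R.
have dpos x : (0 < (d x)%:R :> R)%R by rewrite ltr0n.
have dge1 x : (1 <= (d x)%:R :> R)%R by rewrite ler1n.
have lnd x : (0 <= ln (d x)%:R :> R)%R by apply: ln_ge0.
have lnM_le x y : (ln (d (x * y)%g)%:R <= ln (d x)%:R + ln (d y)%:R :> R)%R.
  rewrite -lnM ?posrE// ler_ln ?posrE ?mulr_gt0//.
  by rewrite -natrM ler_nat coset_index_actM.
have lnX x n : sg_set H x -> (ln (d (x ^+ n)%g)%:R = n%:R * ln (d x)%:R :> R)%R.
  by move=> Hx; rewrite dX// natrX lnXn// mulr_natl.
set z := sg_elt Ha; set w := sg_elt Hb.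
have : l (z^-1 * w^-1 * z^-1^-1 * w^-1^-1)%g = 0%R.
  apply: homogeneous_length_comm.
  - by move=> x; rewrite addr_ge0.
  - move=> x y; rewrite /l invgM.
    have := lnM_le (val x) (val y); have := lnM_le (val y^-1) (val x^-1).
    rewrite -[val (x * y)]/(val x * val y) -[val (y^-1 * x^-1)]/(val y^-1 * val x^-1).
    lra.
  - by move=> x; rewrite /l invgK addrC.
  - move=> x n; rewrite /l -expVgn !sgType_valX.
    by rewrite (lnX _ _ (sg_valP x)) (lnX _ _ (sg_valP x^-1%g)) mulrDr.
rewrite !invgK => /eqP.
rewrite /l paddr_eq0// => /andP[/eqP e1 /eqP e2].
have d1 x : ln (d x)%:R = 0%R :> R -> d x = 1%N.
  move=> /eqP; rewrite ln_eq0// => /eqP; rewrite -[RHS]/(1%:R)%R.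
  by move/eqP; rewrite eqr_nat => /eqP.
have E : [~ a, b] = val (z^-1 * w^-1 * z * w).
  by rewrite commgEl conjgE !mulgA.
have s1 := coset_index1_sub (d1 _ e1); have s2 := coset_index1_sub (d1 _ e2).
rewrite E; apply/seteqP; split=> // x Ux.
by rewrite actE; apply: s2; apply/actP.
Qed.

End FlatCommutators.

(** * Polar subgroups of a flat group *)

Lemma fwd_both (G : topGroupType) (a : caut G) (A : set G) x :
  fwd a A x -> fwd a^-1 A x -> fwd a (fwd a^-1 A) x.
Proof.
move=> h h' k j; have [kj|jk] := leqP k j.
  by rewrite expg_subV//; exact: h'.
by rewrite expV_subg ?(ltnW jk)//; exact: h.
Qed.

Section FlatGroup.
Context (G : topGroupType) (H : set (caut G)) (U : set G).
Hypotheses (hs : hausdorff_space G) (hH : is_subgroup H) (coU : co_subgroup U).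
Hypothesis tidyU : forall a, H a -> tidy_for a U.
Implicit Types (a b c d g : caut G) (M : set (caut G)).

Let H1 : H 1. Proof. by case: hH. Qed.
Let HM a b : H a -> H b -> H (a * b). Proof. by case: hH => _ + _; apply. Qed.
Let HV a : H a -> H a^-1. Proof. by case: hH => _ _; apply. Qed.

Lemma tidy_act a b : H a -> H b -> tidy_for a (act b U).
Proof.
move=> Ha Hb; have -> : a = b * (b^-1 * a * b) * b^-1.
  by rewrite !mulgA mulgV mul1g mulgK.
by apply: tidy_for_conj; apply: tidyU; apply: HM => //; apply: HM => //; exact: HV.
Qed.

Let meets (s : seq (caut G)) := foldr (fun b A => act b U `&` A) U s.

Let meets_tidy a s : H a -> (forall b, b \in s -> H b) -> tidy_for a (meets s).
Proof.
move=> Ha; elim: s => [_|b s IH hb] /=; first exact: tidyU.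
apply: tidy_forI; first by apply: tidy_act => //; apply: hb; rewrite mem_head.
by apply: IH => c cs; apply: hb; rewrite in_cons cs orbT.
Qed.

Let meetsP s x : meets s x <-> U x /\ forall b, b \in s -> U (b^-1 x).
Proof.
elim: s => [|b s IH] /=; first by split=> [Ux|[]].
split=> [[Ub /IH[Ux h]]|[Ux h]].
  by split=> // c; rewrite in_cons => /predU1P[->|]; last exact: h.
split; first by apply: h; rewrite mem_head.
by apply/IH; split=> // c cs; apply: h; rewrite in_cons cs orbT.
Qed.

Lemma meetU_sub M : M 1 -> meetU U M `<=` U.
Proof. by move=> M1 x /(_ 1 M1); rewrite invg1. Qed.

Lemma meetU_subgroup M : is_subgroup (meetU U M).
Proof.
have [[u1 uM uV] _ _] := coU; split; first by move=> b _; rewrite caut_1.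
  by move=> x y hx hy b Mb; rewrite cautM; apply: uM; [exact: hx|exact: hy].
by move=> x hx b Mb; rewrite caut_Vg; apply: uV; exact: hx.
Qed.

Lemma meetU_closed M : closed (meetU U M).
Proof.
have [hU _ oU] := coU.
suff : closed (\bigcap_(b in M) [set x | U (b^-1 x)]) by [].
apply: closed_bigI => b _; apply: closed_pre; first exact: caut_continuous.
exact: open_subgroup_closed.
Qed.

Lemma meetU_compact M : M 1 -> compact (meetU U M).
Proof.
move=> M1; have [_ cU _] := coU.
exact: subclosed_compact (@meetU_closed M) cU (meetU_sub M1).
Qed.

Lemma meetU_mono M M' : M `<=` M' -> meetU U M' `<=` meetU U M.
Proof. by move=> MM' x h b /MM'; exact: h. Qed.

(** [tidy_forI] factors [x] in every finite intersection. For each finite subfamily the admissible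
    plus factors form a closed set, and concatenation of lists makes these sets directed. *)
Lemma meetU_factors M a : H a -> M `<=` H -> M 1 -> factors a (meetU U M).
Proof.
move=> Ha MH M1 x Mx; have [hU cU oU] := coU.
pose I := {s : seq (caut G) | forall b, b \in s -> M b}.
have i0 : I by exists [::].
have ti (i : I) : tidy_for a (meets (sval i)).
  by apply: meets_tidy => // b /(svalP i)/MH.
have cl (i : I) : closed (meets (sval i)).
  by have [[? ? ?] _ _ _] := ti i; exact: open_subgroup_closed.
have [|||y [Uy hy]] := @compact_directed G I i0 U
   (fun i => fwd a^-1 (meets (sval i)) `&` [set y | fwd a (meets (sval i)) (y^-1 * x)]) cU.
- move=> i; apply: closedI; first exact: fwd_closed.
  apply: (@closed_pre _ _ (fun y => y^-1 * x)); last exact: fwd_closed.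
  by apply: continuous_mulg; [exact: invg_continuous|exact: continuous_cstg].
- move=> [s hs1] [t ht]; have st b : b \in s ++ t -> M b.
    by rewrite mem_cat => /orP[/hs1|/ht].
  exists (exist _ _ st) => y /= [h1 h2].
  have sub1 : meets (s ++ t) `<=` meets s.
    by move=> z /meetsP[Uz h]; apply/meetsP; split=> // b bs; apply: h; rewrite mem_cat bs.
  have sub2 : meets (s ++ t) `<=` meets t.
    by move=> z /meetsP[Uz h]; apply/meetsP; split=> // b bs; apply: h; rewrite mem_cat bs orbT.
  by do 2!split=> /=; [exact: fwd_mono h1|exact: fwd_mono h2|exact: fwd_mono h1|exact: fwd_mono h2].
- move=> i; have [_ fi _ _] := ti i.
  have [|y f1 f2] := fi x.
    apply/meetsP; split; first exact: (meetU_sub M1).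
    by move=> b /(svalP i) Mb; exact: Mx.
  by exists y; split=> //; have /meetsP[] := fwd_sub f1.
have one b : M b -> {i : I | sval i = [:: b]}.
  move=> Mb; have h c : c \in [:: b] -> M c by rewrite inE => /eqP ->.
  by exists (exist _ _ h).
exists y.
  move=> n b Mb; have [i ib] := one b Mb; have [h _] := hy i.
  have /meetsP[_] := h n; rewrite ib => /(_ b); apply; exact: mem_head.
move=> n b Mb; have [i ib] := one b Mb; have [_ h] := hy i.
have /meetsP[_] := h n; rewrite ib => /(_ b); apply; exact: mem_head.
Qed.

(** * Monoids containing the stabilizer of [U] *)

Hypothesis commU : forall a b, H a -> H b -> act [~ a, b] U = U.

(** By [commU], the condition [good_stab] puts all commutators in [M], so [M] is invariant under
    conjugation by [H]. *)
Record good M : Prop := Good {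
  good_sub : M `<=` H;
  good_stab : forall a, H a -> act a U = U -> M a;
  good_mul : forall a b, M a -> M b -> M (a * b) }.

Lemma good1 M : good M -> M 1.
Proof. by case=> _ st _; apply: st => //; rewrite act1. Qed.

Lemma goodX M a n : good M -> M a -> M (a ^+ n).
Proof.
move=> gM Ma; elim: n => [|n IH]; first exact: good1.
by rewrite expgS; exact: good_mul.
Qed.

Lemma HX a n : H a -> H (a ^+ n).
Proof. by move=> Ha; elim: n => [|n IH]; rewrite ?expg0// expgS; exact: HM. Qed.

Lemma good_conj M a b : good M -> H a -> M b -> M (b ^ a).
Proof.
move=> gM Ha Mb; have Hb := good_sub gM Mb.
have -> : b ^ a = b * [~ b, a] by rewrite commgEl mulVKg.
apply: good_mul => //; apply: good_stab => //; last exact: commU.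
by rewrite commgEl conjgE; apply: HM; [exact: HV|apply: HM; [exact: HV|exact: HM]].
Qed.

(** For [b] in [M], powers of [b^-1] map [c(U_M)] into itself, as [M] is invariant under conjugation
    by [c]. So the orbit of [x] under [b^-1] is bounded and, starting in [U], stays there by
    [traps]. *)
Lemma good_cap M c x : good M -> H c -> act c (meetU U M) x -> U x -> meetU U M x.
Proof.
move=> gM Hc cx Ux b Mb.
have M1 := good1 gM.
have [_ _ t _] := tidyU (HV (good_sub gM Mb)).
apply: (t x Ux _ 1%N); exists (act c (meetU U M)); first exact/act_compact/meetU_compact.
move=> n d Md; rewrite expVgn.
have : M ((b ^+ n) ^ c * d) by apply: good_mul => //; apply: good_conj => //; exact: goodX.
move=> /cx; rewrite -!cautMg -!invgM conjgE mulgA mulgA mulgV mul1g.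
by rewrite mulgA.
Qed.

Lemma good_capV M c : good M -> H c -> act c (meetU U M) `<=` U ->
  act c (meetU U M) `<=` meetU U M.
Proof. by move=> gM Hc h x cx; exact: (good_cap gM Hc cx (h _ cx)). Qed.

Lemma good_act_sup M b : good M -> M b -> meetU U M `<=` act b (meetU U M).
Proof.
move=> gM Mb x hx d Md; rewrite -cautMg -invgM; apply: hx; exact: good_mul.
Qed.

Lemma good_act_subV M b : good M -> M b -> act b^-1 (meetU U M) `<=` meetU U M.
Proof.
move=> gM Mb x hx; have := good_act_sup gM Mb; move=> /(_ (b x)).
by rewrite actE cautVKg; apply; apply/actV.
Qed.

(** Conjugation invariance of [M] lets the powers of [g] be collected on the left, so the products
    [g^n b] already form a monoid. *)
Lemma good_gen M g : good M -> H g -> good (gen_by M g).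
Proof.
move=> gM Hg; split.
- by move=> _ [n [b [Mb ->]]]; apply: HM; [exact: HX|exact: good_sub Mb].
- by move=> a Ha ha; exists 0%N, a; rewrite expg0 mul1g; split=> //; exact: good_stab.
- move=> _ _ [n [b [Mb ->]]] [m [c [Mc ->]]].
  exists (n + m)%N, (b ^ (g ^+ m) * c); split.
    by apply: good_mul => //; apply: good_conj => //; exact: HX.
  by rewrite expgnDr conjgE !mulgA mulgK.
Qed.

Lemma sub_gen M g : M `<=` gen_by M g.
Proof. by move=> b Mb; exists 0%N, b; rewrite expg0 mul1g. Qed.

Lemma mem_gen M g : M 1 -> gen_by M g g.
Proof. by move=> M1; exists 1%N, 1; rewrite expg1 mulg1. Qed.

Lemma meetU_gen M g : meetU U (gen_by M g) = fwd g^-1 (meetU U M).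
Proof.
apply/seteqP; split=> x h.
  move=> n b Mb; rewrite expVgn -cautMg -invgM; apply: h.
  by exists n, b.
by move=> _ [n [b [Mb ->]]]; rewrite invgM cautMg -expVgn; exact: h.
Qed.

Definition stabU : set (caut G) := [set a | H a /\ act a U = U].

Lemma good_stabU : good stabU.
Proof.
split=> [a []//|a Ha ha//|a b [Ha ha] [Hb hb]].
by split; [exact: HM|rewrite act_mul hb ha].
Qed.

Lemma meetU_stab : meetU U stabU = U.
Proof.
apply/seteqP; split; first by apply: meetU_sub; exact: good1 good_stabU.
by move=> x Ux b [Hb hb]; move: Ux; rewrite -{1}hb.
Qed.

Lemma maximal_good a : H a -> ~ (act a U `<=` U) ->
  exists M, [/\ good M, M a, ~ (act a (meetU U M) `<=` U) &
    forall g, H g -> M g \/ M g^-1].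
Proof.
move=> Ha nU; have [hU cU oU] := coU.
pose ok M := [/\ good M, M a & ~ (act a (meetU U M) `<=` U)].
(* Here [U_M] is the plus part [U_+] for [a]. As [a(U_-)] lies in [U], an inclusion of [a(U_+)] in
   [U] would give that of [a(U)]. *)
have ok0 : ok (gen_by stabU a).
  have gS := good_stabU; have S1 := good1 gS; split.
  - exact: good_gen.
  - exact: mem_gen.
  - rewrite meetU_gen meetU_stab => sU; apply: nU => x ax.
    have [_ fU _ _] := tidyU Ha.
    have [y fy fz] := fU _ ax.
    have -> : x = a y * a (y^-1 * a^-1 x) by rewrite -cautM mulVKg cautKV.
    have [_ uM _] := hU; apply: uM; last exact: (fz 1%N).
    by apply: sU; apply/actP.
pose T := {M : set (caut G) | ok M}.
pose t0 : T := exist _ _ ok0.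
have [|||M] := @ZL_preorder T t0 (fun s t => `[< sval s `<=` sval t >]).
- by move=> t; apply/asboolP.
- by move=> r s t /asboolP rs /asboolP st; apply/asboolP; exact: subset_trans st.
- move=> A totA; have [[s0 As0]|nA] := pselect (exists s, A s); last first.
    by exists t0 => s As; exfalso; apply: nA; exists s.
  pose B := \bigcup_(s in A) sval s.
  have [gs0 s0a _] := svalP s0.
  have gB : good B.
    split.
    - by move=> b [s As sb]; have [gs _ _] := svalP s; exact: good_sub gs _ sb.
    - by move=> b Hb hb; exists s0 => //; exact: good_stab gs0 _ Hb hb.
    - move=> b c [s As sb] [t At tc].
      have [gs _ _] := svalP s; have [gt _ _] := svalP t.
      by have [/asboolP st|/asboolP ts] := totA s t As At;
        [exists t => //; apply: good_mul => //; exact: st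
        |exists s => //; apply: good_mul => //; exact: ts].
  have okB : ok B.
    split=> //; first by exists s0.
    move=> sU.
    pose I := {s : T | A s}.
    (* The group of the union is the intersection of the groups of the members, and the points of
       their images under [a] outside the open group [U] form nonempty compact sets along the
       chain. *)
    have [||||x [_ hx]] := @compact_directed G I (exist _ _ As0) (act a U)
       (fun i => act a (meetU U (sval (sval i))) `&` ~` U).
    - exact: act_compact.
    - move=> i; apply: closedI; last exact: open_closedC.
      apply: act_closed; exact: meetU_closed.
    - move=> [s As] [t At].
      have [/asboolP st|/asboolP ts] := totA s t As At.
        exists (exist _ _ At) => y [/= hy nUy]; do 2!split=> //.
        by move: hy; rewrite !actE; exact: meetU_mono.
      exists (exist _ _ As) => y [/= hy nUy]; do 2!split=> //.
      by move: hy; rewrite !actE; exact: meetU_mono.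
    - move=> [s As] /=; have [gs sa] := svalP s.
      move=> /existsNP[y /not_implyP[hy nUy]]; exists y; split; last by split.
      by rewrite actE; apply: meetU_sub hy; exact: good1 gs.
    - have [_] := hx (exist _ _ As0); apply; apply: sU => b [s As sb].
      by have [h _] := hx (exist _ _ As); exact: h.
  exists (exist _ _ okB) => s As; apply/asboolP => b sb; by exists s.
- move=> maxM; have [gM Ma nM] := svalP M.
  exists (sval M); split=> // g Hg; apply: contrapT => /not_orP[ng ngV].
  have M1 := good1 gM.
  have key h : H h -> ~ sval M h -> act a (meetU U (gen_by (sval M) h)) `<=` U.
    move=> Hh nh; apply: contrapT => nsub; apply: nh.
    have okh : ok (gen_by (sval M) h).
      by split=> //; [exact: good_gen|exact: sub_gen].
    have sub : `[< sval M `<=` gen_by (sval M) h >].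
      by apply/asboolP; exact: sub_gen.
    have /asboolP := maxM (exist _ _ okh) sub.
    by apply; exact: mem_gen.
  (* By [meetU_gen], the plus and minus parts of [U_M] for [g] are the groups of the two enlarged
     monoids; if [a] sends both into [U], it sends their product [U_M] into [U]. *)
  have k1 := key g Hg ng; have k2 := key _ (HV Hg) ngV.
  rewrite meetU_gen in k1; rewrite meetU_gen invgK in k2.
  apply: nM => x ax.
  have [y fy fz] := meetU_factors Hg (good_sub gM) M1 ax.
  have -> : x = a y * a (y^-1 * a^-1 x) by rewrite -cautM mulVKg cautKV.
  have [_ uM _] := hU; apply: uM; first by apply: k1; apply/actP.
  by apply: k2; apply/actP.
Qed.

(** By [d e = e d^e], an element of [M] acts on [c(U_M)] as a conjugate of it, again in [M], acts on
    [U_M]; so [b] and [b^-1] both enlarge [c(U_M)]. *)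
Lemma act_invariant M c b : good M -> H c -> M b -> M b^-1 ->
  act b (act c (meetU U M)) = act c (meetU U M).
Proof.
move=> gM Hc Mb MbV.
have E d e : M d -> M d^-1 -> H e -> act e (meetU U M) `<=` act d (act e (meetU U M)).
  move=> Md MdV He x; rewrite -act_mul.
  have -> : d * e = e * d ^ e by rewrite conjgE !mulgA mulgV mul1g.
  rewrite act_mul !actE; apply: good_act_sup => //; exact: good_conj.
apply/seteqP; split; last exact: E.
move=> x hx; have := E b^-1 c MbV; rewrite invgK => /(_ Mb Hc (b^-1 x) hx).
by rewrite actE invgK cautKV.
Qed.

(** * Homomorphisms to the integers and finiteness *)

Section Rho.
Variable rho : caut G -> int.
Hypothesis rhoM : forall a b, H a -> H b -> rho (a * b) = (rho a + rho b)%R.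
Hypothesis rho_stab : forall a, H a -> act a U = U -> rho a = 0%R.

Definition nneg : set (caut G) := [set a | H a /\ (0 <= rho a)%R].

Lemma good_nneg : good nneg.
Proof.
split=> [a []//|a Ha ha|a b [Ha ha] [Hb hb]].
  by split=> //; rewrite rho_stab.
by split; [exact: HM|rewrite rhoM// addr_ge0].
Qed.

Lemma rho1 : rho 1 = 0%R.
Proof. by apply: rho_stab => //; rewrite act1. Qed.

Lemma rhoV a : H a -> rho a^-1 = (- rho a)%R.
Proof.
by move=> Ha; apply/eqP; rewrite -addr_eq0 -rhoM ?mulVg ?rho1//; exact: HV.
Qed.

Lemma rhoX a n : H a -> rho (a ^+ n) = (n%:Z * rho a)%R.
Proof.
move=> Ha; elim: n => [|n IH]; first by rewrite expg0 rho1 mul0r.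
by rewrite expgS rhoM ?IH//; [lia|exact: HX].
Qed.

(** Suppose no coset is lost, so that [a(A)] lies in [a(A_+) U] for [A = U_S] and its plus part
    under [b]. Iterating [a] and comparing along [b^(n k) a^(m k)], on which [rho] vanishes, forces
    [V] into the part [A0] of [A] where whole [b]-orbits stay. Then [b] preserves [V], hence so does
    [a^m], and [a(V)] lies in [U] after all. *)
Lemma index_drop S a b : good S -> S a -> S `<=` nneg -> H b ->
  (0 < rho a)%R -> (rho b < 0)%R -> ~ (act a (meetU U nneg) `<=` U) ->
  exists2 x, act a (meetU U S) x &
    forall y, act a (meetU U (gen_by S b)) y -> ~ U (y^-1 * x).
Proof.
move=> gS Sa SN Hb ra rb nV; apply: contrapT => nex.
have hEq x : act a (meetU U S) x -> exists2 y, act a (meetU U (gen_by S b)) y & U (y^-1 * x).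
  move=> ax; apply: contrapT => ny; apply: nex; exists x => // y ay Uy.
  by apply: ny; exists y.
have Ha := good_sub gS Sa.
have gN := good_nneg; have N1 := good1 gN; have S1 := good1 gS.
have VU := meetU_sub N1.
set V := meetU U nneg in nV VU; set A := meetU U S in hEq.
have VA : V `<=` A := meetU_mono SN.
pose Ap := fwd b^-1 A; pose Am := fwd b A.
rewrite meetU_gen -/A -/Ap in hEq.
have hA : is_subgroup A := meetU_subgroup S.
have hAp : is_subgroup Ap := fwd_subgroup b^-1 hA.
have hAm : is_subgroup Am := fwd_subgroup b hA.
have gSp : good (gen_by S b) := good_gen gS Hb.
have gSm : good (gen_by S b^-1) := good_gen gS (HV Hb).
have ApE : Ap = meetU U (gen_by S b) by rewrite meetU_gen.
have AmE : Am = meetU U (gen_by S b^-1) by rewrite meetU_gen invgK.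
pose S0 := gen_by (gen_by S b) b^-1.
have gS0 : good S0 := good_gen gSp (HV Hb).
pose A0 := fwd b Ap.
have A0E : A0 = meetU U S0 by rewrite !meetU_gen invgK.
have NbV : nneg b^-1 by split; [exact: HV|rewrite rhoV// oppr_ge0 ltW].
have VAm : V `<=` Am.
  rewrite AmE; apply: meetU_mono => _ [n [s [Ss ->]]]; apply: (good_mul gN).
    exact: goodX gN NbV.
  exact: SN.
have AmU : Am `<=` U by rewrite AmE; apply: meetU_sub; exact: good1 gSm.
have supX M n : good M -> M a -> meetU U M `<=` act (a ^+ n) (meetU U M).
  by move=> gM Ma; apply: good_act_sup => //; exact: goodX.
have Apa n : Ap `<=` act (a ^+ n) Ap.
  by rewrite ApE; apply: supX => //; exact: sub_gen.
have Ama n : Am `<=` act (a ^+ n) Am.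
  by rewrite AmE; apply: supX => //; exact: sub_gen.
(* [a^m A = a^m(A_+) A] *)
have s1 m x : act (a ^+ m) A x -> exists2 y, act (a ^+ m) Ap y & A (y^-1 * x).
  elim: m x => [|m IH] x.
    rewrite expg0 !act1 => Ax; exists 1; first by case: hAp.
    by rewrite invg1 mul1g.
  rewrite expgSr !act_mul actE => hx.
  have [y0 ay0 Uy0] := hEq _ hx.
  have Ay0 : A (y0^-1 * (a ^+ m)^-1 x).
    apply: (good_cap gS Ha) => //.
    apply: (sg_div (act_subgroup a hA) _ hx).
    by move: ay0; rewrite !actE; exact: fwd_sub.
  have aAy0 : act (a ^+ m) A ((a ^+ m) (y0^-1 * (a ^+ m)^-1 x)) by apply/actP.
  have [y1 ay1 Ay1] := IH _ aAy0.
  exists ((a ^+ m) y0 * y1).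
    have [_ hM _] := act_subgroup (a ^+ m) (act_subgroup a hAp); apply: hM.
      exact/actP.
    by move: ay1; rewrite !actE -cautMg -[in X in _ -> X](expg1 a); exact: Apa.
  by move: Ay1; rewrite cautM caut_Vg cautKV invgM mulgA.
(* Write [x = y p q] with [p] in [A_+] and [q] in [A_-] for [b]. The factor [y p] is in [a^m(A_+)],
   and it equals [x q^-1], which is in [a^m(A_-)] because [V] lies in [A_-]; so it is in
   [a^m(A0)]. *)
have s2 m x : act (a ^+ m) V x -> exists2 c, act (a ^+ m) A0 c & Am (c^-1 * x).
  move=> Vx; have Ax : act (a ^+ m) A x by move: Vx; rewrite !actE; exact: VA.
  have [y ay Ay] := s1 m x Ax.
  have [p fp fq] := meetU_factors Hb (good_sub gS) S1 Ay.
  exists (y * p); last by rewrite invgM -mulgA.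
  apply: fwd_both; last first.
    have [_ hM _] := act_subgroup (a ^+ m) hAp; apply: hM => //; exact: Apa.
  rewrite -/(Am _) -[X in Am X]/((a ^+ m)^-1 (y * p)) -(actE (a ^+ m) Am).
  have -> : y * p = x * (p^-1 * (y^-1 * x))^-1.
    by rewrite !invgM !invgK !mulgA mulgV mul1g.
  have [_ hM hV] := act_subgroup (a ^+ m) hAm; apply: hM.
    by move: Vx; rewrite !actE; exact: VAm.
  by apply: hV; exact: Ama.
pose m := `|rho b|%N; pose n := `|rho a|%N.
have n0 : (0 < n)%N by rewrite /n; lia.
have m0 : (0 < m)%N by rewrite /m; lia.
(* The exponents make [rho] vanish, so the product and its inverse both lie in [nneg] and preserve
   [V]. *)
have gamV N : act (b ^+ (n * N) * a ^+ (m * N)) V = V.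
  have Hg : H (b ^+ (n * N) * a ^+ (m * N)) by apply: HM; exact: HX.
  have r0 : rho (b ^+ (n * N) * a ^+ (m * N)) = 0%R.
    by rewrite rhoM ?rhoX//; [rewrite /m /n; nia|exact: HX|exact: HX].
  have Ng : nneg (b ^+ (n * N) * a ^+ (m * N)) by split=> //; rewrite r0.
  have NgV : nneg (b ^+ (n * N) * a ^+ (m * N))^-1.
    by split; [exact: HV|rewrite rhoV// r0].
  by have := act_invariant gN H1 Ng NgV; rewrite act1.
have S0b : S0 b by apply: sub_gen; exact: mem_gen.
have S0bV : S0 b^-1 by apply: mem_gen; exact: good1 gSp.
have VA0 : V `<=` A0.
  move=> v Vv.
  (* Move [v] into [a^(m k)(V)] by [b^(-n k)], split it there by [s2], and return. The minus factor
     has been advanced by [b^(n k)], so it stays in [A_-] even after [b^-k]; the other factor lands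
     in [U] and so in [A0] by [good_cap]. *)
  have key k : exists2 c, A0 c & Am ((b^-1 ^+ k) (c^-1 * v)).
    pose bk := b ^+ (n * k); pose am := a ^+ (m * k).
    have Vw : act am V (bk^-1 v).
      have : act (bk * am) V v by rewrite gamV.
      by rewrite act_mul.
    have [c ac ec] := s2 _ _ Vw.
    have Aec : Am (bk (c^-1 * bk^-1 v)) by exact: fwd_iter.
    have acb : act am A0 (bk c).
      have Sk : S0 bk by exact: goodX.
      have SkV : S0 bk^-1 by rewrite /bk -expVgn; exact: goodX.
      rewrite A0E -(act_invariant gS0 (HX (m * k) Ha) Sk SkV).
      by apply/actP; rewrite -A0E.
    have bcE : bk c = v * (bk (c^-1 * bk^-1 v))^-1.
      by rewrite cautM caut_Vg cautKV invgM invgK mulgA mulgV mul1g.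
    have Ubc : U (bk c).
      rewrite bcE; have [[_ uM uV] _ _] := coU; apply: uM; first exact: VU.
      by apply: uV; exact: AmU.
    have A0bc : A0 (bk c).
      rewrite A0E; apply: (good_cap gS0 (HX (m * k) Ha)) => //.
      by rewrite -A0E.
    exists (bk c) => //.
    have -> : (bk c)^-1 * v = bk (c^-1 * bk^-1 v) by rewrite cautM caut_Vg cautKV.
    rewrite /bk expV_subg; first exact: fwd_iter.
    by rewrite leq_pmull.
  have [|||| c [Ac hc]] := @compact_directed G nat 0%N A0
     (fun k => [set c | Am ((b^-1 ^+ k) (c^-1 * v))]).
  - by rewrite A0E; apply: meetU_compact => //; exact: good1 gS0.
  - move=> k; apply: (@closed_pre _ _ (fun c : G => (b^-1 ^+ k) (c^-1 * v))).
      apply: caut_comp_continuous; first exact: caut_continuous.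
      by apply: continuous_mulg; [exact: invg_continuous|exact: continuous_cstg].
    by rewrite AmE; exact: meetU_closed.
  - move=> i j; exists (maxn i j) => c /= h; split.
      by rewrite -(subKn (leq_maxl i j)) -exp_subVg ?leq_subr//; exact: fwd_iter.
    by rewrite -(subKn (leq_maxr i j)) -exp_subVg ?leq_subr//; exact: fwd_iter.
  - by move=> k; have [c ? ?] := key k; exists c.
  have : A0 (c^-1 * v).
    apply: fwd_both; first exact: (hc 0%N).
    by move=> k; exact: (hc k 0%N).
  rewrite -{2}(mulVKg c v); have [_ hM _] := fwd_subgroup b hAp; exact: hM.
(* [A0] is stable under [b^-1] and lies in [U], so [b^-1(V)] lies in [U] and [good_capV] applies. *)
have bVsub : act b^-1 V `<=` V.
  apply: (good_capV gN (HV Hb)) => x /actV/VA0 h.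
  have : A0 (b^-1 (b x)).
    by rewrite A0E in h *; apply: (good_act_sup gS0 S0b) h.
  by rewrite cautVKg => /fwd_sub/fwd_sub; apply: meetU_sub.
have bV : act b^-1 V = V.
  by apply/seteqP; split=> //; exact: good_act_sup.
have bnV k : act (b^-1 ^+ k) V = V.
  by elim: k => [|k IH]; rewrite ?expg0 ?act1// expgS act_mul IH.
have amV : act (a ^+ m) V = V.
  have := gamV 1%N; rewrite !muln1 => E.
  by rewrite -[in RHS](bnV n) -[in RHS]E -act_mul mulgA expVgn mulVg mul1g.
apply: nV => x; rewrite -/V => ax; apply: VU.
have Na : nneg a by split=> //; exact: ltW.
rewrite -amV; case: (m) m0 => // k _; rewrite expgS act_mul actE.
exact: (good_act_sup gN (goodX k gN Na)).
Qed.

End Rho.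

Lemma H_zexp a z : H a -> H (zexp a z).
Proof. by case: z => n Ha; [exact: HX|apply: HV; exact: HX]. Qed.

Lemma rho_zexp (rho : caut G -> int) a z :
  (forall a b, H a -> H b -> rho (a * b) = (rho a + rho b)%R) ->
  (forall a, H a -> act a U = U -> rho a = 0%R) ->
  H a -> rho (zexp a z) = (z * rho a)%R.
Proof.
move=> rM rS Ha; case: z => n; first exact: rhoX.
by rewrite /zexp rhoV// ?rhoX//; [rewrite NegzE mulNr|exact: HX].
Qed.

(* Surjectivity onto the integers makes distinct homomorphisms that are positive at [a]
   non-proportional. *)
Lemma rho_separate (r1 r2 : caut G -> int) a :
  (forall a b, H a -> H b -> r1 (a * b) = (r1 a + r1 b)%R) ->
  (forall a, H a -> act a U = U -> r1 a = 0%R) -> (exists2 g, H g & r1 g = 1%R) ->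
  (forall a b, H a -> H b -> r2 (a * b) = (r2 a + r2 b)%R) ->
  (forall a, H a -> act a U = U -> r2 a = 0%R) -> (exists2 g, H g & r2 g = 1%R) ->
  H a -> (0 < r1 a)%R -> (0 < r2 a)%R -> ~ (forall g, H g -> r1 g = r2 g) ->
  exists b, [/\ H b, (0 < r1 b)%R & (r2 b < 0)%R].
Proof.
move=> r1M r1S [g1 Hg1 r1g] r2M r2S [g2 Hg2 r2g] Ha p1 p2 ne.
have [g [Hg]] : exists g, H g /\ (r1 g * r2 a)%R <> (r2 g * r1 a)%R.
  apply: contrapT => /forallNP h.
  have {}h g : H g -> (r1 g * r2 a = r2 g * r1 a)%R.
    by move=> Hg; apply: contrapT => n; apply: (h g).
  apply: ne => g Hg; have := h g Hg; have := h g1 Hg1; have := h g2 Hg2.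
  rewrite r1g r2g => e2 e1.
  have e : r1 a = r2 a.
    move: e1 e2; rewrite !mul1r => e1 e2.
    have q1 : (0 < r2 g1)%R by rewrite -(pmulr_lgt0 _ p1) -e1.
    have q2 : (0 < r1 g2)%R by rewrite -(pmulr_lgt0 _ p2) e2.
    have l1 : (r1 a <= r2 a)%R by rewrite e1 ler_peMl// ltW.
    have l2 : (r2 a <= r1 a)%R by rewrite -e2 ler_peMl// ltW.
    by apply/eqP; rewrite eq_le l1 l2.
  by rewrite e; apply: mulIf; rewrite gt_eqF.
wlog lt : g Hg / (r2 g * r1 a < r1 g * r2 a)%R => [hw|_].
  move=> n; have [lt|lt|//] := ltgtP (r2 g * r1 a)%R (r1 g * r2 a)%R.
  - exact: hw Hg lt n.
  - apply: (hw g^-1 (HV Hg)); rewrite !rhoV// !mulNr; first by rewrite ltrN2.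
    by move/oppr_inj.
  - by move=> e; case: n.
(* With denominators cleared, the element below is [g] minus [m / k] times [a], where [m / k] is the
   mean of [r1 g / r1 a] and [r2 g / r2 a]; so [r1] and [r2] take opposite signs on it. *)
pose k := (2 * r1 a * r2 a)%R; pose m := (r1 a * r2 g + r2 a * r1 g)%R.
exists (zexp g k * zexp a (- m)%R).
have ? : H (zexp g k) by exact: H_zexp.
have ? : H (zexp a (- m)%R) by exact: H_zexp.
split; first exact: HM.
  rewrite r1M// !rho_zexp// /k /m.
  have -> : (2 * r1 a * r2 a * r1 g + - (r1 a * r2 g + r2 a * r1 g) * r1 a =
    r1 a * (r1 g * r2 a - r2 g * r1 a))%R by ring.
  by rewrite pmulr_rgt0// subr_gt0.
rewrite r2M// !rho_zexp// /k /m.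
have -> : (2 * r1 a * r2 a * r2 g + - (r1 a * r2 g + r2 a * r1 g) * r2 a =
    r2 a * (r2 g * r1 a - r1 g * r2 a))%R by ring.
by rewrite pmulr_rlt0// subr_lt0.
Qed.

Lemma finite_rho (I : Type) (P : set I) (rho : I -> caut G -> int) a : H a ->
  (forall i, P i -> [/\ forall a b, H a -> H b -> rho i (a * b) = (rho i a + rho i b)%R,
     forall a, H a -> act a U = U -> rho i a = 0%R,
     exists2 g, H g & rho i g = 1%R &
     (0 < rho i a)%R -> ~ (act a (meetU U (nneg (rho i))) `<=` U)]) ->
  (forall i j, P i -> P j -> (forall g, H g -> rho i g = rho j g) -> i = j) ->
  finite_set [set i | P i /\ (0 < rho i a)%R].
Proof.
move=> Ha hP injP; have [hU cU oU] := coU.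
have key n S : good S -> S a -> (coset_index (act a (meetU U S)) U < n)%N ->
    finite_set [set i | P i /\ (0 < rho i a)%R /\ S `<=` nneg (rho i)].
  elim: n S => // n IH S gS Sa lt.
  set Phi := [set i | _].
  have [uni|] := pselect (forall i j, Phi i -> Phi j -> i = j).
    have [[i Pi]|nP] := pselect (exists i, Phi i).
      apply: (@sub_finite_set _ _ [set i]); last exact: finite_set1.
      by move=> j Pj; rewrite (uni i j).
    apply: (@sub_finite_set _ _ set0); last exact: finite_set0.
    by move=> j Pj; apply: nP; exists j.
  move=> /existsNP[i /existsNP[j /not_implyP[[Pi [ia Si]] /not_implyP[[Pj [ja Sj]] ij]]]].
  have [iM iS isur nVi] := hP i Pi; have [jM jS jsur nVj] := hP j Pj.
  have [b [Hb ib jb]] : exists b, [/\ H b, (0 < rho i b)%R & (rho j b < 0)%R].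
    by apply: (rho_separate iM iS isur jM jS jsur Ha) => // h; apply: ij; exact: injP.
  have fS c : H c -> (exists k, [/\ P k, (0 < rho k a)%R, S `<=` nneg (rho k) & (rho k c < 0)%R]) ->
      finite_set [set i | P i /\ (0 < rho i a)%R /\ gen_by S c `<=` nneg (rho i)].
    move=> Hc [k [Pk ka Sk kc]]; have [kM kS _ nVk] := hP k Pk.
    apply: IH; [exact: good_gen|exact: sub_gen|].
    rewrite -ltnS; apply: leq_trans lt; rewrite ltnS; apply: coset_index_lt => //.
    - apply: left_cosets_finite => //; apply: act_compact; apply: meetU_compact.
      exact: good1 gS.
    - by move=> x; rewrite !actE; apply: meetU_mono; exact: sub_gen.
    - exact: (index_drop kM kS gS Sa Sk Hc ka kc (nVk ka)).
  have f1 := fS b Hb (ex_intro _ j (And4 Pj ja Sj jb)).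
  have f2 : finite_set [set i | P i /\ (0 < rho i a)%R /\ gen_by S b^-1 `<=` nneg (rho i)].
    apply: fS (HV Hb) _; exists i; split=> //.
    by rewrite rhoV// oppr_lt0.
  (* Each [rho k] is nonnegative at [b] or at [b^-1], hence on one of the two enlarged monoids. The
     count drops for [b] because of [j] and for [b^-1] because of [i]. *)
  have f3 := conj f1 f2; rewrite -finite_setU in f3; apply: sub_finite_set f3.
  move=> k [Pk [ka Sk]]; have [kM kS _ _] := hP k Pk; have gk := good_nneg kM kS.
  have gen c : nneg (rho k) c -> gen_by S c `<=` nneg (rho k).
    move=> Nc _ [m [d [Sd ->]]]; apply: (good_mul gk); last exact: Sk.
    exact: goodX.
  have [le|lt'] := leP 0%R (rho k b).
    by left; split=> //; split=> //; exact: gen.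
  right; split=> //; split=> //; apply: gen; split; first exact: HV.
  by rewrite rhoV// oppr_ge0 ltW.
apply: (@sub_finite_set _ _ _ _ (key _ (gen_by stabU a) _ _ (ltnSn _))).
- move=> i [Pi ia]; split=> //; split=> //.
  have [iM iS _ _] := hP i Pi; have gi := good_nneg iM iS.
  move=> _ [n [b [[Hb hb] ->]]]; apply: (good_mul gi); last exact: good_stab gi _ Hb hb.
  by apply: goodX => //; split=> //; exact: ltW.
- exact: good_gen good_stabU Ha.
- by apply: mem_gen; exact: good1 good_stabU.
Qed.

End FlatGroup.

(** * Haar measure *)

(** Compactness as an induction principle: the complements of the sets with [P] are directed, so if
    all of them met [K], some point of [K] would lie in no set with [P]. *)
Lemma compact_ideal (T : topologicalType) (K : set T) (P : set T -> Prop) :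
  compact K -> P set0 -> (forall A B, P A -> P B -> P (A `|` B)) ->
  (forall A, P A -> open A) -> (forall x, K x -> exists2 N, P N & N x) ->
  exists2 S, P S & K `<=` S.
Proof.
move=> cK P0 PU oP KP; apply: contrapT => nex.
pose I := {S : set T | P S}.
have [||||x [Kx hx]] := @compact_directed T I (exist _ _ P0) K (fun i => ~` (sval i)).
- exact: cK.
- by move=> i; apply: open_closedC; apply: oP; exact: svalP.
- move=> [A PA] [B PB]; exists (exist _ _ (PU _ _ PA PB)) => x /= h.
  by split=> Ax; apply: h; [left|right].
- move=> [A PA] /=; apply: contrapT => K0; apply: nex; exists A => // x Kx.
  by apply: contrapT => nAx; apply: K0; exists x.
- by have [N PN Nx] := KP x Kx; exact: (hx (exist _ _ PN)).
Qed.

Definition compact_open_set (T : topologicalType) (K : set T) := compact K /\ open K.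
Definition saturated (G : groupType) (K V : set G) := forall x v, K x -> V v -> K (x * v).

Section CompactOpen.
Context (G : topGroupType).
Hypothesis hs : hausdorff_space G.
Hypothesis base : forall N : set G, nbhs 1 N -> exists2 V, co_subgroup V & V `<=` N.
Implicit Types (K V W O : set G) (x : G).

Lemma compact_openU K K' : compact_open_set K -> compact_open_set K' -> compact_open_set (K `|` K').
Proof. by move=> [cK oK] [cK' oK']; split; [exact: compactU|exact: openU]. Qed.

Lemma compact_openD K K' : compact_open_set K -> compact_open_set K' -> compact_open_set (K `\` K').
Proof.
move=> [cK oK] [cK' oK']; have clK' : closed K' by exact: compact_closed.
have clK : closed K by exact: compact_closed.
split; last by apply: openI => //; exact: closed_openC.
apply: (subclosed_compact _ cK); last by move=> x [].
by apply: closedI => //; exact: open_closedC.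
Qed.

Lemma compact_open0 : compact_open_set (set0 : set G).
Proof. by split; [exact: compact0|exact: open0]. Qed.

Lemma compact_open_lcoset x V : co_subgroup V -> compact_open_set (left_coset x V).
Proof. by move=> [_ cV oV]; split; [exact: compact_left_coset|exact: open_left_coset]. Qed.

Lemma mem_left_coset x V : is_subgroup V -> left_coset x V x.
Proof. by move=> hV; apply/left_cosetE; rewrite mulVg; case: hV. Qed.

Lemma small_coset O x : open O -> O x -> exists2 V, co_subgroup V & left_coset x V `<=` O.
Proof.
move=> oO Ox.
have [|V coV VO] := base (N := (fun y => x * y) @^-1` O).
  apply: open_nbhs_nbhs; split; last by rewrite /preimage /= mulg1.
  by apply: open_pre => //; exact: continuous_mull.
by exists V => // _ [v Vv <-]; exact: VO.
Qed.

Lemma compact_open_between K O : compact K -> open O -> K `<=` O ->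
  exists S, [/\ compact_open_set S, K `<=` S & S `<=` O].
Proof.
move=> cK oO KO.
have [||||S [coS SO] KS] := @compact_ideal G K (fun S => compact_open_set S /\ S `<=` O) cK.
- by split; [exact: compact_open0|exact: sub0set].
- by move=> A B [cA AO] [cB BO]; split; [exact: compact_openU|rewrite subUset].
- by move=> A [[]].
- move=> x /KO Ox; have [V coV VO] := small_coset oO Ox.
  exists (left_coset x V); first by split=> //; exact: compact_open_lcoset.
  by apply: mem_left_coset; case: coV.
- by exists S.
Qed.

Lemma saturated_sub K V V' : V' `<=` V -> saturated K V -> saturated K V'.
Proof. by move=> VV sK x v Kx /VV; exact: sK. Qed.

(** Around each point a coset of a small subgroup lies in [K] and is saturated under it; a union of
    two saturated sets is saturated under the intersection of their subgroups. *)
Lemma exists_saturated K W : compact_open_set K -> co_subgroup W ->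
  exists V, [/\ co_subgroup V, V `<=` W & saturated K V].
Proof.
move=> [cK oK] coW.
pose P S := [/\ open S, S `<=` K & exists V, [/\ co_subgroup V, V `<=` W & saturated S V]].
have [||||S [oS SK [V [coV VW sV]]] KS] := @compact_ideal G K P cK.
- by split; [exact: open0|exact: sub0set|exists W; split=> // x v].
- move=> A B [oA AK [V [coV VW sV]]] [oB BK [V' [coV' VW' sV']]]; split.
  + exact: openU.
  + by rewrite subUset.
  + exists (V `&` V'); split; first exact: co_subgroupI.
      by move=> x [/VW].
    by move=> x v [Ax|Bx] [Vv V'v]; [left; exact: sV|right; exact: sV'].
- by move=> A [].
- move=> x Kx; have [V coV VK] := small_coset oK Kx.
  have coVW := co_subgroupI coV coW; have [hVW cVW oVW] := coVW.
  exists (left_coset x (V `&` W)); last exact: mem_left_coset.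
  split; first exact: open_left_coset.
    by apply: subset_trans VK; apply: image_subset => y [].
  exists (V `&` W); split=> // y v /left_cosetE hy hv.
  by apply/left_cosetE; rewrite mulgA; have [_ hM _] := hVW; exact: hM.
- by exists V; split=> // x v Kx Vv; apply: SK; apply: sV => //; exact: KS.
Qed.

Lemma coset_index_sat K V V' : compact K -> co_subgroup V -> co_subgroup V' ->
  V' `<=` V -> saturated K V ->
  coset_index K V' = (coset_index K V * coset_index V V')%N.
Proof.
move=> cK [hV cV oV] [hV' cV' oV'] VV sK; apply/eqP; rewrite eqn_leq.
have f1 : finite_set (left_cosets K V) by exact: left_cosets_finite.
have f2 : finite_set (left_cosets K V') by exact: left_cosets_finite.
have f3 : finite_set (left_cosets V V') by exact: left_cosets_finite.
have [_ ->] := coset_index_trans hV hV' f1 f3.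
by rewrite coset_index_mul.
Qed.

Variable (R : realType) (W : set G).
Hypothesis coW : co_subgroup W.
Local Open Scope ring_scope.

(** The measure of [K] relative to that of [W], both counted in cosets of [V]. *)
Definition cratio K V : R := (coset_index K V)%:R / (coset_index W V)%:R.

Definition fine_for K V := [/\ co_subgroup V, V `<=` W & saturated K V].

(** For compact open [K] a fine subgroup exists and, by [contentE], the choice among them does not
    matter; the default [set0] is then never reached. *)
Definition content K : R := cratio K (xget set0 [set V | fine_for K V]).

Lemma index_gt0 V V' : co_subgroup V -> co_subgroup V' -> (0 < coset_index V V')%N.
Proof.
move=> [[V1 _ _] cV _] [hV' _ oV'].
by apply: (@coset_index_gt0 _ _ _ 1%g) => //; exact: left_cosets_finite.
Qed.

Lemma cratio_sub K V V' : compact K -> fine_for K V -> co_subgroup V' ->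
  V' `<=` V -> cratio K V' = cratio K V.
Proof.
move=> cK [coV VW sV] coV' VV; rewrite /cratio.
rewrite (coset_index_sat cK coV coV' VV sV).
have [hW cW oW] := coW.
rewrite (coset_index_sat cW coV coV' VV); last first.
  by move=> x v Wx /VW; have [_ + _] := hW; exact.
rewrite !natrM -mulf_div divff ?mulr1// pnatr_eq0 -lt0n; exact: index_gt0.
Qed.

Lemma contentE K V : compact K -> fine_for K V -> content K = cratio K V.
Proof.
move=> cK fV; rewrite /content; case: xgetP => [V' _ fV'|/(_ V)[]//].
have [coV VW sV] := fV; have [coV' VW' sV'] := fV'.
have coI := co_subgroupI coV coV'.
rewrite -(cratio_sub cK fV coI); last by move=> x [].
by rewrite -(cratio_sub cK fV' coI)//; move=> x [].
Qed.

Lemma common_fine K K' : compact_open_set K -> compact_open_set K' ->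
  exists V, fine_for K V /\ fine_for K' V.
Proof.
move=> coK coK'.
have [V [coV VW sV]] := exists_saturated coK coW.
have [V' [coV' VV sV']] := exists_saturated coK' coV.
exists V'; split; split=> //.
- exact: subset_trans VW.
- exact: saturated_sub sV.
- exact: subset_trans VW.
Qed.

Lemma content_ge0 K : 0 <= content K.
Proof. by rewrite divr_ge0. Qed.

Lemma content_le K K' : compact_open_set K -> compact_open_set K' -> K `<=` K' ->
  content K <= content K'.
Proof.
move=> coK coK' KK; have [V [f f']] := common_fine coK coK'.
have [cK oK] := coK; have [cK' oK'] := coK'.
rewrite (contentE cK f) (contentE cK' f') ler_pM2r.
  have [[hV cV oV] VW sV] := f; rewrite ler_nat.
  apply: (coset_index_le hV (left_cosets_finite cK' hV oV) _).2 => x Kx.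
  by exists x; [exact: KK|rewrite mulVg; case: hV].
by have [coV _ _] := f; rewrite invr_gt0 ltr0n index_gt0.
Qed.

Lemma contentU K K' : compact_open_set K -> compact_open_set K' -> K `&` K' = set0 ->
  content (K `|` K') = content K + content K'.
Proof.
move=> coK coK' KK; have [V [f f']] := common_fine coK coK'.
have [cK oK] := coK; have [cK' oK'] := coK'.
have [coV VW sV] := f; have [_ _ sV'] := f'; have [hV cV oV] := coV.
have fU : fine_for (K `|` K') V.
  by split=> // x v [Kx|Kx] Vv; [left; exact: sV|right; exact: sV'].
rewrite (contentE cK f) (contentE cK' f') (contentE (compactU cK cK') fU).
rewrite -mulrDl -natrD; congr (_%:R / _).
rewrite /coset_index.
have -> : left_cosets (K `|` K') V = left_cosets K V `|` left_cosets K' V by exact: image_setU.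
have f1 : finite_set (left_cosets K V) by exact: left_cosets_finite.
have f2 : finite_set (left_cosets K' V) by exact: left_cosets_finite.
rewrite fset_setU// cardfsU -fset_setI//.
suff -> : left_cosets K V `&` left_cosets K' V = set0 by rewrite fset_set0 cardfs0 subn0.
apply/seteqP; split=> // C [[x Kx <-] [y K'y]] /(left_coset_eqP _ _ hV) h.
have : (K `&` K') x by split=> //; rewrite -(mulVKg y x); exact: sV'.
by rewrite KK.
Qed.

Lemma content0 : content set0 = 0.
Proof.
have := contentU compact_open0 compact_open0 (setI0 _).
by rewrite setU0 => /eqP; rewrite -subr_eq0 opprD addrA subrr add0r oppr_eq0 => /eqP.
Qed.

Lemma content_coset x K : compact_open_set K -> content (left_coset x K) = content K.
Proof.
move=> [cK oK]; have [V [coV VW sV]] := exists_saturated (conj cK oK) coW.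
have f : fine_for K V by [].
have fx : fine_for (left_coset x K) V.
  split=> // y v /left_cosetE h Vv; apply/left_cosetE; rewrite mulgA; exact: sV.
rewrite (contentE cK f) (contentE (compact_left_coset cK) fx); congr (_%:R / _).
have [hV cV oV] := coV.
have le y K' : compact K' -> (coset_index (left_coset y K') V <= coset_index K' V)%N.
  move=> cK'; have f' : finite_set (left_cosets K' V) by exact: left_cosets_finite.
  apply: (card_le_surj (f := fun C => [set y * z | z in C]) f' _).2%g.
  move=> _ [_ [z K'z <-] <-]; exists (left_coset z V); first by exists z.
  by rewrite left_cosetM.
apply/eqP; rewrite eqn_leq le//=.
have {1}-> : K = left_coset x^-1%g (left_coset x K).
  by rewrite /left_coset left_cosetM mulVg; apply/seteqP; split=> z;
    [move=> Kz; apply/left_cosetE; rewrite invg1 mul1g|move=> /left_cosetE; rewrite invg1 mul1g].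
exact/le/compact_left_coset.
Qed.

Lemma content_W : content W = 1.
Proof.
have [hW cW oW] := coW.
have f : fine_for W W by split=> // x v Wx Wv; have [_ + _] := hW; exact.
rewrite (contentE cW f) /cratio divff//.
by have [_ ->] := coset_index_self hW; rewrite oner_eq0.
Qed.

Lemma content_index K V : compact_open_set K -> co_subgroup V -> saturated K V ->
  content K = (coset_index K V)%:R * content V.
Proof.
move=> coK coV sK; have [cK oK] := coK; have [hV cV oV] := coV.
have [V' [[coV' VW sV'] [_ _ sV]]] := common_fine (conj cV oV : compact_open_set V) coK.
have VV : V' `<=` V.
  by move=> x V'x; rewrite -(mul1g x); apply: sV' => //; case: hV.
have f1 : fine_for V V' by [].
have f2 : fine_for K V' by [].
rewrite (contentE cK f2) (contentE cV f1) /cratio.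
by rewrite (coset_index_sat cK coV coV' VV sK) natrM mulrA.
Qed.

Lemma content_gt0 V : co_subgroup V -> 0 < content V.
Proof.
move=> coV; have [hV cV oV] := coV.
have [V' [coV' VW sV']] := exists_saturated (conj cV oV) coW.
have f1 : fine_for V V' by [].
by rewrite (contentE cV f1) divr_gt0// ltr0n index_gt0.
Qed.

(** Cosets of [b(V)] in [b(K)] and [b(W)] are as many as cosets of [V] in [K] and [W], and [W] has
    content [1]. *)
Lemma content_act (b : caut G) K : compact_open_set K ->
  content (act b K) = content (act b W) * content K.
Proof.
move=> coK; have [cK oK] := coK; have [hW cW oW] := coW.
have [V [coV VW sV]] := exists_saturated coK coW; have [hV cV oV] := coV.
have cobV : co_subgroup (act b V).
  by split; [exact: act_subgroup|exact: act_compact|exact: act_open].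
have act_sat C : saturated C V -> saturated (act b C) (act b V).
  by move=> sC x v; rewrite !actE cautM; exact: sC.
have act_co C : compact_open_set C -> compact_open_set (act b C).
  by move=> [? ?]; split; [exact: act_compact|exact: act_open].
have E C : compact_open_set C -> saturated C V ->
    content (act b C) = (coset_index C V)%:R * content (act b V).
  move=> coC sC; have [cC oC] := coC.
  rewrite (content_index (act_co _ coC) cobV (act_sat _ sC)).
  have f : finite_set (left_cosets C V) by exact: left_cosets_finite.
  by have [_ ->] := coset_index_act b hV f.
have coWW : compact_open_set W by [].
have sW : saturated W V by move=> x v Wx /VW; have [_ + _] := hW; exact.
rewrite (E K coK sV) (E W coWW sW) (content_index coK coV sV).
have := content_index coWW coV sW; rewrite content_W.
move: (content V) (content (act b V)) (_ W V)%:R (_ K V)%:R => c d i j e.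
by rewrite mulrACA [d * c]mulrC mulrACA -e mul1r.
Qed.

(** * From the content to a left Haar measure *)

Local Open Scope ereal_scope.

Definition open_content (O : set G) : \bar R :=
  ereal_sup [set (content K)%:E | K in [set K | compact_open_set K /\ K `<=` O]].

Definition haar_outer (A : set G) : \bar R :=
  ereal_inf [set open_content O | O in [set O | open O /\ A `<=` O]].

Lemma le_open_content K O : compact_open_set K -> K `<=` O ->
  (content K)%:E <= open_content O.
Proof. by move=> coK KO; apply: ereal_sup_ubound; exists K. Qed.

Lemma open_content_le O c :
  (forall K, compact_open_set K -> K `<=` O -> (content K)%:E <= c) ->
  open_content O <= c.
Proof. by move=> h; apply: ub_ereal_sup => _ [K [coK KO] <-]; exact: h. Qed.

Lemma open_content_ge0 O : 0 <= open_content O.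
Proof.
by apply: le_trans (le_open_content compact_open0 (@sub0set _ O)); rewrite lee_fin content_ge0.
Qed.

Lemma open_content_mono O O' : O `<=` O' -> open_content O <= open_content O'.
Proof.
by move=> OO; apply: open_content_le => K coK KO; apply: le_open_content => //;
  exact: subset_trans OO.
Qed.

Lemma open_content_compact K : compact_open_set K -> open_content K = (content K)%:E.
Proof.
move=> coK; apply/eqP; rewrite eq_le le_open_content// andbT.
by apply: open_content_le => K' coK' KK; rewrite lee_fin content_le.
Qed.

(* A compact open subset of [O `|` O'] splits into compact open subsets of
   [O] and [O']. *)
Lemma open_contentU O O' : open O -> open O' ->
  open_content (O `|` O') <= open_content O + open_content O'.
Proof.
move=> oO oO'; apply: open_content_le => K coK KO; have [cK oK] := coK.
have cD : compact (K `\` O').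
  apply: (subclosed_compact _ cK); last by move=> x [].
  by apply: closedI; [exact: compact_closed|exact: open_closedC].
have [||S [coS DS SO]] := @compact_open_between (K `\` O') (O `&` K) cD.
- exact: openI.
- by move=> x [Kx nO'x]; split=> //; case: (KO x Kx).
have coK2 : compact_open_set (K `\` S) by exact: compact_openD.
have KE : K = S `|` (K `\` S).
  apply/seteqP; split=> x; first by move=> Kx; have [Sx|nSx] := pselect (S x); [left|right].
  by move=> [/SO[]|[]].
rewrite KE contentU//; last by apply/seteqP; split=> // x [Sx [_]].
rewrite EFinD; apply: leeD; apply: le_open_content => //; first by move=> x /SO[].
move=> x [Kx nSx]; apply: contrapT => nO'; apply: nSx; exact: DS.
Qed.

Lemma open_content_sum (O : nat -> set G) n : (forall i, open (O i)) ->
  open_content (\bigcup_(i in `I_n) O i) <= \sum_(0 <= i < n) open_content (O i).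
Proof.
move=> oO; elim: n => [|n IH].
  rewrite II0 bigcup_set0 big_geq// open_content_compact ?content0//.
  exact: compact_open0.
rewrite IIS bigcup_setU bigcup_set1 big_nat_recr//=.
apply: le_trans (open_contentU _ (oO n)) _; first exact: bigcup_open.
exact: leeD.
Qed.

Lemma open_content_sigma (O : nat -> set G) : (forall i, open (O i)) ->
  open_content (\bigcup_i O i) <= \sum_(0 <= i <oo) open_content (O i).
Proof.
move=> oO; apply: open_content_le => K [cK oK] KO.
pose P S := open S /\ exists n, S `<=` \bigcup_(i in `I_n) O i.
have [||||S [oS [n Sn]] KS] := @compact_ideal G K P cK.
- by split; [exact: open0|exists 0%N].
- move=> A B [oA [n An]] [oB [m Bm]]; split; first exact: openU.
  exists (n + m)%N => x [/An[i] /= ni Ox|/Bm[i] /= mi Ox]; exists i => //=.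
    exact: ltn_addr.
  exact: ltn_addl.
- by move=> A [].
- move=> x /KO[i _ Oix]; exists (O i) => //; split=> //; exists i.+1 => y Oy; exists i => //=.
apply: le_trans (nneseries_lim_ge n _); last by move=> i _ _; exact: open_content_ge0.
apply: le_trans (open_content_sum n oO).
by apply: le_open_content => //; exact: subset_trans KS Sn.
Qed.

Lemma haar_outer_open O : open O -> haar_outer O = open_content O.
Proof.
move=> oO; apply/eqP; rewrite eq_le; apply/andP; split.
  by apply: ereal_inf_lbound; exists O => //; split.
by apply: le_ereal_inf_tmp => _ [N [oN ON] <-]; exact: open_content_mono.
Qed.

Lemma haar_outer_ge0 A : 0 <= haar_outer A.
Proof. by apply: le_ereal_inf_tmp => _ [N _ <-]; exact: open_content_ge0. Qed.

Lemma haar_outer_mono A B : A `<=` B -> haar_outer A <= haar_outer B.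
Proof.
move=> AB; apply: le_ereal_inf_tmp => _ [N [oN BN] <-].
by apply: ereal_inf_lbound; exists N => //; split=> //; exact: subset_trans BN.
Qed.

Lemma haar_outer0 : haar_outer set0 = 0.
Proof.
by rewrite (haar_outer_open open0) (open_content_compact compact_open0) content0.
Qed.

Lemma haar_outer_sigma : sigma_subadditive haar_outer.
Proof.
move=> A; have [[i Ai]|nA] := pselect (exists i, haar_outer (A i) = +oo).
  rewrite (_ : \sum_(_ <= _ <oo) _ = +oo) ?leey//.
  apply: (eseries_pinfty _ _ Ai) => // j _.
  by apply: contraTneq (haar_outer_ge0 (A j)) => ->.
apply/lee_addgt0Pr => e e0.
have apx i : exists O, [/\ open O, A i `<=` O &
    open_content O <= haar_outer (A i) + (e / (2 ^ i.+1)%:R)%:E].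
  have fin : haar_outer (A i) \is a fin_num.
    by rewrite ge0_fin_numE ?haar_outer_ge0// ltey; apply/eqP => h; apply: nA; exists i.
  have e1 : (0 < e / (2 ^ i.+1)%:R :> R)%R by rewrite divr_gt0// ltr0n expn_gt0.
  have [_ [N [oN AN] <-] lt] := lb_ereal_inf_adherent e1 fin.
  by exists N; split=> //; exact: ltW.
have /choice[N hN] := apx.
have A0 i : 0 <= haar_outer (A i) by exact: haar_outer_ge0.
apply: le_trans (epsilon_trick _ A0 (ltW e0)).
apply: (@le_trans _ _ (\sum_(0 <= i <oo) open_content (N i))); last first.
  by apply: lee_nneseries => [i _ _|i _]; [exact: open_content_ge0|case: (hN i)].
apply: le_trans (open_content_sigma _); last by move=> i; case: (hN i).
rewrite -haar_outer_open; last by apply: bigcup_open => i _; case: (hN i).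
by apply: haar_outer_mono; apply: subset_bigcup => i _; case: (hN i).
Qed.

Lemma open_content_setD P K : open P -> compact_open_set K -> K `<=` P ->
  (content K)%:E + open_content (P `\` K) <= open_content P.
Proof.
move=> oP coK KP; rewrite addeC -leeBrDr//; apply: open_content_le => K' coK' KK.
rewrite leeBrDr// -EFinD -contentU//.
  apply: le_open_content; first exact: compact_openU.
  by move=> x [/KK[]|/KP].
by apply/seteqP; split=> // x [/KK[]].
Qed.

(** A compact open [K] inside both [P] and [O] approximates the first term. The rest of [P] is open
    and covers the part of [P] outside [O], and content adds up over [K] and the rest. This is
    Caratheodory's condition for [O], tested on open sets. *)
Lemma haar_outer_open_split P O : open P -> open O ->
  open_content (P `&` O) + haar_outer (P `&` ~` O) <= open_content P.
Proof.
move=> oP oO; have [->|fin] := eqVneq (open_content P) +oo; first exact: leey.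
have PP : haar_outer (P `&` ~` O) <= open_content P.
  by rewrite -haar_outer_open//; apply: haar_outer_mono => x [].
have fQ : haar_outer (P `&` ~` O) \is a fin_num.
  by rewrite ge0_fin_numE ?haar_outer_ge0//; apply: le_lt_trans PP _; rewrite ltey.
rewrite -leeBrDr//; apply: open_content_le => K coK KP; rewrite leeBrDr//.
have KP' : K `<=` P by move=> x /KP[].
apply: le_trans (open_content_setD oP coK KP'); rewrite leeD2l//.
have oD : open (P `\` K).
  by have [cK oK] := coK; apply: openI => //; apply: closed_openC; exact: compact_closed.
rewrite -haar_outer_open//; apply: haar_outer_mono => x [Px nOx]; split=> //.
by move=> /KP[].
Qed.

(** One inequality holds for every automorphism; applied to [b] and to [b^-1], whose factors have
    product [1], it gives equality. *)
Lemma haar_outer_act (b : caut G) A :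
  haar_outer (act b A) = (content (act b W))%:E * haar_outer A.
Proof.
have [hW cW oW] := coW.
have cpos (g : caut G) : (0 < content (act g W))%R.
  by apply: content_gt0; split; [exact: act_subgroup|exact: act_compact|exact: act_open].
have ge (g : caut G) O : (content (act g W))%:E * open_content O <= open_content (act g O).
  rewrite -lee_pdivlMl//; apply: open_content_le => K coK KO.
  rewrite lee_pdivlMl// -EFinM -content_act//.
  apply: le_open_content; last by move=> x; rewrite !actE => /KO.
  by have [cK oK] := coK; split; [exact: act_compact|exact: act_open].
have geA (g : caut G) B : (content (act g W))%:E * haar_outer B <= haar_outer (act g B).
  apply: le_ereal_inf_tmp => _ [N [oN BN] <-].
  have {1}-> : N = act g (act g^-1%g N) by rewrite -act_mul mulgV act1.
  apply: le_trans (ge g _); rewrite lee_pmul2l ?lte_fin//.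
  apply: ereal_inf_lbound; exists (act g^-1%g N) => //; split; first exact: act_open.
  by move=> x Bx; apply/actV; apply: BN; apply/actP.
apply/eqP; rewrite eq_le geA andbT.
have := geA b^-1%g (act b A); rewrite -act_mul mulVg act1.
have e : (content (act b W) * content (act b^-1%g W) = 1)%R.
  rewrite -content_act; last by split; [exact: act_compact|exact: act_open].
  by rewrite -act_mul mulgV act1 content_W.
move=> h; have c0 : 0 <= (content (act b W))%:E by rewrite lee_fin ltW.
by have := lee_wpmul2l c0 h; rewrite muleA -EFinM e mul1e.
Qed.

Lemma haar_outer_coset x A : haar_outer (left_coset x A) = haar_outer A.
Proof.
have le y B : haar_outer (left_coset y B) <= haar_outer B.
  apply: le_ereal_inf_tmp => _ [N [oN BN] <-].
  apply: le_trans (_ : open_content (left_coset y N) <= _).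
    apply: ereal_inf_lbound; exists (left_coset y N) => //; split; first exact: open_left_coset.
    exact: image_subset.
  apply: open_content_le => K coK KN; have [cK oK] := coK.
  rewrite -(content_coset y^-1%g coK); apply: le_open_content.
    by split; [exact: compact_left_coset|exact: open_left_coset].
  by move=> _ [z /KN[n Nn <-] <-]; rewrite mulKg.
apply/eqP; rewrite eq_le le /=.
have {1}-> : A = left_coset x^-1%g (left_coset x A); last exact: le.
rewrite /left_coset left_cosetM mulVg; apply/seteqP; split=> z.
  by move=> Az; apply/left_cosetE; rewrite invg1 mul1g.
by move=> /left_cosetE; rewrite invg1 mul1g.
Qed.

Lemma haar_outer_compact K : compact K -> haar_outer K < +oo.
Proof.
move=> cK; have [S [coS KS _]] := compact_open_between cK openT (@subsetT _ K).
apply: le_lt_trans (haar_outer_mono KS) _; have [cS oS] := coS.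
by rewrite haar_outer_open// open_content_compact// ltry.
Qed.

Let T := pointed_group G.

Let haar_om : {outer_measure set T -> \bar R} :=
  HB.pack haar_outer (isOuterMeasure.Build R T haar_outer haar_outer0 haar_outer_ge0
    haar_outer_mono haar_outer_sigma).

Lemma haar_caratheodory (A : set (borel G)) : measurable A ->
  haar_om.-caratheodory A.
Proof.
apply: smallest_sub; last first.
  move=> O oO; apply: le_caratheodory_measurable => X.
  apply: le_ereal_inf_tmp => _ [N [oN XN] <-].
  apply: le_trans (haar_outer_open_split oN oO).
  have oNO : open (N `&` O) by exact: openI.
  rewrite -(haar_outer_open oNO); apply: leeD; apply: haar_outer_mono.
    by move=> x [/XN].
  by move=> x [/XN].
split; first exact: caratheodory_measurable_set0.
  by move=> B mB; rewrite setTD; exact: caratheodory_measurable_setC.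
exact: caratheodory_measurable_bigcup.
Qed.

Let haar_fun (A : set (borel G)) : \bar R := haar_outer A.

Let haar_fun_sigma : semi_sigma_additive haar_fun.
Proof.
move=> A mA tA mbA.
apply: (@caratheodory_measure_sigma_additive R T haar_om A _ tA).
  by move=> i; exact: haar_caratheodory.
exact: haar_caratheodory.
Qed.

Theorem exists_left_haar : exists mu : {measure set (borel G) -> \bar R},
  left_haar mu /\ forall b : caut G, exists2 c : R, (0 < c)%R &
    forall A : set (borel G), mu (b @` A) = c%:E * mu A.
Proof.
pose mu : {measure set (borel G) -> \bar R} :=
  HB.pack haar_fun (isMeasure.Build _ (borel G) R haar_fun haar_outer0
    haar_outer_ge0 haar_fun_sigma).
have muE A : mu A = haar_outer A by [].
exists mu; split; last first.
  move=> b; exists (content (act b W)).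
    have [hW cW oW] := coW.
    by apply: content_gt0; split; [exact: act_subgroup|exact: act_compact|exact: act_open].
  by move=> A; rewrite image_act; exact: haar_outer_act.
split.
- rewrite muE gt_eqF//; apply: lt_le_trans (haar_outer_mono (@subsetT _ W)).
  have [hW cW oW] := coW.
  by rewrite haar_outer_open// open_content_compact// content_W lte_fin.
- by move=> x A mA; exact: haar_outer_coset.
- exact: haar_outer_compact.
- move=> A mA; rewrite !muE /haar_outer; congr ereal_inf.
  apply/seteqP; split=> _ [N [oN AN] <-]; exists N => //; first exact: haar_outer_open.
  by rewrite -haar_outer_open.
- move=> U oU; apply/eqP; rewrite eq_le; apply/andP; split.
    rewrite muE haar_outer_open//; apply: open_content_le => K coK KU.
    apply: ereal_sup_ubound; exists K; first by split=> //; case: coK.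
    by have [cK oK] := coK; rewrite muE haar_outer_open// open_content_compact.
  by apply: ub_ereal_sup => _ [K [cK KU] <-]; exact: haar_outer_mono.
Qed.

End CompactOpen.

(** * Closed subgroups and modules *)

Section VanDantzig.

Lemma separate_point (T : topologicalType) (D : set T) x : hausdorff_space T ->
  compact D -> ~ D x ->
  exists A B, [/\ open A, open B, A x, D `<=` B & A `&` B = set0].
Proof.
move=> hs cD nDx.
pose P (S : set T) := open S /\ exists A, [/\ open A, A x & A `&` S = set0].
have [||||B [oB [A [oA Ax AB]]] DB] := @compact_ideal T D P cD.
- split; first exact: open0.
  by exists setT; split=> //; [exact: openT|rewrite setI0].
- move=> S S' [oS [A [oA Ax AS]]] [oS' [A' [oA' Ax' AS']]]; split; first exact: openU.
  exists (A `&` A'); split=> //; first exact: openI.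
  apply/seteqP; split=> // y [[Ay A'y] [Sy|S'y]].
    by rewrite -AS.
  by rewrite -AS'.
- by move=> S [].
- move=> y Dy; move: hs; rewrite open_hausdorff => /(_ x y).
  case=> [|[A B] /= [/set_mem Ax /set_mem By] [oA oB /eqP AB]].
    by apply: contra_notN nDx => /eqP ->.
  by exists B => //; split=> //; exists A.
- by exists A, B.
Qed.

Lemma separate_compact (T : topologicalType) (C D : set T) : hausdorff_space T ->
  compact C -> compact D -> C `&` D = set0 ->
  exists A B, [/\ open A, open B, C `<=` A, D `<=` B & A `&` B = set0].
Proof.
move=> hs cC cD CD.
pose P (S : set T) := open S /\ exists B, [/\ open B, D `<=` B & S `&` B = set0].
have [||||A [oA [B [oB DB AB]]] CA] := @compact_ideal T C P cC.
- split; first exact: open0.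
  by exists setT; split=> //; [exact: openT|rewrite set0I].
- move=> S S' [oS [B [oB DB SB]]] [oS' [B' [oB' DB' SB']]]; split; first exact: openU.
  exists (B `&` B'); split; [exact: openI|by rewrite subsetI|].
  apply/seteqP; split=> // y [[Sy|S'y] [By B'y]].
    by rewrite -SB.
  by rewrite -SB'.
- by move=> S [].
- move=> x Cx; have nDx : ~ D x by move=> Dx; have : (C `&` D) x by []; rewrite CD.
  have [A [B [oA oB Ax DB AB]]] := separate_point hs cD nDx.
  by exists A => //; split=> //; exists B.
- by exists A, B.
Qed.

(** The intersection [Q] of the compact open neighbourhoods of [x] in [U] is connected: the two
    halves of a splitting of [Q] lie in disjoint open sets [A] and [A'], some member [C] of the
    family lies in their union, and the half of [C] around [x] belongs to the family again, hence
    contains [Q]. *)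
Lemma quasi_component (T : topologicalType) (U : set T) x : hausdorff_space T ->
  totally_disconnected [set: T] -> compact_open_set U -> U x ->
  forall y, (forall C, compact_open_set C -> C x -> C `<=` U -> C y) -> y = x.
Proof.
move=> hs td coU Ux y hy.
pose fam C := [/\ compact_open_set C, C x & C `<=` U].
pose Q := [set y | forall C, fam C -> C y].
have Qy : Q y by move=> C [? ? ?]; exact: hy.
have Qx : Q x by move=> C [].
have famI C C' : fam C -> fam C' -> fam (C `&` C').
  move=> [[cC oC] Cx CU] [[cC' oC'] C'x _]; split=> //; last by move=> z [/CU].
  split; last exact: openI.
  by apply: compact_closedI => //; exact: compact_closed.
have famU : fam U by split.
have clQ : closed Q.
  have -> : Q = \bigcap_(C in fam) C by [].
  by apply: closed_bigI => C [[cC _] _ _]; exact: compact_closed.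
have cQ : compact Q.
  by have [cU _] := coU; apply: subclosed_compact clQ cU _ => z; apply.
have shrink O : open O -> Q `<=` O -> exists2 C, fam C & C `<=` O.
  move=> oO QO; apply: contrapT => nex.
  have [cU _] := coU.
  have [|||z [_ hz]] := @compact_directed T {C | fam C} (exist _ _ famU) U
    (fun i => sval i `&` ~` O) cU.
  - move=> [C [[cC oC] Cx CU]] /=; apply: closedI; last exact: open_closedC.
    exact: compact_closed.
  - move=> [C fC] [C' fC']; exists (exist _ _ (famI _ _ fC fC')) => z /= [[Cz C'z] nO].
    by split.
  - move=> [C fC] /=; apply: contrapT => ne; apply: nex; exists C => // z Cz.
    apply: contrapT => nOz; apply: ne; exists z; split=> //.
    by have [_ _] := fC; apply.
  - have [_] := hz (exist _ _ famU); apply; apply: QO => C fC.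
    by have [] := hz (exist _ _ fC).
suff cnQ : connected Q.
  have := connected_component_max Qx (@subsetT _ Q) cnQ.
  by rewrite td// => /(_ y Qy).
move=> B [b Bb] [N oN BN] [D clD BD].
have BQ : B `<=` Q by rewrite BN => z [].
have cB : compact B by rewrite BD; apply: compact_closedI.
have cB' : compact (Q `&` ~` N).
  by apply: compact_closedI => //; exact: open_closedC.
have dB : B `&` (Q `&` ~` N) = set0.
  by apply/seteqP; split=> // z []; rewrite BN => -[_ Nz] [_].
have [A [A' [oA oA' BA BA' AA]]] := separate_compact hs cB cB' dB.
have QA : Q `<=` A `|` A'.
  move=> z Qz; have [Nz|nOz] := pselect (N z).
    by left; apply: BA; rewrite BN.
  by right; apply: BA'.
have [C fC CA] := shrink _ (openU oA oA') QA.
have [[cC oC] Cx CU] := fC.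
have piece E E' : open E -> open E' -> C `<=` E `|` E' -> E `&` E' = set0 -> E x -> fam (C `&` E).
  move=> oE oE' CE EE Ex; split=> //; last by move=> z [/CU].
  split; last exact: openI.
  have -> : C `&` E = C `&` ~` E'.
    apply/seteqP; split=> z [Cz h]; split=> //.
      by move=> E'z; have : (E `&` E') z by []; rewrite EE.
    by case: (CE z Cz).
  by apply: compact_closedI => //; exact: open_closedC.
have [Ax|A'x] := CA x Cx.
  have fE := piece A A' oA oA' CA AA Ax.
  apply/seteqP; split=> // z Qz; rewrite BN; split=> //; apply: contrapT => nOz.
  have A'z : A' z by apply: BA'.
  have [_ Az] := Qz _ fE.
  by have : (A `&` A') z by []; rewrite AA.
have fE : fam (C `&` A').
  by apply: (piece A' A) => //; [rewrite setUC|rewrite setIC].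
have [_ A'b] := BQ b Bb _ fE.
have : (A `&` A') b by split=> //; exact: BA.
by rewrite AA.
Qed.

Theorem van_dantzig (G : topGroupType) (U : set G) : hausdorff_space G ->
  totally_disconnected [set: G] -> co_subgroup U ->
  forall N : set G, nbhs 1 N -> exists2 V, co_subgroup V & V `<=` N.
Proof.
move=> hs td [hU cU oU] N N1; have U1 : U 1 by case: hU.
have coU : compact_open_set U by [].
have [C [coC C1 CN]] : exists C, [/\ compact_open_set C, C 1 & C `<=` N].
  apply: contrapT => nex.
  pose fam (C : set G) := [/\ compact_open_set C, C 1 & C `<=` U].
  pose I := {C | fam C}.
  have i0 : I by exists U; split.
  have oNi : open (N^°) by exact: open_interior.
  have [|||z [_ hz]] := @compact_directed G I i0 U (fun i => sval i `&` ~` (N^°)) cU.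
  - move=> [C [[cC oC] Cx CU]] /=; apply: closedI; last exact: open_closedC.
    exact: compact_closed.
  - move=> [C [[cC oC] C1 CU]] [C' [[cC' oC'] C1' CU']].
    have h : fam (C `&` C').
      split=> //; last by move=> z [/CU].
      by split; [apply: compact_closedI => //; exact: compact_closed|exact: openI].
    by exists (exist _ _ h) => z /= [[Cz C'z] nO].
  - move=> [C [coC C1 CU]] /=; apply: contrapT => ne; apply: nex; exists C; split=> // z Cz.
    apply: contrapT => nOz; apply: ne; exists z; split; first exact: CU.
    by split=> // /interior_subset.
  - have z1 : z = 1.
      apply: (quasi_component hs td coU U1) => C coC C1 CU.
      by have [] := hz (exist fam C (And3 coC C1 CU)).
    by have [_] := hz i0; rewrite z1; apply.
have [cC oC] := coC.
(* The subgroup of right translations that preserve [C]: it lies in [C] because [1] does, and [tube]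
   makes it open. *)
pose V := [set x | (forall c, C c -> C (c * x)) /\ (forall c, C c -> C (c * x^-1))].
have hV : is_subgroup V.
  split.
  - by split=> c; rewrite ?invg1 mulg1.
  - move=> x y [h1 h2] [h3 h4]; split=> c Cc; first by rewrite mulgA; apply: h3; exact: h1.
    by rewrite invgM mulgA; apply: h2; exact: h4.
  - by move=> x [h1 h2]; split; rewrite ?invgK.
have VC : V `<=` C by move=> x [/(_ 1 C1)]; rewrite mul1g.
have oV : open V.
  apply: nbhs1_open => //; apply: filterI.
    apply: (tube (f := fun p => p.1 * p.2)) => //; first exact: mulg_continuous.
    by move=> c /=; rewrite mulg1.
  apply: (tube (f := fun p => p.1 * p.2^-1)) => //.
    apply: continuous_mulg; first by move=> p; exact: cvg_fst.
    by apply: continuous_invg => p; exact: cvg_snd.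
  by move=> c /=; rewrite invg1 mulg1.
exists V; last exact: subset_trans CN.
by split=> //; apply: subclosed_compact cC VC; exact: open_subgroup_closed.
Qed.

End VanDantzig.

(** * Measures on closed subgroups *)

Section ClosedSubgroup.
Context (G : topGroupType) (L : subgroup G).
Hypotheses (hs : hausdorff_space G) (cL : closed (L : set G)).
Local Notation T := (sgType L).
Local Notation pre K := ((val : T -> G) @^-1` K).

Lemma nbhs_sg (x : T) (B : set T) : nbhs x B ->
  exists2 A, open A & A (val x) /\ pre A `<=` B.
Proof. by move=> [_ [[A oA <-] Ax] AB]; exists A. Qed.

Lemma sg_hausdorff : hausdorff_space T.
Proof.
move=> p q clpq; apply: val_inj; apply: hs => A B Ap Bq.
have [x [Ax Bx]] := clpq _ _ (@sg_val_continuous G L p A Ap) (@sg_val_continuous G L q B Bq).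
by exists (val x).
Qed.

Lemma pre_open A : open A -> open (pre A).
Proof. by apply: open_pre; exact: sg_val_continuous. Qed.

Lemma pre_compact K : compact K -> compact (pre K).
Proof.
move=> cK F PF FK.
have cKL : compact (K `&` L) by exact: compact_closedI.
pose F' : set_system G := [set A | F (pre A)].
have PF' : ProperFilter F'.
  by apply: fmap_proper_filter.
have FK' : F' (K `&` L).
  rewrite -[F' _]/(F (pre (K `&` L))); apply: filterS FK => x Kx.
  by split; [exact: Kx|exact: sg_valP].
have [x [[Kx Lx] clx]] := cKL F' PF' FK'.
exists (sg_elt Lx); split=> // A B FA /nbhs_sg[N oN [Nx NB]].
have F'A : F' (val @` A).
  by rewrite -[F' _]/(F (pre (val @` A))); apply: filterS FA => y Ay; exists y.
have [_ [[y Ay <-] Ny]] := clx _ _ F'A (open_nbhs_nbhs (conj oN Nx)).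
by exists y; split=> //; exact: NB.
Qed.

Lemma pre_subgroup A : is_subgroup A -> is_subgroup (pre A).
Proof.
by move=> [a1 aM aV]; split=> //; [move=> x y; exact: aM|move=> x; exact: aV].
Qed.

Lemma pre_co_subgroup A : co_subgroup A -> co_subgroup (pre A).
Proof.
by move=> [hA cA oA]; split; [exact: pre_subgroup|exact: pre_compact|exact: pre_open].
Qed.

Lemma sg_base : (forall N : set G, nbhs 1 N -> exists2 V, co_subgroup V & V `<=` N) ->
  forall N : set T, nbhs 1 N -> exists2 V, co_subgroup V & V `<=` N.
Proof.
move=> base N /nbhs_sg[A oA [A1 AN]].
have [V coV VO] := base A (open_nbhs_nbhs (conj oA A1)).
by exists (pre V); [exact: pre_co_subgroup|apply: subset_trans AN => x; exact: VO].
Qed.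

End ClosedSubgroup.

Section HaarFacts.
Context (R : realType) (T : topGroupType).
Hypothesis hs : hausdorff_space T.
Hypothesis base : forall N : set T, nbhs 1 N -> exists2 V, co_subgroup V & V `<=` N.
Variable mu : ({measure set (borel T) -> \bar R})%R.
Hypothesis haar : left_haar mu.
Local Open Scope ereal_scope.

Lemma borel_open (A : set T) : open A -> measurable (A : set (borel T)).
Proof. by move=> oA; apply: sub_sigma_algebra. Qed.

Lemma borel_closed (A : set T) : closed A -> measurable (A : set (borel T)).
Proof.
move=> cA; rewrite -[A]setCK; apply: measurableC; apply: borel_open.
exact: closed_openC.
Qed.

Lemma haar_lt_pinfty (K : set T) : compact K -> mu K < +oo.
Proof. by case: haar => _ _ + _ _; apply. Qed.

(** Otherwise every translate of [V] is null, hence so is every compact set, and inner regularity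
    makes the whole group null. *)
Lemma haar_gt0 V : co_subgroup V -> 0 < mu V.
Proof.
move=> [hV cV oV]; have [mu0 inv _ _ inner] := haar.
rewrite lt0e measure_ge0 andbT; apply: contra_neq mu0 => V0.
apply/eqP; rewrite eq_le measure_ge0 andbT (inner _ openT).
apply: ub_ereal_sup => _ [K [cK _] <-].
pose P (S : set T) := open S /\ mu S = 0.
have [||||S [oS S0] KS] := @compact_ideal T K P cK.
- by split; [exact: open0|rewrite measure0].
- move=> A B [oA A0] [oB B0]; split; first exact: openU.
  apply/eqP; rewrite eq_le measure_ge0 andbT.
  apply: le_trans (measureU2 _ _ _) _; [exact: borel_open|exact: borel_open|].
  by rewrite -[X in X + _ <= _]/(mu A) -[X in _ + X <= _]/(mu B) A0 B0 adde0.
- by move=> A [].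
- move=> x Kx; exists (left_coset x V); last exact: mem_left_coset.
  by split; [exact: open_left_coset|rewrite inv//; exact: borel_open].
- rewrite -S0; apply: le_measure => //; rewrite inE.
    by apply: borel_closed; exact: compact_closed.
  exact: borel_open.
Qed.

Lemma haar_index (K V : set T) : compact K -> open K -> co_subgroup V -> saturated K V ->
  mu K = (coset_index K V)%:R%:E * mu V.
Proof.
move=> cK oK [hV cV oV] sK; have [_ inv _ _ _] := haar.
have f : finite_set (left_cosets K V) by exact: left_cosets_finite.
have KE : K = \bigcup_(C in left_cosets K V) C.
  apply/seteqP; split=> [x Kx|x [_ [y Ky <-] [v Vv <-]]]; last exact: sK.
  by exists (left_coset x V); [exists x|exact: mem_left_coset].
rewrite {1}KE (@measure_fin_bigcup _ _ _ mu _ _ id)//; first last.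
- by move=> _ [x _ <-]; apply: borel_open; exact: open_left_coset.
- move=> _ _ [x _ <-] [y _ <-] [z [/left_cosetE xz /left_cosetE yz]].
  apply/left_coset_eqP => //; have [_ hM hI] := hV.
  have -> : (x^-1 * y = (x^-1 * z) * (y^-1 * z)^-1)%g by rewrite invgM invgK !mulgA mulgK.
  by apply: hM => //; exact: hI.
rewrite fsbig_finite//= big_seq (eq_bigr (fun=> mu V)); last first.
  move=> C; rewrite in_fset_set// inE => -[x _ <-].
  by apply: inv; exact: borel_open.
rewrite -big_seq.
have fV : mu V \is a fin_num by rewrite ge0_fin_numE ?haar_lt_pinfty.
rewrite -(fineK fV) sumEFin -EFinM; congr EFin.
by rewrite big_const_seq count_predT iter_addr_0 mulr_natl.
Qed.

(** The right-hand side involves indices only, so the scaling factor is the same for every left Haar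
    measure; this identifies the value that [xget] picks in [module]. *)
Lemma haar_scaling_factor (b : caut T) (W : set T) (c : R) : co_subgroup W ->
  (forall A : set (borel T), measurable A -> mu (b @` A) = c%:E * mu A) ->
  let V := W `&` act b W in
  c = ((coset_index (act b W) V)%:R / (coset_index W V)%:R)%R.
Proof.
move=> coW hc V; have [hW cW oW] := coW.
have cobW : co_subgroup (act b W).
  by split; [exact: act_subgroup|exact: act_compact|exact: act_open].
have [hbW cbW obW] := cobW.
have coV : co_subgroup V by exact: co_subgroupI.
have sW : saturated W V by move=> x v Wx [Wv _]; have [_ + _] := hW; exact.
have sbW : saturated (act b W) V by move=> x v Wx [_ Wv]; have [_ + _] := hbW; exact.
have := hc W (borel_open oW); rewrite image_act.
rewrite (haar_index cbW obW coV sbW) (haar_index cW oW coV sW).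
have fV : mu V \is a fin_num by rewrite ge0_fin_numE ?haar_lt_pinfty//; case: coV.
have V0 : (0 < fine (mu V))%R by rewrite fine_gt0// haar_gt0//= -ge0_fin_numE.
rewrite -(fineK fV) -!EFinM => -[]; rewrite mulrA => /(mulIf (lt0r_neq0 V0)) ->.
by rewrite mulfK// pnatr_eq0 -lt0n index_gt0.
Qed.

Lemma haar_subgroup_eq (V W : set T) : co_subgroup V -> co_subgroup W -> V `<=` W ->
  mu W <= mu V -> V = W.
Proof.
move=> coV coW VW le; apply/seteqP; split=> // x Wx; apply: contrapT => nVx.
have [hV cV oV] := coV; have [hW cW oW] := coW.
have sW : saturated W V by move=> y v Wy /VW Wv; have [_ + _] := hW; exact.
move: le; rewrite (haar_index cW oW coV sW) leNgt => /negP; apply.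
have fV : mu V \is a fin_num by rewrite ge0_fin_numE ?haar_lt_pinfty.
have V0 : (0 < fine (mu V))%R by rewrite fine_gt0// haar_gt0//= -ge0_fin_numE.
rewrite -(fineK fV) -EFinM lte_fin ltr_pMl// ltr1n.
have f : finite_set (left_cosets W V) by exact: left_cosets_finite.
have [_ <-] := coset_index_self hV.
apply: coset_index_lt => //; exists x => // y Vy Vyx; apply: nVx.
by rewrite -(mulVKg y x); have [_ + _] := hV; apply.
Qed.

End HaarFacts.

Section Module.
Context (R : realType) (T : topGroupType).
Hypothesis hs : hausdorff_space T.
Hypothesis base : forall N : set T, nbhs 1 N -> exists2 V, co_subgroup V & V `<=` N.
Local Open Scope ring_scope.
Local Open Scope ereal_scope.

Lemma haar_module : exists mu : {measure set (borel T) -> \bar R},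
  left_haar mu /\ forall b : caut T, (0 < module R b)%R /\
    forall A : set (borel T), mu (b @` A) = (module R b)%:E * mu A.
Proof.
have [W coW _] := base (@filterT _ (nbhs 1%g) _).
have [mu [haar hb]] := exists_left_haar hs base R coW.
exists mu; split=> // b; have [c c0 hc] := hb b.
suff -> : module R b = c by [].
rewrite /module; case: xgetP => [d _ [nu [nuhaar hd]]|/(_ c)[]]; last first.
  by exists mu; split=> // A _; exact: hc.
rewrite (haar_scaling_factor hs nuhaar coW hd).
by rewrite -(haar_scaling_factor hs haar coW (fun A _ => hc A)).
Qed.

End Module.

(** * Subgroups of direct sums *)

Section FreeSubgroup.
Local Open Scope ring_scope.

(** [well_ordering_principle] provides unique least elements; the order axioms follow by applying it
    to sets of two or three elements. *)
Lemma exists_well_order (I : choiceType) : exists R : rel I,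
  [/\ reflexive R, antisymmetric R, transitive R, total R &
    forall A : set I, A !=set0 -> exists2 m, A m & forall x, A x -> R m x].
Proof.
have [R wo] := well_ordering_principle I; exists R.
have min (A : set I) : A !=set0 -> exists2 m, A m & forall x, A x -> R m x.
  move=> [x Ax]; have [|m [[mA mlb] _]] := wo [pred x | `[< A x >]].
    by exists x; exact: (asboolT Ax).
  exists m; first exact: (asboolW mA).
  by move=> y Ay; exact: (mlb y (asboolT Ay)).
have tot : total R.
  move=> x y; have [|m [->|->] h] := min [set x; y]; first by exists x; left.
    by rewrite h//; right.
  by rewrite (h x) ?orbT//; left.
have refl : reflexive R by move=> x; have := tot x x; rewrite orbb.
have anti : antisymmetric R.
  move=> x y /andP[xy yx].
  have [|m [_ um]] := wo [pred z | (z == x) || (z == y)].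
    by exists x; rewrite inE eqxx.
  rewrite -(um x); last first.
    split; first by rewrite inE eqxx.
    by move=> z; rewrite inE => /orP[] /eqP ->.
  apply: um; split; first by rewrite inE eqxx orbT.
  by move=> z; rewrite inE => /orP[] /eqP ->.
split=> // y x z xy yz.
have [|m mem h] := min [set x; y; z]; first by exists x; left; left.
case: mem h => [[->|->]|->] h.
- by apply: h; right.
- have e : x = y by apply: anti; rewrite xy h//; left; left.
  by rewrite e.
- have e : z = y by apply: anti; rewrite yz h//; left; right.
  by rewrite e.
Qed.

Lemma exists_maximum (I : choiceType) (R : rel I) (A : set I) :
  transitive R -> total R -> finite_set A -> A !=set0 ->
  exists2 m, A m & forall x, A x -> R x m.
Proof.
move=> tr tot fA [x0 Ax0].
have key (s : seq I) : s != [::] -> exists2 m, m \in s & forall x, x \in s -> R x m.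
  elim: s => // y [_ _|z s IH _].
    exists y; first exact: mem_head.
    by move=> x; rewrite inE => /eqP ->; have := tot y y; rewrite orbb.
  have [//|m ms hm] := IH.
  have [ym|my] := orP (tot y m).
    exists m; first by rewrite in_cons ms orbT.
    by move=> x; rewrite in_cons => /predU1P[->//|]; exact: hm.
  exists y; first exact: mem_head.
  move=> x; rewrite in_cons => /predU1P[->|xs]; first by have := tot y y; rewrite orbb.
  exact: tr (hm x xs) my.
have [|m ms hm] := key (fset_set A).
  apply/eqP => e; have h : x0 \in fset_set A by rewrite in_fset_set// inE.
  have : x0 \in enum_fset (fset_set A) by [].
  by rewrite e.
exists m; first by move: ms; rewrite in_fset_set// inE.
by move=> x Ax; apply: hm; rewrite in_fset_set// inE.
Qed.

Lemma int_subgroup_gen (S : set int) : S 0 -> (forall x y, S x -> S y -> S (x - y)) ->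
  exists2 g, S g & forall z, S z -> exists k : int, z = k * g.
Proof.
move=> S0 SB.
have SN x : S x -> S (- x) by move=> Sx; rewrite -sub0r; exact: SB.
have SD x y : S x -> S y -> S (x + y).
  by move=> Sx Sy; rewrite -[y]opprK; apply: SB => //; exact: SN.
have SM (k : int) x : S x -> S (k * x).
  move=> Sx; have Sn n : S (n%:Z * x).
    by elim: n => [|n IH]; rewrite ?mul0r// -addn1 PoszD mulrDl mul1r; exact: SD.
  by case: k => n; rewrite ?NegzE ?mulNr//; exact: SN.
have [[x [Sx x0]]|nex] := pselect (exists x, S x /\ x != 0); last first.
  exists 0 => // z Sz; exists 0; rewrite mul0r; apply: contrapT => /eqP z0.
  by apply: nex; exists z.
have ex : exists n : nat, `[< S n.+1%:Z >].
  exists `|x|%N.-1; apply/asboolP; rewrite prednK ?absz_gt0// abszE.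
  by case: (ler0P x) => _ //; exact: SN.
case: (ex_minnP ex) => n /asboolP Sn hn.
exists n.+1%:Z => // z Sz; exists (z %/ n.+1%:Z)%Z.
have Sr : S (z %% n.+1%:Z)%Z by rewrite /modz; apply: SB => //; exact: SM.
have r0 : (0 <= (z %% n.+1%:Z)%Z) by rewrite modz_ge0.
have rn : ((z %% n.+1%:Z)%Z < n.+1%:Z) by rewrite ltz_mod.
rewrite {1}(divz_eq z n.+1%:Z); case: (_ %% _)%Z r0 rn Sr => // -[|m] _ mn Sm.
  by rewrite addr0.
by have := hn m (asboolT Sm); move: mn; rewrite ltz_nat ltnS; lia.
Qed.

(* Dedekind's argument: along a well-ordering of the index set, the elements
   of [B] with generating leading coefficients form a basis of [B]. *)
Theorem direct_sum_subgroup_free (I : choiceType) (B : set (I -> int)) :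
  B `<=` direct_sum I -> B 0 -> (forall x y, B x -> B y -> B (x - y)) ->
  exists (J : choiceType) (phi : (J -> int) -> (I -> int)),
    [/\ forall m n, direct_sum J m -> direct_sum J n -> phi (m + n) = phi m + phi n,
      forall m, direct_sum J m -> B (phi m),
      forall b, B b -> exists2 m, direct_sum J m & phi m = b &
      forall m, direct_sum J m -> phi m = 0 -> m = 0].
Proof.
move=> BI B0 BB; have [R [refl anti tr tot wf]] := exists_well_order I.
have BN b : B b -> B (- b) by move=> Bb; rewrite -sub0r; exact: BB.
have BD b c : B b -> B c -> B (b + c).
  by move=> Bb Bc; rewrite -[c]opprK; apply: BB => //; exact: BN.
have BM (k : int) b : B b -> B (fun i => k * b i).
  move=> Bb; have Bn n : B (fun i => n%:Z * b i).
    elim: n => [|n IH].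
      by rewrite (_ : (fun _ => _) = 0)//; apply/funext => i; rewrite mul0r.
    rewrite (_ : (fun _ => _) = (fun i => n%:Z * b i) + b); first exact: BD.
    by apply/funext => i; rewrite -addn1 PoszD mulrDl mul1r.
  case: k => n; first exact: Bn.
  rewrite (_ : (fun _ => _) = - (fun i => n.+1%:Z * b i)); first exact: BN.
  by apply/funext => i; rewrite NegzE mulNr.
pose below i (b : I -> int) := forall k, b k <> 0 -> R k i.
(* The [i]-th coefficients of the elements of [B] supported below [i] form a subgroup of the
   integers, and [b i] realizes a generator. Indices where this generator is [0] are left out of
   [J]. *)
have lead i : exists b, [/\ B b, below i b &
    forall c, B c -> below i c -> exists k : int, c i = k * b i].
  have [||_ [b [Bb bi] <-] hg] := @int_subgroup_gen [set b i | b in [set b | B b /\ below i b]].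
  - by exists 0 => //; split.
  - move=> _ _ [b [Bb bi] <-] [c [Bc ci] <-]; exists (b - c) => //; split; first exact: BB.
    move=> k; rewrite -[(b - c) k]/(b k - c k) => nk.
    have [e|n] := eqVneq (b k) 0; last by apply: bi; apply/eqP.
    by apply: ci => e'; apply: nk; rewrite e e' subr0.
  - exists b; split=> // c Bc ci; apply: hg; by exists c.
have [b hb] := choice lead.
pose J := {i : I | b i i != 0}.
pose supp (m : J -> int) : set J := [set j | m j <> 0].
pose phi (m : J -> int) : I -> int :=
  fun i => \sum_(j <- fset_set (supp m)) m j * b (val j) i.
have phiE (m : J -> int) (S : {fset J}) i : finite_set (supp m) ->
    (fset_set (supp m) `<=` S)%fset -> phi m i = \sum_(j <- S) m j * b (val j) i.
  move=> fm mS; apply: big_fset_incl => // j _; rewrite in_fset_set//.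
  by rewrite notin_setE => /contrapT ->; rewrite mul0r.
have phiD m n : direct_sum J m -> direct_sum J n -> phi (m + n) = phi m + phi n.
  move=> fm fn; apply/funext => i; rewrite -[RHS]/(phi m i + phi n i).
  have fmn : finite_set (supp (m + n)).
    apply: (@sub_finite_set _ _ (supp m `|` supp n)); last by rewrite finite_setU.
    move=> j; rewrite /supp /= -[(m + n) j]/(m j + n j) => h.
    have [e|ne] := eqVneq (m j) 0; last by left; apply/eqP.
    by right => e'; apply: h; rewrite e e' addr0.
  pose mn := m + n.
  pose S := (fset_set (supp m) `|` fset_set (supp n) `|` fset_set (supp mn))%fset.
  rewrite (phiE _ S)//; last by rewrite fsubsetUr.
  rewrite (phiE m S)//; last by rewrite /S -fsetUA fsubsetUl.
  rewrite (phiE n S)//; last by rewrite /S fsetUAC fsubsetUr.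
  rewrite -big_split /=; apply: eq_bigr => j _.
  by rewrite -mulrDl.
have phiB m : direct_sum J m -> B (phi m).
  move=> fm; rewrite (_ : phi m = \sum_(j <- fset_set (supp m)) (fun i => m j * b (val j) i)).
    elim/big_ind : _ => // j _; apply: BM; by case: (hb (val j)).
  apply/funext => i; rewrite /phi; elim/big_rec2 : _ => // j y z _ ->.
  by [].
(* the leading coefficient of [phi m] *)
have top m : direct_sum J m -> m <> 0 -> exists j : J, phi m (val j) <> 0.
  move=> fm m0.
  have [j mj] : exists j, m j <> 0.
    apply: contrapT => /forallNP h; apply: m0; apply/funext => j; exact: contrapT (h j).
  have [|||j' mj' hj'] := @exists_maximum J (fun x y : J => R (val x) (val y)) (supp m) _ _ fm.
  - by move=> x y z; exact: tr.
  - by move=> x y; exact: tot.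
  - by exists j.
  exists j'; have jS : j' \in fset_set (supp m) by rewrite in_fset_set// inE.
  rewrite /phi (big_fsetD1 j' jS) /= big_seq big1.
    rewrite addr0 => /eqP; rewrite mulf_eq0 => /orP[/eqP//|].
    by have /negPf -> := valP j'.
  move=> k; rewrite !inE in_fset_set// => /andP[kj /set_mem mk].
  have [_ bk _] := hb (val k).
  have [->|nz] := eqVneq (b (val k) (val j')) 0; first by rewrite mulr0.
  have := bk (val j') (elimN eqP nz).
  have := hj' k mk => h1 h2.
  by case/eqP: kj; apply/val_inj/anti; rewrite h1.
exists J, phi; split=> //; last first.
  by move=> m fm e; apply: contrapT => /(top m fm)[j]; rewrite e.
(* Leading indices of elements outside the image. At the least one, a multiple of [b i] cancels the
   leading coefficient; the difference is still outside the image and has a smaller leading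
   index. *)
pose bad i := exists c, [/\ B c, below i c, c i <> 0 & ~ exists2 m, direct_sum J m & phi m = c].
have phi0 : phi 0 = 0.
  apply/funext => i; rewrite (phiE 0 fset0) ?big_seq_fset0//.
    rewrite (_ : supp 0 = set0); first exact: finite_set0.
    by apply/seteqP; split=> // j.
  rewrite (_ : supp 0 = set0) ?fset_set0//.
  by apply/seteqP; split=> // j.
have d0 : direct_sum J 0.
  rewrite /direct_sum /= (_ : [set i | _] = set0); first exact: finite_set0.
  by apply/seteqP; split=> // j.
have toptop c : B c -> c <> 0 -> exists i, below i c /\ c i <> 0.
  move=> Bc c0; have [|i ci hi] := exists_maximum tr tot (BI c Bc).
    apply: contrapT => h; apply: c0; apply/funext => i; apply: contrapT => ci.
    by apply: h; exists i.
  by exists i.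
have nobad i : ~ bad i.
  move=> bi; have [|i0 [c [Bc ci ci0 nc]] hmin] := wf bad; first by exists i.
  have [Bb bb hk] := hb i0; have [k ck] := hk c Bc ci.
  have bi0 : b i0 i0 != 0 by apply/eqP => e; apply: ci0; rewrite ck e mulr0.
  pose j0 : J := exist _ i0 bi0.
  pose m0 : J -> int := fun j => if j == j0 then k else 0.
  have s0 : supp m0 `<=` [set j0] by move=> j; rewrite /supp /m0 /=; case: eqP.
  have fm0 : direct_sum J m0 by apply: sub_finite_set s0 _; exact: finite_set1.
  have phim0 : phi m0 = (fun i => k * b i0 i).
    apply/funext => x; rewrite (phiE m0 [fset j0]%fset)//.
      by rewrite big_seq_fset1 /m0 eqxx.
    by apply/fsubsetP => j; rewrite in_fset_set// inE => /s0 ->; rewrite inE.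
  pose d := c - phi m0.
  have Bd : B d by apply: BB => //; exact: phiB.
  have nd : ~ exists2 m, direct_sum J m & phi m = d.
    move=> [m fm pm]; apply: nc; exists (m + m0); last by rewrite phiD// pm /d subrK.
    apply: (@sub_finite_set _ _ (supp m `|` supp m0)); last by rewrite finite_setU.
    move=> j; rewrite /supp /= -[(m + m0) j]/(m j + m0 j) => h.
    have [e|ne] := eqVneq (m j) 0; last by left; apply/eqP.
    by right => e'; apply: h; rewrite e e' addr0.
  have d_i0 : d i0 = 0.
    by rewrite /d -[(c - phi m0) i0]/(c i0 - phi m0 i0) phim0 -ck subrr.
  have [|i1 [bi1 di1]] := toptop d Bd.
    by move=> e; apply: nd; exists 0; rewrite ?phi0.
  have i10 : R i1 i0.
    have [e|ne] := eqVneq (c i1) 0; last by apply: ci; apply/eqP.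
    apply: bb => e'; apply: di1.
    by rewrite /d -[(c - phi m0) i1]/(c i1 - phi m0 i1) phim0 e e' mulr0 subr0.
  have : bad i1 by exists d.
  move=> /hmin i01; apply: di1.
  by have -> : i1 = i0 by apply: anti; rewrite i10.
move=> c Bc; apply: contrapT => nc.
have [|i [bi ci]] := toptop c Bc.
  by move=> e; apply: nc; exists 0; rewrite ?phi0.
by apply: (nobad i); exists c.
Qed.

End FreeSubgroup.

(** * Roots *)

Section FlatTidy.
Context (G : topGroupType).

Lemma compact_open_co_subgroup (U : subgroup G) :
  compact_open_subgroup U -> co_subgroup (U : set G).
Proof. by move=> [cU oU]; split=> //; exact: subgroupP. Qed.

(** Two elements of the group [a(U)] congruent modulo [U] are congruent modulo the intersection, so
    it is enough to count the cosets of [U] that meet [a(U)]. *)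
Lemma displacement_indexE (a : caut G) (U : subgroup G) : compact_open_subgroup U ->
  displacement_index a U = coset_index (act a U) U.
Proof.
move=> /compact_open_co_subgroup coU; have [hU cU oU] := coU.
rewrite /displacement_index image_act.
have hact := act_subgroup a hU.
have hI : is_subgroup (act a U `&` U).
  have [h1 hM hI] := hU; have [k1 kM kI] := hact; split=> //.
    by move=> x y [? ?] [? ?]; split; [exact: kM|exact: hM].
  by move=> x [? ?]; split; [exact: kI|exact: hI].
have [||] // := coset_index_eq hU hI _ _ (act_cosets_finite a coU coU).
by move=> x y ax ay Uxy; split=> //; have [_ + kI] := hact; apply=> //; exact: kI.
Qed.

Lemma scale_le (a : caut G) (U V : subgroup G) : tidy a U -> compact_open_subgroup V ->
  (displacement_index a U <= displacement_index a V)%N.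
Proof.
move=> [coU ->] coV.
have ex : exists n,
    `[< exists2 U : subgroup G, compact_open_subgroup U & displacement_index a U = n >].
  by exists (displacement_index a U); apply/asboolP; exists U.
case: (ex_minnP ex) => m /asboolP hm hmin.
rewrite /scale; case: xgetP => [n _ [_ hn]|/(_ m)[]]; first exact: hn.
by split=> // W coW; apply: hmin; apply/asboolP; exists W.
Qed.

Lemma tidy_minimal (a : caut G) (U : subgroup G) : tidy a U -> forall V, co_subgroup V ->
  (coset_index (act a U) U <= coset_index (act a V) V)%N.
Proof.
move=> tU V [hV cV oV]; have coV : compact_open_subgroup (to_subgroup hV).
  by split; rewrite to_subgroupE.
by have := scale_le tU coV; rewrite !displacement_indexE// ?to_subgroupE//; case: tU.
Qed.

Lemma tidy_scale (a : caut G) (U : subgroup G) : tidy a U ->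
  scale a = coset_index (act a U) U.
Proof. by move=> [coU <-]; rewrite displacement_indexE. Qed.

Lemma uniscalar_act (a : caut G) (U : subgroup G) : tidy a U -> tidy a^-1 U ->
  (scale a = 1%N /\ scale a^-1 = 1%N) <-> act a U = U.
Proof.
move=> tU tV; rewrite (tidy_scale tU) (tidy_scale tV).
have [/compact_open_co_subgroup coU _] := tU; have [hU _ _] := coU.
split=> [[s1 s2]|e].
  apply/seteqP; split; first exact: (coset_index1_sub coU s1).
  by move=> x Ux; rewrite actE; apply: (coset_index1_sub coU s2); apply/actV; rewrite cautKV.
have e' : act a^-1 U = U by rewrite -{1}e -act_mul mulVg act1.
by rewrite e e'; have [_ ->] := coset_index_self hU.
Qed.

End FlatTidy.

Section StableSubgroup.
Context (R : realType) (G : topGroupType) (HH : subgroup (caut G)) (L : subgroup G).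
Hypotheses (hs : hausdorff_space G) (cL : closed (L : set G)) (st : stable HH L).
Hypothesis base : forall N : set G, nbhs 1 N -> exists2 V, co_subgroup V & V `<=` N.
Local Notation pre K := ((val : sgType L -> G) @^-1` K).
Implicit Types a b : sgType HH.

Lemma restrict_image (c : caut G) (cS : c @` (L : set G) = L) (A : set G) :
  caut_restrict cS @` pre A = pre (act c A).
Proof.
apply/seteqP; split=> [_ [x Ax <-]|x cx]; first by apply/actP.
have Lx : sg_set L (c^-1 (val x)).
  have : (c @` (L : set G)) (val x) by rewrite cS; exact: sg_valP.
  by move=> [y Ly <-]; rewrite cautVKg.
by exists (sg_elt Lx) => //; apply: val_inj; rewrite /= cautKV.
Qed.

(** The same number as [module_on], but defined from stability alone, so that it can be used before
    the group is known to be scaling. *)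
Definition stable_module a : R := module R (caut_restrict (st (sg_valP a))).

Lemma stable_haar : exists mu : ({measure set (borel (sgType L)) -> \bar R})%R,
  left_haar mu /\ forall a, (0 < stable_module a)%R /\
    forall A : set G, mu (pre (act (val a) A)) = ((stable_module a)%:E * mu (pre A))%E.
Proof.
have [mu [haar hm]] := haar_module R (sg_hausdorff hs) (sg_base cL base).
exists mu; split=> // a; have [m0 hA] := hm (caut_restrict (st (sg_valP a))).
split=> // A; apply: etrans (hA (pre A)); congr (mu _); exact/esym/restrict_image.
Qed.

Lemma stable_haar_le (mu : ({measure set (borel (sgType L)) -> \bar R})%R) (A B : set G) :
  left_haar mu -> co_subgroup (pre A) -> co_subgroup (pre B) -> A `<=` B -> A `<=` L ->
  B `<=` L -> (mu (pre B) <= mu (pre A))%E -> A = B.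
Proof.
move=> haar coA coB AB AL BL le.
have E := haar_subgroup_eq (sg_hausdorff hs) haar coA coB (fun x => AB (val x)) le.
apply/seteqP; split=> // x Bx.
have : pre B (sg_elt (BL x Bx)) by [].
by rewrite -E.
Qed.

Lemma stable_moduleM a b : stable_module (a * b) = (stable_module a * stable_module b)%R.
Proof.
have [mu [haar hm]] := stable_haar.
have [V coV _] := base (@filterT _ (nbhs 1%g) _).
have coW := pre_co_subgroup cL coV; have [_ cW _] := coW.
have W0 := haar_gt0 (sg_hausdorff hs) haar coW.
have fW : mu (pre V) \is a fin_num by rewrite ge0_fin_numE ?haar_lt_pinfty// ltW.
have [_ hab] := hm (a * b); have [_ ha] := hm a; have [_ hb] := hm b.
have := hab V; rewrite act_mul ha hb -(fineK fW) -!EFinM => -[].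
have f0 : (0 < fine (mu (pre V)))%R by rewrite fine_gt0// W0 -ge0_fin_numE// ltW.
by rewrite mulrA => /(mulIf (lt0r_neq0 f0)).
Qed.

End StableSubgroup.

Section Roots.
Context (R : realType) (G : topGroupType) (HH : subgroup (caut G)) (U : set G).
Hypotheses (hs : hausdorff_space G) (coU : co_subgroup U).
Hypothesis base : forall N : set G, nbhs 1 N -> exists2 V, co_subgroup V & V `<=` N.
Hypothesis tidyU : forall a, sg_set HH a -> tidy_for a U.
Hypothesis commU : forall a b, sg_set HH a -> sg_set HH b -> act [~ a, b] U = U.
Implicit Types (a b c : caut G).
Local Notation pre K := (val @^-1` K).

Let hH : is_subgroup (HH : set (caut G)) := subgroupP HH.

Section OneRoot.
Variable rho : sgType HH -> int.
Hypothesis root : flat_root R rho.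

Lemma root_haar : exists (L : subgroup G) (_ : scaling_subgroup HH L) (s : R),
  (1 < s)%R /\ exists mu : ({measure set (borel (sgType L)) -> \bar R})%R,
    left_haar mu /\ forall (a : sgType HH) (A : set G),
      mu (pre (act (val a) A)) = ((s ^ rho a)%R%:E * mu (pre A))%E.
Proof.
have [_ _ [L [sL [s [s1 hm]]]]] := root; exists L, sL, (s%:~R)%R; split; first by rewrite ltr1z.
have [mu [haar h]] := stable_haar R hs (scaling_closed sL) (scaling_stable sL) base.
exists mu; split=> // a A; have [_ ->] := h a; congr (_ * _)%E; congr EFin.
by rewrite -hm.
Qed.

(** The trace of [U] on the scaling subgroup has finite positive measure, which [a] leaves unchanged
    and also multiplies by [s ^ rho a]. *)
Lemma root_act_eq (a : sgType HH) : act (val a) U = U -> rho a = 0%R.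
Proof.
have [L [sL [s [s1 [mu [haar hmu]]]]]] := root_haar => e.
have coP := pre_co_subgroup (scaling_closed sL) coU; have [_ cP _] := coP.
have P0 := haar_gt0 (sg_hausdorff hs) haar coP.
have fP : mu (pre U) \is a fin_num by rewrite ge0_fin_numE ?haar_lt_pinfty// ltW.
have := hmu a U; rewrite e -(fineK fP) -EFinM => -[].
have f0 : (0 < fine (mu (pre U)))%R by rewrite fine_gt0// P0 -ge0_fin_numE// ltW.
rewrite -{1}[fine _]mul1r => /(mulIf (lt0r_neq0 f0)) e1.
have s0 : (0 < s)%R := lt_trans ltr01 s1.
by apply: (ieexprIz s0 _); rewrite ?(gt_eqF s1)// -e1 expr0z.
Qed.

(** The value [0] outside [HH] is a convention: the finiteness results are stated for functions on
    all automorphisms. *)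
Definition extend_root (b : caut G) : int :=
  if pselect (sg_set HH b) is left Hb then rho (sg_elt Hb) else 0%R.

Lemma extend_rootE (b : sgType HH) : extend_root (val b) = rho b.
Proof.
rewrite /extend_root; case: pselect => [Hb|]; last by case; exact: sg_valP.
by congr rho; apply: val_inj.
Qed.

Lemma extend_rootM a b : sg_set HH a -> sg_set HH b ->
  extend_root (a * b) = (extend_root a + extend_root b)%R.
Proof.
move=> Ha Hb; have [rM _ _] := root.
have := rM (sg_elt Ha) (sg_elt Hb).
by rewrite -!extend_rootE.
Qed.

Lemma extend_root_act a : sg_set HH a -> act a U = U -> extend_root a = 0%R.
Proof.
move=> Ha e; have -> : a = val (sg_elt Ha) by [].
by rewrite extend_rootE; exact: root_act_eq.
Qed.

Lemma extend_root1 : exists2 a, sg_set HH a & extend_root a = 1%R.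
Proof.
have [_ rT _] := root; have : range rho 1%R by rewrite rT.
by move=> [a _ <-]; exists (val a); [exact: sg_valP|exact: extend_rootE].
Qed.

(* [U] meets the scaling subgroup in a subgroup of [V := meetU U (nneg ..)],
   by [traps]; so [V] is open in the scaling subgroup, and its Haar measure
   would grow under [a] if [a] mapped [V] into [U], hence into itself. *)
Lemma root_pos_expands a : sg_set HH a -> (0 < extend_root a)%R ->
  ~ (act a (meetU U (nneg HH extend_root)) `<=` U).
Proof.
move=> Ha ra sub.
have [L [sL [s [s1 [mu [haar hmu]]]]]] := root_haar.
have cL := scaling_closed sL; have st := scaling_stable sL.
have hsL := sg_hausdorff (L := L) hs.
have s0 : (0 < s)%R := lt_trans ltr01 s1.
have [W [WL cW [N oN WE] chain _]] := scaling_base sL.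
have gN := good_nneg hH extend_rootM extend_root_act.
have N1 := good1 hH gN.
set V := meetU U (nneg HH extend_root) in sub *.
have actL b (A : set G) : sg_set HH b -> A `<=` L -> act b A `<=` L.
  move=> Hb AL x bx; rewrite -(st b Hb) image_act actE; exact: AL.
have hmu' b (A : set G) : sg_set HH b ->
    mu (pre (act b A)) = ((s ^ extend_root b)%R%:E * mu (pre A))%E.
  by move=> Hb; have := hmu (sg_elt Hb) A; rewrite -extend_rootE.
have coW : co_subgroup (pre W : set (sgType L)).
  split; [exact/pre_subgroup/subgroupP|exact: pre_compact|].
  rewrite (_ : pre W = pre N); first exact: pre_open.
  apply/seteqP; split=> x; first by rewrite /= WE => -[].
  by move=> Nx; rewrite /= WE; split=> //; exact: sg_valP.
(* If instead [W] lies in [b^-1(W)], the latter has [s ^ (- rho b)] times the measure of [W], which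
   is not larger, so the two groups are equal. *)
have shrink b : nneg HH extend_root b -> act b^-1 W `<=` W.
  move=> [Hb rb]; have HbV : sg_set HH b^-1 by exact: sgV.
  have [|] := chain _ HbV; rewrite image_act => // WbW.
  have cobW : co_subgroup (pre (act b^-1 W) : set (sgType L)).
    split; first exact/pre_subgroup/act_subgroup/subgroupP.
      exact/pre_compact/act_compact.
    rewrite (_ : pre _ = pre (act b^-1 N)); first exact/pre_open/act_open.
    apply/seteqP; split=> x; rewrite /= !actE WE; first by case.
    move=> Nx; split=> //; move: (sg_valP x); rewrite -{1}(st _ HbV) image_act.
    by rewrite actE.
  rewrite -(stable_haar_le hs haar coW cobW WbW WL)//; first exact: actL.
  rewrite hmu'// -[leRHS]mul1e lee_wpmul2r//.
  rewrite lee_fin (rhoV hH extend_rootM extend_root_act)//.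
  by rewrite -(expr0z s) ler_eXz2l// oppr_le0.
have WUV : U `&` W `<=` V.
  move=> x [Ux Wx] b Nb; have [Hb _] := Nb.
  have [_ _ _ tb] := tidyU Hb.
  apply: (tb x Ux _ 1%N); exists W => // n.
  elim: n => [//|n IH]; rewrite expgSg; apply: (shrink b Nb).
  by rewrite actE cautVKg.
have hV : is_subgroup V := meetU_subgroup coU _.
have coUW : co_subgroup (pre (U `&` W) : set (sgType L)).
  exact: co_subgroupI (pre_co_subgroup cL coU) coW.
have coV : co_subgroup (pre V : set (sgType L)).
  split; first exact: pre_subgroup.
    exact: pre_compact (meetU_compact coU N1).
  apply: nbhs1_open; first exact: pre_subgroup.
  have [[u1 _ _] _ oUW] := coUW.
  apply: filterS (open_nbhs_nbhs (conj oUW u1)) => x; exact: WUV.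
have VV := good_capV hH coU tidyU commU gN Ha sub.
have V0 := haar_gt0 hsL haar coV; have [_ cV _] := coV.
have fV : mu (pre V) \is a fin_num by rewrite ge0_fin_numE ?haar_lt_pinfty// ltW.
have f0 : (0 < fine (mu (pre V)))%R by rewrite fine_gt0// V0 -ge0_fin_numE// ltW.
have : (mu (pre (act a V)) <= mu (pre V))%E.
  apply: le_measure; rewrite ?inE.
  - apply: borel_closed; apply: closed_pre; first exact: sg_val_continuous.
    by apply: act_closed => x; exact: (meetU_closed coU).
  - by apply: borel_open; case: coV.
  - by move=> x; exact: VV.
rewrite hmu'// -(fineK fV) -EFinM lee_fin ger_pMl// leNgt => /negP; apply.
by rewrite -(expr0z s) ltr_eXz2l.
Qed.

End OneRoot.

End Roots.

(** * Homomorphisms whose values are integers or inverses of integers *)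

Section DiscreteHomomorphism.
Local Open Scope ring_scope.

(** Let [s] be the least integer value above [1], taken at [g]. If [x] has an integer value
    [n >= s], then the value [n / s] at [x g^-1] is either a smaller integer, to which induction
    applies, or the inverse of an integer, which forces [n = s]. *)
Lemma discrete_hom (R : realType) (Gam : groupType) (c : Gam -> R) :
  (forall x, 0 < c x) -> (forall x y, c (x * y)%g = c x * c y) ->
  (forall x, (exists n : nat, c x = n%:R) \/ exists n : nat, c x^-1%g = n%:R) ->
  (exists x, c x != 1) ->
  exists (s : nat) (rho : Gam -> int),
    [/\ (1 < s)%N, hom_to_additive rho, range rho = setT & forall x, c x = s%:R ^ rho x].
Proof.
move=> c0 cM cn [x0 nx0].
have c1 : c 1%g = 1.
  by apply: (mulfI (lt0r_neq0 (c0 1%g))); rewrite -cM mulg1 mulr1.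
have cV x : c x^-1%g = (c x)^-1.
  apply: (mulfI (lt0r_neq0 (c0 x))); rewrite -cM mulgV c1 divff// lt0r_neq0//.
have big : exists n, `[< (1 < n)%N /\ exists x, c x = n%:R >].
  have key x n : c x != 1 -> c x = n%:R -> exists n, `[< (1 < n)%N /\ exists x, c x = n%:R >].
    move=> nx e; exists n; apply/asboolP; split; last by exists x.
    by have := c0 x; move: nx; rewrite e; case: n {e} => [|[|n]]; rewrite ?ltxx ?eqxx.
  have [[n e]|[n e]] := cn x0; first exact: key e.
  by apply: key e; rewrite cV invr_eq1.
case: (ex_minnP big) => s /asboolP[s1 [g gs]] smin.
have s0 : (0 : R) < s%:R by rewrite ltr0n ltnW.
have pos n x : c x = n%:R -> exists z : int, c x = s%:R ^ z.
  elim/ltn_ind: n x => n IH x e.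
  have [n1|n1] := leqP n 1.
    exists 0; rewrite expr0z e; have := c0 x; rewrite e.
    by case: n n1 {IH e} => [|[|n]]; rewrite ?ltxx.
  have sn : (s <= n)%N by apply: smin; apply/asboolP; split=> //; exists x.
  have e' : c (x * g^-1)%g = n%:R / s%:R by rewrite cM cV e gs.
  have xE : c x = c (x * g^-1)%g * s%:R by rewrite -gs -cM mulgVK.
  have [[m em]|[m em]] := cn (x * g^-1)%g.
    have [|z ez] := IH m _ _ em.
      rewrite -(ltr_nat R) -em e' ltr_pdivrMr// -natrM ltr_nat.
      by rewrite -{1}[n]muln1 ltn_pmul2l// ltnW.
    by exists (z + 1); rewrite exprzDr ?expr1z -?ez// unitfE lt0r_neq0.
  exists 1; rewrite expr1z e; suff -> : n = s by [].
  apply/eqP; rewrite eqn_leq sn andbT -(ler_nat R).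
  have : (1 : R) <= c (x * g^-1)^-1%g.
    by have := c0 (x * g^-1)^-1%g; rewrite em ltr0n ler1n.
  by rewrite cV e' invf_div ler_pdivlMr ?mul1r// ltr0n ltnW.
have /choice[rho hrho] : forall x, exists z : int, c x = s%:R ^ z.
  move=> x; have [[n e]|[n e]] := cn x; first exact: pos e.
  have [z ez] := pos _ _ e; exists (- z).
  by rewrite -[x]invgK cV ez invr_expz.
have inj : injective (exprz (s%:R : R)).
  by apply: ieexprIz => //; rewrite gt_eqF// ltr1n.
have hom : hom_to_additive rho.
  move=> x y; apply: inj; rewrite -hrho cM !hrho exprzDr//.
  by rewrite unitfE lt0r_neq0.
have rg : rho g = 1 by apply: inj; rewrite -hrho gs expr1z.
have r1 : rho 1%g = 0 by apply: inj; rewrite -hrho c1 expr0z.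
have rV x : rho x^-1%g = - rho x.
  by apply/eqP; rewrite -addr_eq0 -hom mulVg r1.
have rX n : rho (g ^+ n)%g = n%:Z.
  by elim: n => [|n IH]; rewrite ?expg0// expgS hom IH rg -PoszD add1n.
exists s, rho; split=> //; apply/seteqP; split=> // z _.
case: z => n; first by exists (g ^+ n)%g.
by exists (g ^+ n.+1)^-1%g => //; rewrite rV rX NegzE.
Qed.

End DiscreteHomomorphism.

(** * A scaling subgroup and a root from a maximal monoid *)

Section RootExistence.
Context (R : realType) (G : topGroupType) (HH : subgroup (caut G)) (U : set G).
Hypotheses (hs : hausdorff_space G) (coU : co_subgroup U).
Hypothesis base : forall N : set G, nbhs 1 N -> exists2 V, co_subgroup V & V `<=` N.
Hypothesis tidyU : forall a, sg_set HH a -> tidy_for a U.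
Hypothesis commU : forall a b, sg_set HH a -> sg_set HH b -> act [~ a, b] U = U.
Implicit Types (a b c : caut G).
Local Notation pre K := (val @^-1` K).

Let hH : is_subgroup (HH : set (caut G)) := subgroupP HH.

Section Translates.
Variable M : set (caut G).
Hypotheses (gM : good HH U M) (totM : forall g, sg_set HH g -> M g \/ M g^-1).
Let W := meetU U M.

Definition translates : set G := [set x | exists2 b, sg_set HH b & act b W x].

Let M1 : M 1 := good1 hH gM.
Let hW : is_subgroup W := meetU_subgroup coU M.

Let chain b c : sg_set HH b -> sg_set HH c ->
  act b W `<=` act c W \/ act c W `<=` act b W.
Proof.
move=> Hb Hc; have Hbc : sg_set HH (b^-1 * c) by apply: sgM => //; exact: sgV.
have [Mbc|Mbc] := totM Hbc.
  left=> x bx; rewrite -[c](mulVKg b) act_mul.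
  exact: good_act_sup gM Mbc _ bx.
right=> x; rewrite -{1}[c](mulVKg b) act_mul => bx.
by apply: good_act_subV gM Mbc _ _; rewrite invgK; exact: bx.
Qed.

Lemma translates_subgroup : is_subgroup translates.
Proof.
split; first by exists 1; [exact: sg1|case: (act_subgroup 1 hW)].
- move=> x y [b Hb bx] [c Hc cy]; have [bc|cb] := chain Hb Hc.
    by exists c => //; have [_ + _] := act_subgroup c hW; apply=> //; exact: bc.
  by exists b => //; have [_ + _] := act_subgroup b hW; apply=> //; exact: cb.
- by move=> x [b Hb bx]; exists b => //; have [_ _] := act_subgroup b hW; apply.
Qed.

Let L : subgroup G := to_subgroup translates_subgroup.

Let LE : (L : set G) = translates := to_subgroupE translates_subgroup.

Let WL : W `<=` L.
Proof. by move=> x Wx; rewrite LE; exists 1; [exact: sg1|rewrite act1]. Qed.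

Let UL : U `&` L = W.
Proof.
apply/seteqP; split=> [x [Ux]|x Wx]; last by split; [exact: meetU_sub M1 _ Wx|exact: WL].
by rewrite LE => -[b Hb bx]; exact: (good_cap hH coU tidyU commU gM Hb bx Ux).
Qed.

Lemma translates_stable : stable HH L.
Proof.
move=> a Ha; rewrite image_act LE; apply/seteqP; split=> x.
  rewrite actE => -[b Hb bx]; exists (a * b); first exact: sgM.
  by rewrite act_mul.
move=> [b Hb bx]; exists (a^-1 * b); first by apply: sgM => //; exact: sgV.
by rewrite act_mul actV cautKV.
Qed.

(** Translation by an element of [L] moves a point of the closure into the open group [U], where [L]
    coincides with the closed group [W]. *)
Lemma translates_closed : closed (L : set G).
Proof.
have [[u1 uM uV] cU oU] := coU.
have hL := subgroupP L; have [l1 lM lV] := hL.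
have [k1 kM kV] := closure_subgroup hL.
move=> x clx.
have [|l [Ll Ul]] := clx (left_coset x U).
  by apply: open_nbhs_nbhs; split; [exact: open_left_coset|exists 1; rewrite ?mulg1].
have {Ul} Ul : U (l^-1 * x).
  by case: Ul => u Uu <-; rewrite invgM mulgVK; exact: uV.
have clx' : closure (L : set G) (l^-1 * x).
  by apply: kM => //; apply: kV; exact: subset_closure.
suff Wx : W (l^-1 * x) by rewrite -[x](mulVKg l); apply: lM => //; exact: WL.
apply: (meetU_closed coU) => B /filterI-/(_ U)/(_ (open_nbhs_nbhs (conj oU Ul))) BU.
have [y [Ly [By Uy]]] := clx' _ BU.
by exists y; split=> //; rewrite -/W -UL.
Qed.

Local Notation c := (stable_module R translates_stable).

Let coW : co_subgroup (pre W : set (sgType L)).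
Proof.
have -> : pre W = pre U :> set (sgType L).
  apply/seteqP; split=> x; first by rewrite -UL /= => -[].
  by move=> Ux; rewrite /= -UL; split=> //; exact: sg_valP.
exact: (pre_co_subgroup translates_closed coU).
Qed.

Let actL b : sg_set HH b -> act b W `<=` L.
Proof. by move=> Hb x bx; rewrite LE; exists b. Qed.

Let coactW (b : sgType HH) : co_subgroup (pre (act (val b) W) : set (sgType L)).
Proof.
have st := translates_stable (sg_valP b).
rewrite -(restrict_image st) image_act; have [kW cW oW] := coW.
by split; [exact: act_subgroup|exact: act_compact|exact: act_open].
Qed.

(** For [b] in [M] the group [W] lies in [b(W)], and the module is the index [[b(W) : W]]. *)
Lemma translates_module_nat (b : sgType HH) : M (val b) -> exists n : nat, c b = n%:R%R.
Proof.
move=> Mb; have [mu [haar hm]] := stable_haar R hs translates_closed translates_stable base.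
have [_ hb] := hm b; have [hbW cbW obW] := coactW b.
exists (coset_index (pre (act (val b) W) : set (sgType L)) (pre W)).
have W0 := haar_gt0 (sg_hausdorff hs) haar coW; have [_ cW _] := coW.
have fW : mu (pre W) \is a fin_num by rewrite ge0_fin_numE ?haar_lt_pinfty// ltW.
have f0 : (0 < fine (mu (pre W)))%R by rewrite fine_gt0// W0 -ge0_fin_numE// ltW.
have := hb W; rewrite (haar_index haar cbW obW coW); last first.
  move=> x y bx Wy; have [_ + _] := hbW; apply=> //.
  exact: (good_act_sup gM Mb).
by rewrite -(fineK fW) -!EFinM => -[] /(mulIf (lt0r_neq0 f0)) ->.
Qed.

(** [W] and [b(W)] are comparable and have equal measure. *)
Lemma translates_module1 (b : sgType HH) : c b = 1%R -> act (val b) W = W.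
Proof.
move=> cb; have [mu [haar hm]] := stable_haar R hs translates_closed translates_stable base.
have [_ hb] := hm b; have e := hb W; rewrite cb mul1e in e.
have bL := actL (sg_valP b).
have [|] := chain (sg_valP b) (sg1 HH); rewrite act1 => sub.
  by apply: (stable_haar_le hs haar (coactW b) coW) => //; rewrite e.
by apply/esym/(stable_haar_le hs haar coW (coactW b)) => //; rewrite e.
Qed.

(** A compact [L] would have finite positive measure, which [a] preserves and also multiplies by
    [c a]. *)
Lemma translates_noncompact (a : sgType HH) : c a != 1%R -> ~ compact (L : set G).
Proof.
move=> ca cL; have [mu [haar hm]] := stable_haar R hs translates_closed translates_stable base.
have preL : pre L = [set: sgType L] by apply/seteqP; split=> // x _; exact: sg_valP.
have coL : co_subgroup (pre L : set (sgType L)).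
  rewrite preL; split; last exact: openT.
    by split.
  by rewrite -preL; exact: pre_compact translates_closed _ cL.
have L0 := haar_gt0 (sg_hausdorff hs) haar coL; have [_ cpL _] := coL.
have fL : mu (pre L) \is a fin_num by rewrite ge0_fin_numE ?haar_lt_pinfty// ltW.
have f0 : (0 < fine (mu (pre L)))%R by rewrite fine_gt0// L0 -ge0_fin_numE// ltW.
have [_ ha] := hm a; have := ha L.
rewrite -image_act (translates_stable (sg_valP a)) -(fineK fL) -EFinM => -[].
rewrite -{1}[fine _]mul1r => /(mulIf (lt0r_neq0 f0)) e.
by rewrite -e eqxx in ca.
Qed.

Lemma translates_root (a : sgType HH) : act (val a) W <> W ->
  exists2 rho, flat_root R rho & rho a <> 0%R.
Proof.
move=> aW; have ca : c a != 1%R by apply/eqP => /translates_module1.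
have sL : scaling_subgroup HH L.
  split; [exact: translates_closed|exact: translates_noncompact ca
    |exact: translates_stable|].
  exists (to_subgroup hW); rewrite to_subgroupE; split=> //.
  - exact: (meetU_compact coU M1).
  - by exists U; [case: coU|rewrite UL].
  - move=> b Hb; rewrite image_act.
    by have := chain Hb (sg1 HH); rewrite act1 => -[]; [right|left].
  - rewrite LE; apply/seteqP; split=> x.
      by move=> [b Hb bx]; exists b => //; rewrite image_act.
    by move=> [b Hb]; rewrite image_act => bx; exists b.
have [||||s [rho [s1 hom rT hc]]] := @discrete_hom R (sgType HH) c.
- by move=> b; have [mu [_ /(_ b)[]]] := stable_haar R hs translates_closed translates_stable base.
- exact: stable_moduleM hs translates_closed translates_stable base.
- move=> b; have [Mb|Mb] := totM (sg_valP b); [left|right]; exact: translates_module_nat.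
- by exists a.
exists rho; last by move=> ra; have := hc a; rewrite ra expr0z => e; rewrite e eqxx in ca.
split=> //; exists L, sL, (s%:Z)%R; split; first by rewrite ltz_nat.
move=> b; rewrite -pmulrn -hc /module_on /stable_module.
by congr (module R (caut_restrict _)); exact: Prop_irrelevance.
Qed.

End Translates.

Lemma exists_root (a : sgType HH) : act (val a) U <> U ->
  exists2 rho, flat_root R rho & rho a <> 0%R.
Proof.
have key (b : sgType HH) : ~ (act (val b) U `<=` U) ->
    exists2 rho, flat_root R rho & rho b <> 0%R.
  move=> nb; have [M [gM Mb nbM totM]] := maximal_good hH coU tidyU commU (sg_valP b) nb.
  apply: (translates_root gM totM) => e; apply: nbM; rewrite e.
  exact: meetU_sub (good1 hH gM).
(* If [a(U)] is a proper subgroup of [U], then [a^-1(U)] is not contained in [U], and a root found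
   for [a^-1] serves. *)
have [aU|] := pselect (act (val a) U `<=` U); last by move=> n _; exact: key.
move=> ne; have [|rho rr rV] := key a^-1.
  move=> aVU; apply: ne; apply/seteqP; split=> // x Ux.
  by rewrite actE; apply: aVU; apply/actV; rewrite cautKV.
exists rho => // ra; apply: rV; have [hom _ _] := rr.
have r1 : rho 1%g = 0%R by apply: (addIr (rho 1%g)); rewrite -hom mulg1 add0r.
by have := hom a^-1 a; rewrite mulVg r1 ra addr0.
Qed.

End RootExistence.

(** [direct_sum_subgroup_free] provides coordinates on the range of [f]; the isomorphism sends a
    coset to the coordinates of the common value of [f] on it. *)
Lemma quotient_free_abelian (Gam : groupType) (N : normal_subgroup Gam) (I : choiceType)
    (f : Gam -> I -> int) : hom_to_additive f -> range f `<=` direct_sum I ->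
  (forall x, f x = 0%R <-> (N : set Gam) x) -> free_abelian (quotient_group N).
Proof.
move=> hom fI ker.
have f1 : f 1 = 0%R by apply/ker; exact: sg1.
have fV x : f x^-1 = (- f x)%R.
  by apply: (addIr (f x)); rewrite -hom mulVg addNr.
have [|||J [phi [phiD phiB phiT phi0]]] := @direct_sum_subgroup_free I (range f).
- exact: fI.
- by exists 1.
- by move=> _ _ [x _ <-] [y _ <-]; exists (x * y^-1) => //; rewrite hom fV.
have d0 : direct_sum J 0%R.
  rewrite /direct_sum /= (_ : [set i | _] = set0); first exact: finite_set0.
  by apply/seteqP; split.
have dB m n : direct_sum J m -> direct_sum J n -> direct_sum J (m - n)%R.
  move=> dm dn; apply: (@sub_finite_set _ _ ([set j | m j <> 0%R] `|` [set j | n j <> 0%R])).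
    move=> j /= h; have [e|ne] := eqVneq (m j) 0%R; last by left; apply/eqP.
    by right => e'; apply: h; rewrite -[(m - n)%R j]/(m j - n j)%R e e' subr0.
  by rewrite finite_setU.
have dD m n : direct_sum J m -> direct_sum J n -> direct_sum J (m + n)%R.
  move=> dm dn; rewrite -[n]opprK; apply: (dB) => //.
  by rewrite -sub0r; exact: dB.
have inj m n : direct_sum J m -> direct_sum J n -> phi m = phi n -> m = n.
  move=> dm dn e; apply/eqP; rewrite -subr_eq0; apply/eqP/phi0; first exact: dB.
  by apply: (addIr (phi n)); rewrite -phiD// ?subrK ?e ?add0r//; exact: dB.
have /choice[rep hrep] : forall C : quotient_group N, exists x, val C = left_coset x N.
  exact: quotientP.
have /choice[h hh] : forall C : quotient_group N,
    exists m, direct_sum J m /\ phi m = f (rep C).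
  by move=> C; have [|m dm e] := phiT (f (rep C)); [exists (rep C)|exists m].
have same x y : left_coset x N = left_coset y N <-> f x = f y.
  have E : f (x^-1 * y) = 0%R <-> f x = f y.
    rewrite hom fV; split=> [|->]; last by rewrite addNr.
    by move=> /(congr1 (fun z => f x + z)%R); rewrite addrA subrr add0r addr0.
  rewrite -E ker; exact: (left_coset_eqP x y (subgroupP N)).
have hE x : phi (h (to_quotient N x)) = f x.
  by have [_ ->] := hh (to_quotient N x); apply/same; rewrite -hrep.
exists J, h; split.
- move=> C D; have [dC eC] := hh C; have [dD' eD] := hh D.
  have [dCD eCD] := hh (C * D); apply: inj => //; first exact: dD.
  rewrite phiD// eCD eC eD -hom; apply/same; rewrite -hrep -set_mulg_lcoset -!hrep.
  by [].
- move=> C D e; apply: val_inj; rewrite !hrep; apply/same.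
  by have [_ <-] := hh C; have [_ <-] := hh D; rewrite e.
- apply/seteqP; split=> [_ [C _ <-]|m dm]; first by have [] := hh C.
  have [x _ fx] := phiB m dm; exists (to_quotient N x) => //.
  by apply: inj => //; [have [] := hh (to_quotient N x)|rewrite hE].
Qed.

(** * Kernel, range and quotient of the root map *)

Theorem theorem1 (R : realType) (G : topGroupType) (hG : tdlc G)
    (HH : subgroup (caut G)) (hHH : flat HH) :
  [/\ hom_to_additive (root_map R HH),
      [set a | root_map R HH a = 0%R] = uniscalar_part HH,
      range (root_map R HH) `<=` direct_sum (set_type (flat_roots R HH)),
      (forall a : sgType HH,
        finite_set [set rho | flat_roots R HH rho /\ rho a <> 0%R]) /\
      (exists N : normal_subgroup (sgType HH),
        (N : set (sgType HH)) = uniscalar_part HH /\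
        free_abelian (quotient_group N)) &
      flat_roots R HH = set0 <-> [set: sgType HH] = uniscalar_part HH].
Proof.
have [hs _ td] := hG; have [U tU] := hHH.
have coU : co_subgroup (U : set G).
  by apply: compact_open_co_subgroup; have [] := tU 1 (sg1 HH).
have hH : is_subgroup (HH : set (caut G)) := subgroupP HH.
have base : forall N : set G, nbhs 1 N -> exists2 V, co_subgroup V & V `<=` N.
  exact: van_dantzig hs td coU.
have minU a : sg_set HH a -> forall V, co_subgroup V ->
    (coset_index (act a U) U <= coset_index (act a V) V)%N.
  by move=> Ha; exact: tidy_minimal (tU a Ha).
have tidyU a : sg_set HH a -> tidy_for a U.
  move=> Ha; have HaV : sg_set HH a^-1 by exact: sgV.
  split=> //; first exact: minimal_factors coU (minU a Ha).
    exact: minimal_traps hs coU (minU a Ha).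
  exact: minimal_traps hs coU (minU _ HaV).
have commU := flat_comm hs coU minU R.
have uniP (a : sgType HH) : uniscalar_part HH a <-> act (val a) U = U.
  apply: uniscalar_act; apply: tU; first exact: sg_valP.
  by apply: sgV; exact: sg_valP.
have hom : hom_to_additive (root_map R HH).
  move=> a b; apply/funext => -[rho hrho]; have [+ _ _] := set_mem hrho.
  exact.
have rootP (a : sgType HH) : root_map R HH a = 0%R <-> uniscalar_part HH a.
  rewrite uniP; split=> [e|e]; last first.
    apply/funext => -[rho hrho]; exact: (root_act_eq hs coU base (set_mem hrho) e).
  apply: contrapT => /(exists_root R hs coU base tidyU commU)[rho hrho]; apply.
  by have := congr1 (fun F => F (SigSub (mem_set hrho))) e.
have pos (a : sgType HH) : finite_set [set rho | flat_roots R HH rho /\ (0 < rho a)%R].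
  have h1 rho : flat_roots R HH rho ->
      [/\ forall b c, sg_set HH b -> sg_set HH c ->
            extend_root rho (b * c) = (extend_root rho b + extend_root rho c)%R,
          forall b, sg_set HH b -> act b U = U -> extend_root rho b = 0%R,
          exists2 g, sg_set HH g & extend_root rho g = 1%R &
          (0 < extend_root rho (val a))%R ->
            ~ (act (val a) (meetU U (nneg HH (extend_root rho))) `<=` U)].
    move=> hrho; split.
    - exact: extend_rootM hrho.
    - exact: (extend_root_act hs coU base hrho).
    - exact: (extend_root1 hrho).
    - exact: (root_pos_expands hs coU base tidyU commU hrho (sg_valP a)).
  have h2 rho sigma : flat_roots R HH rho -> flat_roots R HH sigma ->
      (forall g, sg_set HH g -> extend_root rho g = extend_root sigma g) -> rho = sigma.
    move=> _ _ e; apply/funext => b.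
    by rewrite -!extend_rootE; apply: e; exact: sg_valP.
  apply: sub_finite_set (finite_rho hH coU tidyU commU (sg_valP a) h1 h2).
  by move=> rho [hrho ra]; split=> //; rewrite extend_rootE.
(* A root that does not vanish at [a] is positive at [a] or at [a^-1]. *)
have fin (a : sgType HH) : finite_set [set rho | flat_roots R HH rho /\ rho a <> 0%R].
  apply: (@sub_finite_set _ _ ([set rho | flat_roots R HH rho /\ (0 < rho a)%R] `|`
      [set rho | flat_roots R HH rho /\ (0 < rho (a^-1)%g)%R])); last by rewrite finite_setU.
  move=> rho [hrho ra]; have [rM _ _] := hrho.
  have r1 : rho 1 = 0%R by apply: (addIr (rho 1)); rewrite -rM mulg1 add0r.
  have rV : rho a^-1 = (- rho a)%R by apply: (addIr (rho a)); rewrite -rM mulVg addNr.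
  have [ra0|ra0|//] := ltgtP (rho a) 0%R; [right|left]; split=> //.
  by rewrite rV oppr_gt0.
have range_sum : range (root_map R HH) `<=` direct_sum (set_type (flat_roots R HH)).
  move=> _ [a _ <-]; rewrite /direct_sum /=.
  have := @finite_preimage _ _ _ (val : set_type (flat_roots R HH) -> _)
    (in2W val_inj) (fin a).
  apply: sub_finite_set.
  by move=> [rho hrho] ra; split=> //; exact: set_mem hrho.
have kerE : [set a | root_map R HH a = 0%R] = uniscalar_part HH.
  by apply/seteqP; split=> a; [move=> /rootP|move=> /rootP].
have u1 : uniscalar_part HH 1 by apply/uniP; exact: act1.
have uM a b : uniscalar_part HH a -> uniscalar_part HH b -> uniscalar_part HH (a * b).
  by move=> /rootP ha /rootP hb; apply/rootP; rewrite hom ha hb addr0.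
have uV a : uniscalar_part HH a -> uniscalar_part HH a^-1.
  move=> /rootP ha; apply/rootP; apply: (addIr (root_map R HH a)).
  by rewrite -hom mulVg add0r ha; apply/rootP.
have uJ a b : uniscalar_part HH b -> uniscalar_part HH (a * b * a^-1).
  move=> /rootP hb; apply/rootP; rewrite !hom hb addr0 -hom mulgV; exact/rootP.
pose N := @NormalSubgroup (sgType HH) (Subgroup u1 uM uV) uJ.
split=> //.
- split=> //; exists N; split=> //.
  apply: (@quotient_free_abelian _ N _ (root_map R HH)) => //.
- split=> [e|e].
    apply/seteqP; split=> // a _; apply/rootP; apply/funext => -[rho hrho].
    by exfalso; have := set_mem hrho; rewrite e.
  apply/seteqP; split=> // rho hrho; have [_ rT _] := hrho.
  have : range rho 1%R by rewrite rT.
  move=> [a _ ra]; have : uniscalar_part HH a by rewrite -e.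
  move=> /rootP/(congr1 (fun F => F (SigSub (mem_set hrho)))).
  by rewrite /root_map /= ra.
Qed.
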